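(* Let $D,\Omega,H,P$ and the functionals $\mathcal F,\mathcal G$ be as in the context. There exists a unique optimal zeta potential $\zeta_{0,opt}\in[a,b]$ which minimizes the cost functional $\mathcal F(\zeta_0)$ over all $\zeta_0\in[a,b]$. Likewise, there exists a unique optimal zeta potential $\zeta_{0,opt}\in[c,d]$ which minimizes the cost functional $\mathcal G(\zeta_0)$ over all $\zeta_0\in[c,d]$.
   Context: $\Omega\subset\mathbb{R}^2$ is a bounded domain and $D$ is a domain with $\overline D\subset\Omega$, both of class $C^{1,\alpha}$ for some $0<\alpha<1$; $H,P$ are harmonic functions on $\mathbb{R}^2$ (background fields); $[a,b],[c,d]\subset\mathbb{R}$ are given intervals; $\nu$ is the outward unit normal. The potential $\varphi$ solves $\Delta\varphi=0$ in $\mathbb{R}^2\setminus\overline D$, $\partial\varphi/\partial\nu=0$ on $\partial D$, $\varphi=H(x)+O(|x|^{-1})$ as $|x|\to\infty$. Cloaking functional: $$\mathcal F(\zeta_0)=\Big\|\frac{\partial P}{\partial\nu}-\frac{\partial p}{\partial\nu}-12\zeta_0\frac{\partial\varphi}{\partial\nu}\Big\|^2_{L^2(\partial\Omega)},\quad\zeta_0\in[a,b],$$ where $p$ solves $\Delta p=0$ in $\Omega\setminus\overline D$, $\partial p/\partial\nu=0$ on $\partial D$, $p=P$ on $\partial\Omega$. Shielding functional: $$\mathcal G(\zeta_0)=\Big\|\frac{\partial p}{\partial\nu}-12\zeta_0\frac{\partial\varphi}{\partial\nu}\Big\|^2_{L^2(\partial\Omega)},\quad\zeta_0\in[c,d],$$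 where $p$ solves $\Delta p=0$ in $\mathbb{R}^2\setminus\overline\Omega$, $p=0$ on $\partial\Omega$, $p=P(x)+O(|x|^{-1})$ as $|x|\to\infty$.
   Formalization: The background field H is additionally assumed non-constant: for constant H the potential φ = H has zero normal derivative, so both functionals are independent of ζ0 and uniqueness fails on any interval with more than one point. *)

(* Defs.v *)
From HB Require Import structures.
From mathcomp Require Import all_boot all_order all_algebra.
From mathcomp Require Import all_classical all_reals all_analysis.

Set Implicit Arguments.
Unset Strict Implicit.
Unset Printing Implicit Defensive.

Import Order.TTheory GRing.Theory Num.Theory.
Import numFieldNormedType.Exports.

Local Open Scope classical_set_scope.
Local Open Scope ring_scope.

Section plane.
Context {R : realType}.
Implicit Types (x y e nu : 'rV[R]_2) (U A Omega : set 'rV[R]_2).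
Implicit Types (f : 'rV[R]_2 -> R).

Definition dot x y : R := \sum_i x 0 i * y 0 i.

(* The library norm of 'rV[R]_2 is the sup norm; lengths, normals and
   arc-length measure need the Euclidean one. *)
Definition enorm x : R := Num.sqrt (dot x x).

Definition rot90 x : 'rV[R]_2 :=
  \row_(i < 2) (if i == 0 then - x 0 1 else x 0 0).

Definition bdry A : set 'rV[R]_2 := closure A `\` interior A.

Definition is_domain U : Prop := [/\ open U, connected U & U !=set0].

Definition partial (i : 'I_2) f x : R := 'D_(delta_mx 0 i) f x.

Definition grad f x : 'rV[R]_2 := \row_i partial i f x.

(* meant for open U *)
Definition C1_on U f : Prop := forall x, U x ->
  differentiable f x /\ forall i, {for x, continuous (partial i f)}.

Definition laplacian f x : R := \sum_i partial i (partial i f) x.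

Definition harmonic_on U f : Prop :=
  [/\ C1_on U f, forall i, C1_on U (partial i f) &
      forall x, U x -> laplacian f x = 0].

(* f belongs to C^1(closure U): f is continuous on closure U and its gradient
   in U has a limit at every point of closure U (hence extends continuously). *)
Definition C1_closure U f : Prop :=
  {within closure U, continuous f} /\
  forall x, closure U x -> cvg (grad f @ within U (nbhs x)).

Definition grad_trace U f x : 'rV[R]_2 := lim (grad f @ within U (nbhs x)).

(* In the disc of radius r about x0, Omega is the subgraph, in the orthonormal
   frame (rot90 e, e), of the function gamma. *)
Definition local_graph Omega x0 (r : R) e (gamma : R -> R) : Prop :=
  [/\ 0 < r, enorm e = 1 &
      forall x, enorm (x - x0) < r ->
        (Omega x <-> dot x e < gamma (dot x (rot90 e)))].

Definition C1_fun (gamma : R -> R) : Prop :=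
  (forall s, derivable gamma s 1) /\ continuous (derive1 gamma).

Definition holder_fun (alpha : R) (h : R -> R) : Prop :=
  exists C : R, forall s t, `|h s - h t| <= C * `|s - t| `^ alpha.

Definition of_class_C1alpha (alpha : R) Omega : Prop :=
  forall x0, bdry Omega x0 -> exists r e gamma,
    [/\ local_graph Omega x0 r e gamma, C1_fun gamma &
        holder_fun alpha (derive1 gamma)].

(* With rho x = dot x e - gamma (dot x (rot90 e)), Omega is locally
   {rho < 0}; the outward unit normal is the normalized gradient of rho. *)
Definition is_outward_normal Omega x nu : Prop :=
  exists r e gamma, [/\ local_graph Omega x r e gamma, C1_fun gamma &
    let v := e - derive1 gamma (dot x (rot90 e)) *: rot90 e in
    nu = (enorm v)^-1 *: v].

Definition outward_normal Omega x : 'rV[R]_2 :=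
  get [set nu | is_outward_normal Omega x nu].

(* Derivative at x along the outward normal of Omega, the gradient being taken
   from within U: U = Omega `\` ... gives the inner one-sided derivative,
   U = ~` closure Omega the outer one, and if f is C^1 near x and U is a
   neighbourhood of x it is the ordinary directional derivative. *)
Definition normal_derivative Omega U f x : R :=
  dot (grad_trace U f x) (outward_normal Omega x).

(* f x = h x + O(|x|^-1) as |x| --> +oo *)
Definition decays_to f (h : 'rV[R]_2 -> R) : Prop :=
  exists C M : R, forall x, M < enorm x -> `|f x - h x| <= C * (enorm x)^-1.

(* The supremum is taken with 0 so that the empty set has diameter 0. *)
Definition ediam A : \bar R :=
  ereal_sup (0%E |` [set (enorm (x - y))%:E | x in A & y in A]).

Definition fine_cover (delta : R) A : set (nat -> set 'rV[R]_2) :=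
  [set V | (forall k, (ediam (V k) <= delta%:E)%E) /\ A `<=` \bigcup_k V k].

Definition hausdorff1_fine (delta : R) A : \bar R :=
  ereal_inf [set (\sum_(k <oo) ediam (V k))%E | V in fine_cover delta A].

(* one-dimensional Hausdorff outer measure, normalized to be arc length *)
Definition hausdorff1 A : \bar R :=
  ereal_sup [set hausdorff1_fine delta A | delta in [set t : R | 0 < t]].

Lemma ediam_ge0 A : (0 <= ediam A)%E.
Proof. by apply: ereal_sup_ubound; left. Qed.

Lemma ediam0 : ediam set0 = 0%E.
Proof.
apply/eqP; rewrite eq_le ediam_ge0 andbT.
by apply: ge_ereal_sup => _ [->|[x []]].
Qed.

Lemma hausdorff1_fine_ge0 delta A : (0 <= hausdorff1_fine delta A)%E.
Proof.
by apply: le_ereal_inf_tmp => _ [V _ <-]; apply: nneseries_ge0 => *; exact: ediam_ge0.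
Qed.

Lemma le_hausdorff1_fine delta :
  {homo hausdorff1_fine delta : A B / A `<=` B >-> (A <= B)%E}.
Proof.
move=> A B AB; apply/ereal_inf_le_tmp => x [V [mV BV]] <-{x}.
by exists V => //; split => //; exact: subset_trans AB BV.
Qed.

Lemma hausdorff1_fine0 delta : 0 < delta -> hausdorff1_fine delta set0 = 0%E.
Proof.
move=> d0; apply/eqP; rewrite eq_le hausdorff1_fine_ge0 andbT.
apply: ereal_inf_lbound; exists (fun=> set0).
  by split => // k; rewrite ediam0 lee_fin ltW.
by apply: eseries0 => *; rewrite ediam0.
Qed.

Lemma hausdorff1_fine_sigma_subadditive delta :
  sigma_subadditive (hausdorff1_fine delta).
Proof.
move=> A; have [[i ioo]|] := pselect (exists i, hausdorff1_fine delta (A i) = +oo%E).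
  rewrite (eseries_pinfty _ _ ioo) ?leey// => n _.
  by rewrite -ltNye (lt_le_trans _ (hausdorff1_fine_ge0 _ _)).
rewrite -forallNE => Aoo.
suff add2e (e : {posnum R}) : (hausdorff1_fine delta (\bigcup_n A n) <=
    \sum_(i <oo) hausdorff1_fine delta (A i) + e%:num%:E)%E.
  by apply/lee_addgt0Pr => _/posnumP[].
rewrite (le_trans _ (epsilon_trick _ _ _))//; last first.
  by move=> n; exact: hausdorff1_fine_ge0.
pose Q n (B : nat -> set 'rV[R]_2) := fine_cover delta (A n) B /\
  (\sum_(k <oo) ediam (B k) <=
   hausdorff1_fine delta (A n) + (e%:num / (2 ^ n.+1)%:R)%:E)%E.
have [G QG] : {G : nat -> nat -> set 'rV[R]_2 & forall n, Q n (G n)}.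
  apply: (@choice _ _ Q) => n; rewrite /Q /hausdorff1_fine.
  set S := (X in ereal_inf X); move infS : (ereal_inf S) => iS.
  case: iS infS => [r Sr|Soo|Soo].
  - have en1 : (0 < e%:num / (2 ^ n.+1)%:R) by [].
    have /(lb_ereal_inf_adherent en1) : ereal_inf S \is a fin_num by rewrite Sr.
    move=> [x [B mB muBx] xS].
    by exists B; split => //; rewrite muBx -Sr; exact/ltW.
  - by have := Aoo n; rewrite /hausdorff1_fine Soo.
  - suff : lbound S 0%E by move/le_ereal_inf_tmp; rewrite Soo.
    by move=> /= _ [B _ <-]; apply: nneseries_ge0 => *; exact: ediam_ge0.
have muG_ge0 ij : (0 <= (ediam \o uncurry G) ij)%E by exact: ediam_ge0.
apply: (@le_trans _ _ (\esum_(i in setT) (ediam \o uncurry G) i)%E).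
  apply: ereal_inf_lbound => /=.
  have /card_esym/ppcard_eqP[f] := card_nat2.
  exists (uncurry G \o f).
    split => [i /=|]; first by case: (f i) => n k; exact: (QG n).1.1.
    move=> t [i _ Ait]; have [j _ Bijt] := (QG i).1.2 _ Ait.
    by exists (f^-1%FUN (i, j)) => //=; rewrite invK ?inE.
  rewrite -(esum_pred_image (ediam \o uncurry G) _ xpredT) ?[fun=> _]set_true//.
  by rewrite image_eq.
rewrite (_ : esum _ _ = \sum_(i <oo) \sum_(j <oo ) ediam (G i j))%E; last first.
  pose J : nat -> set (nat * nat) := fun i => [set (i, j) | j in setT].
  rewrite (_ : setT = \bigcup_k J k); last first.
    by rewrite predeqE => -[p q]; split => // _; exists p => //; exists q.
  rewrite esum_bigcupT /=; last 2 first.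
    - apply/trivIsetP => i j _ _ ij.
      rewrite predeqE => -[n m] /=; split => //= -[] [_] _ [<-{n} _].
      by move=> [m' _] [] /esym/eqP; rewrite (negbTE ij).
    - by move=> /= [n m]; exact: ediam_ge0.
  rewrite -(image_id [set: nat]) -fun_true esum_pred_image//; last first.
    by move=> n _; apply: esum_ge0 => *; exact: ediam_ge0.
  apply: eq_eseriesr => /= j _.
  rewrite -(esum_pred_image (ediam \o uncurry G) (pair j) predT)//=; last 2 first.
  - by move=> *; exact: ediam_ge0.
  - by move=> ? ? _ _; exact: (@can_inj _ _ _ snd).
  by congr esum; rewrite predeqE => -[p q]; split; move=> [i _ <-]; exists i.
apply: lee_lim.
- apply: is_cvg_nneseries => n *.
  by apply: nneseries_ge0 => m *; exact: (muG_ge0 (n, m)).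
- by apply: is_cvg_nneseries => n *; apply: adde_ge0 => //; exact: hausdorff1_fine_ge0.
- by near=> n; apply: lee_sum => i _; exact: (QG i).2.
Unshelve. all: by end_near. Qed.

Lemma hausdorff1_ge0 A : (0 <= hausdorff1 A)%E.
Proof.
apply: le_trans (hausdorff1_fine_ge0 1 A) _.
by apply: ereal_sup_ubound; exists 1 => //=.
Qed.

Lemma hausdorff1_0 : hausdorff1 set0 = 0%E.
Proof.
apply/eqP; rewrite eq_le hausdorff1_ge0 andbT.
by apply: ge_ereal_sup => _ [t t0 <-]; rewrite hausdorff1_fine0.
Qed.

Lemma le_hausdorff1 : {homo hausdorff1 : A B / A `<=` B >-> (A <= B)%E}.
Proof.
move=> A B AB; apply: ge_ereal_sup => _ [t t0 <-].
apply: le_trans (le_hausdorff1_fine t AB) _.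
by apply: ereal_sup_ubound; exists t.
Qed.

Lemma hausdorff1_sigma_subadditive : sigma_subadditive hausdorff1.
Proof.
move=> A; apply: ge_ereal_sup => _ [t t0 <-].
apply: le_trans (hausdorff1_fine_sigma_subadditive t A) _.
apply: lee_nneseries => [i _ _|i _]; first exact: hausdorff1_fine_ge0.
by apply: ereal_sup_ubound; exists t.
Qed.

HB.instance Definition _ := isOuterMeasure.Build R 'rV[R]_2 hausdorff1
  hausdorff1_0 hausdorff1_ge0 le_hausdorff1 hausdorff1_sigma_subadditive.

Definition hausdorff1_outer : {outer_measure set 'rV[R]_2 -> \bar R} :=
  hausdorff1.

(* Borel sets are Caratheodory measurable for the metric outer measure
   hausdorff1, so this extends arc length on Borel sets. *)
Definition arc_length :
    {measure set (caratheodory_type hausdorff1_outer) -> \bar R} :=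
  hausdorff1_outer : set (caratheodory_type hausdorff1_outer) -> \bar R.

Definition L2norm (Gamma : set 'rV[R]_2) f : \bar R :=
  ('N[arc_length]_2%:E[EFin \o (f \_ Gamma)])%E.

End plane.

Section electroosmosis.
Context {R : realType}.
Implicit Types (Omega D : set 'rV[R]_2) (H P phi p : 'rV[R]_2 -> R).

Definition is_potential D H phi : Prop :=
  let U := ~` closure D in
  [/\ harmonic_on U phi, C1_closure U phi,
      forall x, bdry D x -> normal_derivative D U phi x = 0 &
      decays_to phi H].

Definition is_cloaking_pressure Omega D P p : Prop :=
  let U := Omega `\` closure D in
  [/\ harmonic_on U p, C1_closure U p,
      forall x, bdry D x -> normal_derivative D U p x = 0 &
      forall x, bdry Omega x -> p x = P x].

Definition is_shielding_pressure Omega P p : Prop :=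
  let U := ~` closure Omega in
  [/\ harmonic_on U p, C1_closure U p,
      forall x, bdry Omega x -> p x = 0 &
      decays_to p P].

Definition cloaking_functional Omega D P phi p (zeta0 : R) : \bar R :=
  (L2norm (bdry Omega) (fun x : 'rV[R]_2 => (
     normal_derivative Omega setT P x
     - normal_derivative Omega (Omega `\` closure D) p x
     - 12 * zeta0 * normal_derivative Omega (~` closure D) phi x)%R) ^+ 2)%E.

Definition shielding_functional Omega D phi p (zeta0 : R) : \bar R :=
  (L2norm (bdry Omega) (fun x : 'rV[R]_2 => (
     normal_derivative Omega (~` closure Omega) p x
     - 12 * zeta0 * normal_derivative Omega (~` closure D) phi x)%R) ^+ 2)%E.

Definition minimizes (F : R -> \bar R) (I : set R) (z : R) : Prop :=
  I z /\ forall w, I w -> (F z <= F w)%E.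

End electroosmosis.

(* Main.v *)
(* Both functionals are squared L^2 norms of g - 12 z h on the boundary of
   Omega, where h is the normal derivative of phi.  The fields g and h are
   continuous on this compact set of finite length, so the functionals are
   quadratic polynomials in z with leading coefficient 144 |h|^2, and it only
   remains to see that h does not vanish identically.

   Suppose that it does.  Let W be the unbounded component of the complement of
   closure D and A its part inside Omega.  Then phi has zero normal derivative on
   the whole boundary of A, which together with the maximum principle makes phi
   attain its maximum over closure A inside A.  Hence phi is constant on an
   open subset of A, and on W by unique continuation, so H tends to a constant
   at infinity and is constant by the maximum principle on large discs. *)

Require Import Defs.
From mathcomp Require Import all_boot all_order all_algebra.
From mathcomp Require Import finmap ring lra.
From mathcomp Require Import all_classical all_reals all_analysis.

Set Implicit Arguments.
Unset Strict Implicit.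
Unset Printing Implicit Defensive.

Import Order.TTheory GRing.Theory Num.Theory.
Import numFieldNormedType.Exports.

Local Open Scope classical_set_scope.
Local Open Scope ring_scope.

(** * Euclidean geometry and directional derivatives in the plane *)

Section plane_basics.
Context {R : realType}.
Implicit Types (x y z e v : 'rV[R]_2) (f : 'rV[R]_2 -> R).

(** The hypothesis [nonconstH] is what uniqueness rests on: for constant [H] the potential [phi = H]
    has no flux, and the functionals do not depend on zeta. The complement of [closure D] may be
    disconnected, and only its unbounded component sees the condition at infinity; this is why [W]
    and [A] replace the complement and its part in [Omega]. That [A] still has a [C^1] boundary
    comes from the exterior of [D] being connected near each boundary point. The difficulty is a
    maximum located on a boundary that is merely [C^1]. The argument there, like the strong maximum
    principle and unique continuation, is reduced to comparing values at a maximum: explicit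
    strictly subharmonic barriers, and holomorphic quotients on annuli, are fed into one weak
    maximum principle. Since length is a Hausdorff measure, the quadratic form of the functional
    requires three geometric facts: open and closed sets are measurable, the boundary has finite
    length, and each of its relatively open nonempty pieces has positive length. The last one makes
    the leading coefficient positive as soon as the flux is nonzero at one point. *)

Lemma dotE x y : dot x y = x 0 0 * y 0 0 + x 0 1 * y 0 1.
Proof.
by rewrite /dot big_ord_recl big_ord1 (_ : lift ord0 ord0 = 1)//; exact/val_inj.
Qed.

Lemma ord2E (i : 'I_2) : i = 0 \/ i = 1.
Proof. by case: i => [[|[|//]] h]; [left|right]; apply/val_inj. Qed.

Lemma row2P x y : x 0 0 = y 0 0 -> x 0 1 = y 0 1 -> x = y.
Proof. by move=> h0 h1; apply/rowP => i; case: (ord2E i) => ->. Qed.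

Lemma dotC x y : dot x y = dot y x. Proof. by rewrite !dotE; ring. Qed.

Lemma dotDl x y z : dot (x + y) z = dot x z + dot y z.
Proof. by rewrite !dotE !mxE; ring. Qed.

Lemma dotDr x y z : dot z (x + y) = dot z x + dot z y.
Proof. by rewrite !dotE !mxE; ring. Qed.

Lemma dotNl x y : dot (- x) y = - dot x y.
Proof. by rewrite !dotE !mxE; ring. Qed.

Lemma dotNr x y : dot y (- x) = - dot y x.
Proof. by rewrite !dotE !mxE; ring. Qed.

Lemma dotBl x y z : dot (x - y) z = dot x z - dot y z.
Proof. by rewrite dotDl dotNl. Qed.

Lemma dotBr x y z : dot z (x - y) = dot z x - dot z y.
Proof. by rewrite dotDr dotNr. Qed.

Lemma dotZl (k : R) x y : dot (k *: x) y = k * dot x y.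
Proof. by rewrite !dotE !mxE; ring. Qed.

Lemma dotZr (k : R) x y : dot y (k *: x) = k * dot y x.
Proof. by rewrite !dotE !mxE; ring. Qed.

Lemma dot_rot90 x y : dot (rot90 x) (rot90 y) = dot x y.
Proof. by rewrite !dotE !mxE /=; ring. Qed.

Lemma dotx_rot90 x : dot x (rot90 x) = 0.
Proof. by rewrite !dotE !mxE /=; ring. Qed.

Lemma rot90N x : rot90 (- x) = - rot90 x.
Proof. by apply: row2P; rewrite !mxE /=. Qed.

Lemma dot_ge0 x : 0 <= dot x x.
Proof. by rewrite dotE; nra. Qed.

Lemma enorm_ge0 x : 0 <= enorm x. Proof. exact: sqrtr_ge0. Qed.

Lemma sqr_enorm x : enorm x ^+ 2 = dot x x.
Proof. by rewrite sqr_sqrtr// dot_ge0. Qed.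

Lemma enorm1 e : enorm e = 1 -> dot e e = 1.
Proof. by move=> h; rewrite -sqr_enorm h expr1n. Qed.

Lemma enorm_lt x (r : R) : 0 <= r -> (enorm x < r) = (dot x x < r ^+ 2).
Proof. by move=> r0; rewrite -sqr_enorm ltr_pXn2r// nnegrE enorm_ge0. Qed.

Lemma enorm_le x (r : R) : 0 <= r -> (enorm x <= r) = (dot x x <= r ^+ 2).
Proof. by move=> r0; rewrite -sqr_enorm ler_pXn2r// nnegrE enorm_ge0. Qed.

Lemma enormN x : enorm (- x) = enorm x.
Proof. by rewrite /enorm dotNl dotNr opprK. Qed.

Lemma enormZ (k : R) x : enorm (k *: x) = `|k| * enorm x.
Proof.
by rewrite /enorm dotZl dotZr mulrA -expr2 sqrtrM ?sqr_ge0// sqrtr_sqr.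
Qed.

Lemma normr_dot x y : `|dot x y| <= enorm x * enorm y.
Proof.
rewrite -(@ler_pXn2r _ 2)// ?nnegrE ?mulr_ge0 ?enorm_ge0//.
rewrite exprMn !sqr_enorm real_normK ?num_real// !dotE.
have := sqr_ge0 (x 0 0 * y 0 1 - x 0 1 * y 0 0); nra.
Qed.

Lemma ler_enormD x y : enorm (x + y) <= enorm x + enorm y.
Proof.
rewrite enorm_le ?addr_ge0 ?enorm_ge0// sqrrD !sqr_enorm dotDl !dotDr (dotC y x).
have := normr_dot x y; have := ler_norm (dot x y); nra.
Qed.

Lemma coord_le_norm x i : `|x 0 i| <= `|x|.
Proof.
rewrite [leRHS]/Num.norm /= mx_normrE; apply/bigmax_geP; right => /=.
by exists (0, i).
Qed.

Lemma norm_le_coord x (M : R) : `|x 0 0| <= M -> `|x 0 1| <= M -> `|x| <= M.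
Proof.
move=> h0 h1; rewrite [leLHS]/Num.norm /= mx_normrE; apply/bigmax_leP; split.
  exact: le_trans h0.
by move=> [i j] _ /=; rewrite ord1; case: (ord2E j) => ->.
Qed.

Lemma norm_lt_coord x (M : R) : `|x 0 0| < M -> `|x 0 1| < M -> `|x| < M.
Proof.
move=> h0 h1; apply: le_lt_trans (_ : Num.max `|x 0 0| `|x 0 1| < M).
  by apply: norm_le_coord; rewrite le_max lexx ?orbT.
by rewrite gt_max h0.
Qed.

Lemma normr_le_enorm x : `|x| <= enorm x.
Proof.
apply: norm_le_coord; rewrite -(@ler_pXn2r _ 2)// ?nnegrE ?enorm_ge0//;
  rewrite sqr_enorm real_normK ?num_real// dotE; nra.
Qed.

Lemma enorm_le_normr x : enorm x <= 2 * `|x|.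
Proof.
rewrite enorm_le ?mulr_ge0// dotE.
have := coord_le_norm x 0; have := coord_le_norm x 1.
rewrite -(@ler_pXn2r _ 2)// ?nnegrE// real_normK ?num_real// => h1.
rewrite -(@ler_pXn2r _ 2)// ?nnegrE// real_normK ?num_real//.
have := sqr_ge0 `|x|; nra.
Qed.

Lemma pythag e x : enorm e = 1 ->
  dot x x = dot x e ^+ 2 + dot x (rot90 e) ^+ 2.
Proof.
move=> /enorm1; rewrite !dotE !mxE /= => e1.
rewrite -[LHS]mulr1 -{1}e1; ring.
Qed.

Lemma frameE e x : enorm e = 1 ->
  x = dot x e *: e + dot x (rot90 e) *: rot90 e.
Proof.
move=> /enorm1; rewrite !dotE !mxE /= => e1.
by apply: row2P; rewrite !mxE /= -[LHS]mulr1 -{1}e1; ring.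
Qed.

(** The topology of ['rV[R]_2] comes from the sup norm, whereas charts and barriers live on
    Euclidean discs; the inequalities [|x| <= enorm x <= 2 * |x|] translate between them. *)
Lemma nbhs_enormP x (A : set 'rV[R]_2) :
  nbhs x A <-> exists2 d : R, 0 < d & forall y, enorm (y - x) < d -> A y.
Proof.
split=> [/nbhs_normP[d /= d0 h]|[d d0 h]].
  exists d => // y yd; apply: h => /=; rewrite distrC.
  exact: le_lt_trans (normr_le_enorm _) yd.
apply/(@nbhs_normP R 'rV[R]_2); exists (d / 2); first by rewrite /= divr_gt0.
move=> y /=; rewrite distrC => yd; apply: h.
apply: le_lt_trans (enorm_le_normr _) _; lra.
Qed.

Lemma continuous_coord (i : 'I_2) : continuous (fun x : 'rV[R]_2 => x 0 i).
Proof. exact: coord_continuous. Qed.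

Lemma continuous_dotl y : continuous (fun x => dot x y).
Proof.
move=> x; rewrite (_ : (fun x => dot x y) = (fun x => x 0 0 * y 0 0 + x 0 1 * y 0 1)).
  have h i : (fun z : 'rV[R]_2 => z 0 i) @ x --> x 0 i by exact: continuous_coord.
  exact: (cvgD (cvgM (h 0) (cvg_cst _)) (cvgM (h 1) (cvg_cst _))).
by apply/funext => z; rewrite dotE.
Qed.

Lemma continuous_dist2 y : continuous (fun x => dot (x - y) (x - y)).
Proof.
move=> x.
rewrite (_ : (fun x => _) = (fun x => (x 0 0 - y 0 0) * (x 0 0 - y 0 0) +
   (x 0 1 - y 0 1) * (x 0 1 - y 0 1))); last first.
  by apply/funext => z; rewrite dotE !mxE.
have h i : (fun z : 'rV[R]_2 => z 0 i - y 0 i) @ x --> x 0 i - y 0 i.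
  have h0 : (fun z : 'rV[R]_2 => z 0 i) @ x --> x 0 i by exact: continuous_coord.
  exact: (cvgB h0 (cvg_cst _)).
exact: (cvgD (cvgM (h 0) (h 0)) (cvgM (h 1) (h 1))).
Qed.

Lemma is_derive_line f x v (t d : R) :
  is_derive (x + t *: v) v f d -> is_derive t 1 (fun s : R => f (x + s *: v)) d.
Proof.
have E : (fun h : R => h^-1 *: ((f \o shift (x + t *: v)) (h *: v) - f (x + t *: v))) =
   (fun h : R => h^-1 *: (((fun s => f (x + s *: v)) \o shift t) (h *: 1) - f (x + t *: v))).
  apply/funext => h /=; congr (_ *: (f _ - _)).
  by rewrite [h *: 1]mulr1 scalerDl addrCA.
move=> [dv dE]; split; first by move: dv; rewrite /derivable E.
by rewrite -dE /derive E.
Qed.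

Lemma is_derive_line0 f x v (d : R) :
  is_derive (0 : R) 1 (fun s : R => f (x + s *: v)) d -> is_derive x v f d.
Proof.
have E : (fun h : R => h^-1 *: ((f \o shift x) (h *: v) - f x)) =
   (fun h : R => h^-1 *: (((fun s => f (x + s *: v)) \o shift 0) (h *: 1) - f (x + 0 *: v))).
  apply/funext => h /=; congr (_ *: (f _ - f _)); last by rewrite scale0r addr0.
  by rewrite [h *: 1]mulr1 addr0 addrC.
move=> [dv dE]; split; first by move: dv; rewrite /derivable E.
by rewrite -dE /derive E.
Qed.

Lemma gradE f x i : grad f x 0 i = partial i f x.
Proof. by rewrite mxE. Qed.

Lemma derive_grad f x v : differentiable f x -> is_derive x v f (dot (grad f x) v).
Proof.
move=> df; split; first exact: diff_derivable.
rewrite deriveE// dotE !gradE /partial !deriveE//.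
have -> : v = v 0 0 *: delta_mx 0 0 + v 0 1 *: delta_mx 0 1.
  by apply: row2P; rewrite !mxE /= ?mulr1 ?mulr0 ?addr0 ?add0r.
rewrite linearD !linearZ /= !mxE /= !mulr1 !mulr0 addr0 add0r.
by congr (_ + _); rewrite mulrC.
Qed.

End plane_basics.

(** * The weak maximum principle *)

Section max_principle.
Context {R : realType}.
Notation V := 'rV[R]_2.
Implicit Types (x y z e v : V) (A K : set V).

(** [f1] vanishes at the maximum [c]; if its derivative there were positive, [f1] would be positive
    just to the right of [c], and [f] would increase there by the mean value theorem. *)
Lemma deriv2_at_max (f f1 : R -> R) (c d r : R) : 0 < r ->
  (forall t, `|t - c| < r -> is_derive t 1 f (f1 t)) ->
  is_derive c 1 f1 d -> (forall t, `|t - c| < r -> f t <= f c) -> d <= 0.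
Proof.
move=> r0 df df1 fmax; rewrite leNgt; apply/negP => d0.
have inr t : t \in `](c - r), (c + r)[%R -> `|t - c| < r.
  by rewrite in_itv/= => /andP[h1 h2]; rewrite ltr_norml; lra.
have f1c : f1 c = 0.
  have dc : is_derive c 1 f 0.
    apply: (@derive1_at_max R f (c - r) (c + r)).
    - lra.
    - by move=> t /inr ht; have [] := df _ ht.
    - by rewrite in_itv/=; lra.
    - by move=> t /inr; exact: fmax.
  have := df c; rewrite subrr normr0 => /(_ r0) h.
  by rewrite -[LHS](@derive_val _ _ _ _ _ _ _ h) (@derive_val _ _ _ _ _ _ _ dc).
have [dd dv] := df1.
have lim1 : (fun h : R => h^-1 *: ((f1 \o shift c) (h *: 1) - f1 c)) @ 0^' --> d.
  by rewrite -dv; exact: dd.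
have : \forall h \near 0^', 0 < h^-1 *: ((f1 \o shift c) (h *: (1:R)) - f1 c).
  exact: (cvgr_gt _ lim1 _ d0).
move=> [/= e e0 he].
pose s := Num.min e r / 2.
have m0 : 0 < Num.min e r by rewrite lt_min e0 r0.
have s0 : 0 < s by rewrite /s divr_gt0.
have se : s < e.
  have : Num.min e r <= e by rewrite ge_min lexx.
  by rewrite /s; lra.
have sr : s < r.
  have : Num.min e r <= r by rewrite ge_min lexx orbT.
  by rewrite /s; lra.
have pos t : c < t <= c + s -> 0 < f1 t.
  move=> /andP[ct ts]; have /= := he (t - c).
  rewrite sub0r normrN ger0_norm ?subr_ge0 ?ltW// => /(_ ltac:(lra)).
  rewrite subr_eq0 gt_eqF// => /(_ isT).
  rewrite [(t - c) *: 1]mulr1 subrK f1c subr0 => h.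
  by rewrite -(pmulr_rgt0 (x := (t - c)^-1))// invr_gt0 subr_gt0.
have [xi xii] : exists2 xi, xi \in `]c, (c + s)[%R & f (c + s) - f c = f1 xi * (c + s - c).
  apply: MVT; first lra.
  - by move=> t; rewrite in_itv/= => /andP[h1 h2]; apply: df; rewrite ltr_norml; lra.
  - apply: derivable_within_continuous => t; rewrite in_itv/= => /andP[h1 h2].
    by have [] : is_derive t 1 f (f1 t) by apply: df; rewrite ltr_norml; lra.
have := fmax (c + s); rewrite addrAC subrr add0r gtr0_norm// => /(_ sr) le.
move: xii; rewrite in_itv/= => /andP[h1 h2] E.
have : 0 < f1 xi * s by rewrite mulr_gt0// pos// h1 ltW.
by rewrite -E; lra.
Qed.

(** Derivatives are carried as explicit functions so that the Laplacian of a perturbation or of a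
    barrier can be computed term by term. Pure second partials are what a comparison at a maximum
    sees. *)
Definition twice_partial A f (f1 f2 : 'I_2 -> V -> R) : Prop :=
  forall i x, A x -> is_derive x (delta_mx 0 i) f (f1 i x) /\
                     is_derive x (delta_mx 0 i) (f1 i) (f2 i x).

Lemma twice_partialS A B f f1 f2 : B `<=` A ->
  twice_partial A f f1 f2 -> twice_partial B f f1 f2.
Proof. by move=> BA h i x /BA; exact: h. Qed.

Lemma harmonic_twice A f : harmonic_on A f ->
  twice_partial A f (partial^~ f) (fun i => partial i (partial i f)).
Proof.
move=> [c0 c1 _] i x Ax; split; apply: DeriveDef => //; apply: diff_derivable.
  by have [] := c0 x Ax.
by have [] := c1 i x Ax.
Qed.

Lemma twice_partialDZ A f f1 f2 g g1 g2 (k : R) :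
  twice_partial A f f1 f2 -> twice_partial A g g1 g2 ->
  twice_partial A (fun x => f x + k * g x) (fun i x => f1 i x + k * g1 i x)
    (fun i x => f2 i x + k * g2 i x).
Proof.
move=> hf hg i x Ax; have [a b] := hf i x Ax; have [c d] := hg i x Ax.
by split; [exact: (is_deriveD a (is_deriveZ k c)) | exact: (is_deriveD b (is_deriveZ k d))].
Qed.

Lemma laplacian_at_max A f f1 f2 x : open A -> A x -> twice_partial A f f1 f2 ->
  (\forall z \near x, f z <= f x) -> f2 0 x + f2 1 x <= 0.
Proof.
move=> oA Ax tp fmax.
have /nbhs_enormP[d d0 hd] : \forall z \near x, A z /\ f z <= f x.
  by apply: filterI => //; exact: open_nbhs_nbhs.
suff h i : f2 i x <= 0 by have := h 0; have := h 1; lra.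
pose e : V := delta_mx 0 i.
have inb t : `|t| < d -> enorm (x + t *: e - x) < d.
  move=> td; rewrite addrAC subrr add0r enormZ.
  suff -> : enorm e = 1 by rewrite mulr1.
  rewrite /enorm /e dotE; case: (ord2E i) => ->; rewrite !mxE/= ?mulr0 ?mulr1 ?addr0 ?add0r;
    exact: sqrtr1.
apply: (@deriv2_at_max (fun t => f (x + t *: e)) (fun t => f1 i (x + t *: e)) 0 _ d) => //.
- move=> t; rewrite subr0 => /inb /hd[At _]; apply: is_derive_line.
  by have [] := tp i _ At.
- apply: is_derive_line; rewrite scale0r addr0.
  by have [] := tp i _ Ax.
- by move=> t; rewrite subr0 scale0r addr0 => /inb /hd[].
Qed.

Lemma is_derive_coord x v (i : 'I_2) : is_derive x v (fun z : V => z 0 i) (v 0 i).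
Proof.
apply: is_derive_line0.
have -> : (fun s : R => (x + s *: v) 0 i) = (fun s => x 0 i + s * v 0 i).
  by apply/funext => s; rewrite !mxE.
have h : is_derive (0 : R) 1 (fun s : R => x 0 i + s * v 0 i) (0 + (0 *: 0 + v 0 i *: 1)).
  exact: (is_deriveD (is_derive_cst _ _ _) (is_deriveM (is_derive_id _ _) (is_derive_cst _ _ _))).
by apply: is_derive_eq h _; rewrite [_ *: 0]mulr0 [_ *: 1]mulr1 !add0r.
Qed.

Lemma is_derive_dist2 x y v :
  is_derive x v (fun z => dot (z - y) (z - y)) (2 * dot (x - y) v).
Proof.
rewrite (_ : (fun z => _) = (fun z => (z 0 0 - y 0 0) * (z 0 0 - y 0 0) +
   (z 0 1 - y 0 1) * (z 0 1 - y 0 1))); last first.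
  by apply/funext => z; rewrite dotE !mxE.
have h i := is_deriveB (is_derive_coord x v i) (is_derive_cst (y 0 i) x v).
apply: is_derive_eq (is_deriveD (is_deriveM (h 0) (h 0)) (is_deriveM (h 1) (h 1))) _.
rewrite /GRing.scale /= dotE !mxE /=.
rewrite !fctE /=; ring.
Qed.

Lemma is_derive_inv (f : V -> R) x v (d : R) : f x != 0 -> is_derive x v f d ->
  is_derive x v (fun z => (f z)^-1) (- (f x) ^- 2 * d).
Proof.
move=> f0 [dv dE]; split; first exact: derivableV.
by rewrite deriveV// dE.
Qed.

Definition dist2 y x : R := dot (x - y) (x - y).

Lemma dist2_delta x y i : dot (x - y) (delta_mx 0 i) = x 0 i - y 0 i.
Proof.
by rewrite dotE; case: (ord2E i) => ->; rewrite !mxE/= !(mulr0,mulr1) ?addr0 ?add0r.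
Qed.

Lemma twice_partial_dist2 y : twice_partial setT (dist2 y)
  (fun i x => 2 * (x 0 i - y 0 i)) (fun i x => 2).
Proof.
move=> i x _; split.
  by apply: is_derive_eq (is_derive_dist2 x y _) _; rewrite dist2_delta.
have h := is_deriveZ 2 (is_deriveB (is_derive_coord x (delta_mx 0 i) i) (is_derive_cst (y 0 i) x _)).
apply: is_derive_eq h _.
by rewrite mxE !eqxx /= subr0 [_ *: 1]mulr1.
Qed.

Lemma twice_partial_invdist2 y : twice_partial [set x | 0 < dist2 y x] (fun x => (dist2 y x)^-1)
  (fun i x => - (2 * (x 0 i - y 0 i)) * ((dist2 y x)^-1 * (dist2 y x)^-1))
  (fun i x => - 2 * (dist2 y x)^-1 ^+ 2 + 8 * (x 0 i - y 0 i) ^+ 2 * (dist2 y x)^-1 ^+ 3).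
Proof.
move=> i x /= q0; have q1 : dist2 y x != 0 by rewrite gt_eqF.
have [h1 h2] := twice_partial_dist2 y i (x:=x) I.
have h3 := is_derive_inv q1 h1.
split; first by apply: is_derive_eq h3 _; rewrite -exprVn; ring.
apply: is_derive_eq (is_deriveM (is_deriveN h2) (is_deriveM h3 h3)) _.
rewrite /GRing.scale /= !fctE -exprVn; ring.
Qed.

(** In the plane the Laplacian of |x|^s is s^2 |x|^(s-2), so this sum is 4 |x - y|^-4. The exponent
    -2 makes the barrier rational in the coordinates and, unlike the logarithm, strictly
    subharmonic. *)
Lemma laplacian_invdist2 y x : 0 < dist2 y x ->
  0 < (- 2 * (dist2 y x)^-1 ^+ 2 + 8 * (x 0 0 - y 0 0) ^+ 2 * (dist2 y x)^-1 ^+ 3) +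
      (- 2 * (dist2 y x)^-1 ^+ 2 + 8 * (x 0 1 - y 0 1) ^+ 2 * (dist2 y x)^-1 ^+ 3).
Proof.
move=> q0; set q := dist2 y x in q0 *.
have E : (x 0 0 - y 0 0) ^+ 2 + (x 0 1 - y 0 1) ^+ 2 = q.
  by rewrite /q /dist2 dotE !mxE !expr2.
have -> : forall a b : R, a + b = q ->
  (- 2 * q^-1 ^+ 2 + 8 * a * q^-1 ^+ 3) + (- 2 * q^-1 ^+ 2 + 8 * b * q^-1 ^+ 3) =
  4 * q^-1 ^+ 2.
  move=> a b ab; have -> : b = q - a by lra.
  by field; lra.
- by rewrite mulr_gt0// exprn_gt0// invr_gt0.
- exact: E.
Qed.

Lemma within_continuousDZ K (f g : V -> R) (k : R) : {within K, continuous f} ->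
  continuous g -> {within K, continuous (fun x => f x + k * g x)}.
Proof.
move=> cf cg x.
have hg : g @ nbhs (x : subspace K) --> g x := continuous_subspaceT cg (x:=x).
have hc : (fun=> k) @ nbhs (x : subspace K) --> k by exact: cvg_cst.
exact: (cvgD (cf x) (cvgM hc hg)).
Qed.

Lemma bounded_closure A : bounded_set A -> bounded_set (closure A).
Proof.
move=> [M [Mr hM]]; exists M; split => // N MN x.
have [N' MN' N'N] : exists2 N' : R, M < N' & N' < N by exists ((M + N) / 2); lra.
move=> cl; have [y [Ay /= yx]] := cl _ (nbhsx_ballx x (N - N') ltac:(by rewrite subr_gt0)).
have := hM _ MN' y Ay; move: yx; rewrite -ball_normE /= => yx yN.
have := ler_normD (x - y) y; rewrite subrK; lra.
Qed.

Lemma compact_closure A : bounded_set A -> compact (closure A).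
Proof.
move=> bA; apply: bounded_closed_compact; first exact: bounded_closure.
exact: closed_closure.
Qed.

(** Adding [eps * dist2 0] makes the Laplacian strictly positive, so the perturbed function cannot
    attain its maximum in the open set; [eps] is so small that the excess of [f x0] over [M] is
    still visible on the boundary. *)
Lemma weak_max A f f1 f2 (M : R) : open A -> bounded_set A ->
  {within closure A, continuous f} -> twice_partial A f f1 f2 ->
  (forall x, A x -> 0 <= f2 0 x + f2 1 x) ->
  (forall x, closure A x -> ~ A x -> f x <= M) ->
  forall x, closure A x -> f x <= M.
Proof.
move=> oA bA cf tp lap bd x0 Ax0; rewrite leNgt; apply/negP => Mx0.
have cA := compact_closure bA.
have [Q Q0 hQ] : exists2 Q : R, 0 < Q & forall x, closure A x -> dist2 0 x <= Q.
  have [Q [Qr hQ]] := bounded_closure bA.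
  pose N := `|Q| + 1; exists (4 * N ^+ 2); first by rewrite mulr_gt0// exprn_gt0// /N ltr_pwDr.
  move=> x /(hQ N) h; rewrite /dist2 subr0 -sqr_enorm.
  have : `|x| <= N by apply: h; rewrite /N; have := ler_norm Q; lra.
  have := enorm_le_normr x; have := enorm_ge0 x; have : 0 <= `|x| by []; nra.
(* As [Q] bounds [dist2 0] on [closure A], the perturbation is at most half the excess of [f x0]
   over [M]. *)
pose eps := (f x0 - M) / (2 * Q).
have eps0 : 0 < eps by rewrite divr_gt0// ?subr_gt0// mulr_gt0.
pose g x := f x + eps * dist2 0 x.
have cg : {within closure A, continuous g}.
  exact: within_continuousDZ cf (@continuous_dist2 R 0).
have [|x1 /[!inE] Ax1 gmax] := compact_EVT_max _ cA cg; first by exists x0.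
have gx1 : M + eps * Q < g x1.
  apply: lt_le_trans (gmax x0 _); last by rewrite inE.
  have -> : eps * Q = (f x0 - M) / 2 by rewrite /eps; field; lra.
  have : 0 <= eps * dist2 0 x0 by rewrite mulr_ge0 ?dot_ge0// ltW.
  rewrite /g; lra.
have [Ax1'|Ax1'] := pselect (A x1).
  have l1 := lap _ Ax1'.
  suff gm : \forall z \near x1, g z <= g x1.
    have /= := laplacian_at_max oA Ax1' (twice_partialDZ eps tp
      (twice_partialS (@subsetT _ A) (twice_partial_dist2 0))) gm.
    by lra.
  apply: (filterS _ (open_nbhs_nbhs (conj oA Ax1'))) => z Az.
  by apply: gmax; rewrite inE; exact: subset_closure.
have := bd _ Ax1 Ax1'; have := hQ _ Ax1; move: gx1; rewrite /g => *.
have : eps * dist2 0 x1 <= eps * Q by rewrite ler_pM2l.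
lra.
Qed.

End max_principle.

(** * Domains as local subgraphs, and their normals *)

Section charts.
Context {R : realType}.
Notation V := 'rV[R]_2.
Implicit Types (x y z e v : V) (Omega D : set V) (gamma : R -> R).

(* The graph of gamma in the frame (rot90 e, e) is the zero set of
   x |-> dot x e - gamma (dot x (rot90 e)), whose gradient this is. *)
Definition graph_normal e gamma x : V :=
  e - derive1 gamma (dot x (rot90 e)) *: rot90 e.

Lemma graph_normal_dot e gamma x v :
  dot v (graph_normal e gamma x) = dot v e - derive1 gamma (dot x (rot90 e)) * dot v (rot90 e).
Proof. by rewrite dotBr dotZr. Qed.

Lemma graph_normal_sqr e gamma x : enorm e = 1 ->
  dot (graph_normal e gamma x) (graph_normal e gamma x) =
  1 + derive1 gamma (dot x (rot90 e)) ^+ 2.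
Proof.
move=> e1; rewrite (pythag _ e1) /graph_normal !dotBl !dotZl.
by rewrite dot_rot90 (dotC _ e) dotx_rot90 enorm1// ; ring.
Qed.

Lemma graph_normal_enorm_gt0 e gamma x : enorm e = 1 -> 0 < enorm (graph_normal e gamma x).
Proof.
move=> e1; rewrite /enorm sqrtr_gt0 graph_normal_sqr//.
by rewrite ltr_pwDl// sqr_ge0.
Qed.

Lemma local_graph_shrink Omega x0 r e gamma x r' : local_graph Omega x0 r e gamma ->
  0 < r' -> enorm (x - x0) + r' <= r -> local_graph Omega x r' e gamma.
Proof.
move=> [r0 e1 h] r'0 xr; split => // y yx; apply: h.
apply: le_lt_trans (_ : enorm (y - x) + enorm (x - x0) < r).
  by apply: le_trans (ler_enormD _ _); rewrite addrA subrK.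
lra.
Qed.

Lemma local_graph_eq Omega Omega' x0 r e gamma :
  local_graph Omega x0 r e gamma ->
  (forall x, enorm (x - x0) < r -> (Omega x <-> Omega' x)) ->
  local_graph Omega' x0 r e gamma.
Proof. by move=> [r0 e1 h] E; split => // x xr; rewrite -E//; exact: h. Qed.

Lemma C1_fun_continuous gamma : C1_fun gamma -> continuous gamma.
Proof. by move=> [dg _] s; exact/differentiable_continuous/derivable1_diffP. Qed.

Lemma C1_fun_MVT gamma (s t : R) : C1_fun gamma ->
  exists2 c : R, `|c - s| <= `|t - s| & gamma t - gamma s = derive1 gamma c * (t - s).
Proof.
move=> cg.
have dg (c : R) : is_derive c 1 gamma (derive1 gamma c).
  by rewrite derive1E; apply: derivableP; have [] := cg.
have cgam (a b : R) : {within `[a, b], continuous gamma}.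
  by apply: continuous_subspaceT; exact: C1_fun_continuous.
have [lt|le] := leP s t.
  have [c] := MVT_segment lt (fun c _ => dg c) (cgam _ _).
  rewrite in_itv/= => /andP[c1 c2] E; exists c => //.
  by rewrite !ger0_norm; lra.
have [c] := MVT_segment (ltW le) (fun c _ => dg c) (cgam _ _).
rewrite in_itv/= => /andP[c1 c2] E; exists c; last by move: E; lra.
by rewrite !ler0_norm; lra.
Qed.

(** A point of the disc off the graph is not a boundary point: strictly below, it lies in the open
    set [Omega]; strictly above, it has a neighbourhood that misses [Omega]. *)
Lemma local_graph_bdry Omega x0 r e gamma x : open Omega ->
  local_graph Omega x0 r e gamma -> C1_fun gamma ->
  bdry Omega x -> enorm (x - x0) < r -> dot x e = gamma (dot x (rot90 e)).
Proof.
move=> oO [r0 e1 h] /C1_fun_continuous cg [clx] nx xr.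
have nO : ~ Omega x by move=> Ox; apply: nx; rewrite /= -/(interior Omega) (interior_id _).1.
apply/eqP; rewrite eq_le; apply/andP; split; last first.
  by rewrite leNgt; apply/negP => lt; apply: nO; apply/h.
rewrite leNgt; apply/negP => lt.
have cf : {for x, continuous (fun z : V => dot z e - gamma (dot z (rot90 e)))}.
  have h1 : dot^~ (rot90 e) @ x --> dot x (rot90 e) by exact: continuous_dotl.
  have h2 : (fun z => gamma (dot z (rot90 e))) @ x --> gamma (dot x (rot90 e)).
    exact: continuous_comp h1 (cg _).
  have h3 : dot^~ e @ x --> dot x e by exact: continuous_dotl.
  exact: (cvgB h3 h2).
have n1 : \forall z \near x, 0 < dot z e - gamma (dot z (rot90 e)).
  by apply: (cvgr_gt _ cf); rewrite subr_gt0.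
have n2 : \forall z \near x, enorm (z - x0) < r.
  apply/nbhs_enormP; exists (r - enorm (x - x0)); first by rewrite subr_gt0.
  move=> y yx; apply: le_lt_trans (_ : enorm (y - x) + enorm (x - x0) < r); last lra.
  by apply: le_trans (ler_enormD _ _); rewrite addrA subrK.
have [z [Oz [z1 z2]]] := clx _ (filterI n1 n2).
by move: Oz => /(h _ z2); lra.
Qed.

Lemma local_graph_closure Omega x0 r e gamma x : open Omega ->
  local_graph Omega x0 r e gamma -> C1_fun gamma -> enorm (x - x0) < r ->
  closure Omega x <-> dot x e <= gamma (dot x (rot90 e)).
Proof.
move=> oO lg cg xr; have [r0 e1 h] := lg; split => [clx|].
  have [/(h _ xr)/ltW//|nO] := pselect (Omega x).
  by rewrite (local_graph_bdry oO lg cg)//; split => // /interior_subset.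
rewrite le_eqVlt => /predU1P[xE|/(h _ xr)/subset_closure//].
move=> B /nbhs_enormP[d d0 hB].
pose m := Num.min d (r - enorm (x - x0)).
have m0 : 0 < m by rewrite lt_min d0 subr_gt0.
have md : m <= d by rewrite ge_min lexx.
have mr : m <= r - enorm (x - x0) by rewrite ge_min lexx orbT.
have et : enorm (- ((m / 2) *: e)) = m / 2 by rewrite enormN enormZ e1 mulr1 gtr0_norm ?divr_gt0.
exists (x - (m / 2) *: e); split.
  apply/h.
    by have := ler_enormD (x - x0) (- ((m / 2) *: e)); rewrite et addrAC; lra.
  by rewrite !dotBl !dotZl xE dotx_rot90 enorm1// mulr0 subr0; lra.
by apply: hB; rewrite addrAC subrr add0r et; lra.
Qed.

Lemma C1_fun_flip gamma : C1_fun gamma -> C1_fun (fun s => - gamma (- s)) /\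
  forall s, derive1 (fun s => - gamma (- s)) s = derive1 gamma (- s).
Proof.
move=> [dg cg].
have dn (s : R) : is_derive s 1 (fun s => - gamma (- s)) (derive1 gamma (- s)).
  have h1 : is_derive (- s) 1 gamma (derive1 gamma (- s)) by rewrite derive1E; exact: derivableP.
  apply: is_derive_eq (is_deriveN (is_derive1_comp h1 (is_deriveNid s 1))) _.
  by rewrite mulrN1 opprK.
have E (s : R) : derive1 (fun s => - gamma (- s)) s = derive1 gamma (- s).
  by rewrite derive1E; have [] := dn s.
split; last exact: E.
split => [s|]; first by have [] := dn s.
rewrite (_ : derive1 _ = derive1 gamma \o -%R); last by apply/funext.
by move=> s; apply: continuous_comp; [exact: opp_continuous|exact: cg].
Qed.

(** Reversing [e] also reverses [rot90 e], which accounts for both signs in [- gamma (- s)]. The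
    exterior is the strict epigraph because the closure contains the graph. *)
Lemma local_graph_flip Omega x0 r e gamma : open Omega ->
  local_graph Omega x0 r e gamma -> C1_fun gamma ->
  local_graph (~` closure Omega) x0 r (- e) (fun s => - gamma (- s)).
Proof.
move=> oO lg cg; have [r0 e1 h] := lg; split => // [|x xr]; first by rewrite enormN.
rewrite rot90N !dotNr opprK ltrN2 ltNge.
have E := local_graph_closure oO lg cg xr.
by split => [n|/negP n]; [apply/negP => /E|move=> /E].
Qed.

Lemma graph_normal_flip e gamma x : C1_fun gamma ->
  graph_normal (- e) (fun s => - gamma (- s)) x = - graph_normal e gamma x.
Proof.
move=> /C1_fun_flip[_ E]; rewrite /graph_normal E rot90N dotNr opprK scalerN.
by rewrite opprK opprB addrC.
Qed.

Lemma is_derive_chart e gamma x d : C1_fun gamma ->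
  is_derive (0 : R) 1 (fun t : R => dot (x + t *: d) e - gamma (dot (x + t *: d) (rot90 e)))
    (dot d (graph_normal e gamma x)).
Proof.
move=> [dg _].
have hl a : is_derive (0 : R) 1 (fun t : R => dot (x + t *: d) a) (dot d a).
  rewrite (_ : (fun t => _) = (fun t => dot x a + t * dot d a)); last first.
    by apply/funext => t; rewrite dotDl dotZl.
  have h := is_deriveD (is_derive_cst (dot x a) (0:R) 1) (is_deriveM (is_derive_id (0:R) 1) (is_derive_cst (dot d a) _ _)).
  by apply: is_derive_eq h _; rewrite [_ *: 0]mulr0 [_ *: 1]mulr1 !add0r.
have hg : is_derive (dot x (rot90 e)) 1 gamma (derive1 gamma (dot x (rot90 e))).
  by rewrite derive1E; exact: derivableP.
have hc : is_derive (0 : R) 1 (fun t : R => gamma (dot (x + t *: d) (rot90 e)))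
    (derive1 gamma (dot x (rot90 e)) * dot d (rot90 e)).
  have hg' : is_derive (dot (x + 0 *: d) (rot90 e)) 1 gamma (derive1 gamma (dot x (rot90 e))).
    by rewrite scale0r addr0.
  exact: (is_derive1_comp hg' (hl (rot90 e))).
apply: is_derive_eq (is_deriveB (hl e) hc) _.
by rewrite graph_normal_dot.
Qed.

Lemma pos_derive_near (f : R -> R) (d : R) : is_derive (0 : R) 1 f d -> 0 < d ->
  exists2 s : R, 0 < s & forall t, 0 < t < s -> f 0 < f t.
Proof.
move=> [df dv] d0.
have lim1 : (fun h : R => h^-1 *: ((f \o shift 0) (h *: 1) - f 0)) @ 0^' --> d.
  by rewrite -dv; exact: df.
have := cvgr_gt _ lim1 _ d0.
move=> [/= s s0 hs]; exists s => // t /andP[t0 ts].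
have := hs t; rewrite /= sub0r normrN gtr0_norm// => /(_ ts).
rewrite gt_eqF// => /(_ isT); rewrite [t *: 1]mulr1 addr0 => h.
by rewrite -subr_gt0 -(pmulr_rgt0 (x := t^-1))// invr_gt0.
Qed.

Section at_point.
Variables (Omega : set V) (x : V) (r : R) (e : V) (gamma : R -> R).
Hypotheses (oO : open Omega) (bx : bdry Omega x).
Hypotheses (lg : local_graph Omega x r e gamma) (cg : C1_fun gamma).

Let ball_line d : exists2 s : R, 0 < s & forall t, 0 < t < s -> enorm (x + t *: d - x) < r.
Proof.
have [r0 _ _] := lg; exists (r / (enorm d + 1)).
  by rewrite divr_gt0// ltr_wpDl// enorm_ge0.
move=> t /andP[t0]; have ed := enorm_ge0 d.
rewrite addrAC subrr add0r enormZ gtr0_norm// ltr_pdivlMr; last lra.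
nra.
Qed.

(** The chart function vanishes at [x] and has derivative [dot d (graph_normal e gamma x)] along
    [d], so the sign of this number decides on which side of the graph the ray starts. *)
Lemma graph_normal_in d : dot d (graph_normal e gamma x) < 0 ->
  exists2 s : R, 0 < s & forall t, 0 < t < s -> Omega (x + t *: d).
Proof.
move=> d0; have [s1 s10 h1] := ball_line d; have [r0 e1 h] := lg.
have := is_deriveN (is_derive_chart e x d cg).
move=> /pos_derive_near; rewrite oppr_gt0 => /(_ d0)[s2 s20 h2].
exists (Num.min s1 s2); first by rewrite lt_min s10.
move=> t; rewrite lt_min => /and3P[t0 ts1 ts2].
apply/h; first by apply: h1; rewrite t0.
have := h2 t; rewrite t0 ts2 => /(_ isT).
rewrite !fctE scale0r addr0 (local_graph_bdry oO lg cg bx) ?subrr ?oppr0; last first.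
  by rewrite /enorm dotE !mxE mulr0 addr0 sqrtr0.
by rewrite oppr_gt0 subr_lt0.
Qed.

Lemma graph_normal_out d : 0 < dot d (graph_normal e gamma x) ->
  exists2 s : R, 0 < s & forall t, 0 < t < s -> ~ closure Omega (x + t *: d).
Proof.
move=> d0; have [s1 s10 h1] := ball_line d; have [r0 e1 h] := lg.
have := is_derive_chart e x d cg.
move=> /pos_derive_near => /(_ d0)[s2 s20 h2].
exists (Num.min s1 s2); first by rewrite lt_min s10.
move=> t; rewrite lt_min => /and3P[t0 ts1 ts2].
have := h2 t; rewrite t0 ts2 => /(_ isT).
rewrite scale0r addr0 (local_graph_bdry oO lg cg bx) ?subrr ?oppr0; last first.
  by rewrite /enorm dotE !mxE mulr0 addr0 sqrtr0.
have xr : enorm (x + t *: d - x) < r by apply: h1; rewrite t0.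
move=> lt; have [Ox|nOx] := pselect (Omega (x + t *: d)); first by move: Ox => /(h _ xr); lra.
move=> cl; have : dot (x + t *: d) e = gamma (dot (x + t *: d) (rot90 e)).
  apply: (local_graph_bdry oO lg cg _ xr); split => // Oi; apply: nOx.
  exact: interior_subset Oi.
by lra.
Qed.

End at_point.

(** Two distinct unit normals [v] and [w] satisfy [dot v w < 1], so the direction [w - v] enters
    [Omega] according to the chart of [v] and leaves [closure Omega] according to the chart of [w].
    Thus the [get] in [outward_normal] can be evaluated in any chart. *)
Lemma outward_normal_unique Omega x v w : open Omega -> bdry Omega x ->
  is_outward_normal Omega x v -> is_outward_normal Omega x w -> v = w.
Proof.
move=> oO bx [r [e [gamma [lg cg /= vE]]]] [r' [e' [gamma' [lg' cg' /= wE]]]].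
have [_ e1 _] := lg; have [_ e'1 _] := lg'.
have vN : v = (enorm (graph_normal e gamma x))^-1 *: graph_normal e gamma x by [].
have wN : w = (enorm (graph_normal e' gamma' x))^-1 *: graph_normal e' gamma' x by [].
have a0 := graph_normal_enorm_gt0 gamma x e1.
have b0 := graph_normal_enorm_gt0 gamma' x e'1.
have v1 : dot v v = 1.
  by rewrite vN dotZl dotZr -sqr_enorm; field; rewrite gt_eqF.
have w1 : dot w w = 1.
  by rewrite wN dotZl dotZr -sqr_enorm; field; rewrite gt_eqF.
have [//|vw] := pselect (v = w).
have lt1 : dot v w < 1.
  rewrite ltNge; apply/negP => le1; apply: vw.
  have : dot (v - w) (v - w) <= 0 by rewrite !dotBl !dotBr v1 w1 (dotC w v); lra.
  rewrite dotE !mxE => h.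
  have := sqr_ge0 (v 0 0 - w 0 0); have := sqr_ge0 (v 0 1 - w 0 1); rewrite !expr2 => h0 h1.
  by apply: row2P; apply/eqP; rewrite -subr_eq0 -[_ == 0]orbb -mulf_eq0 eq_le; apply/andP; split; lra.
have [s1 s10 h1] : exists2 s : R, 0 < s & forall t, 0 < t < s -> Omega (x + t *: (w - v)).
  apply: (graph_normal_in oO bx lg cg).
  have : dot (w - v) v < 0 by rewrite dotBl v1 dotC; lra.
  by rewrite vN dotZr pmulr_rlt0// invr_gt0.
have [s2 s20 h2] : exists2 s : R, 0 < s & forall t, 0 < t < s -> ~ closure Omega (x + t *: (w - v)).
  apply: (graph_normal_out oO bx lg' cg').
  have : 0 < dot (w - v) w by rewrite dotBl w1; lra.
  by rewrite wN dotZr pmulr_rgt0// invr_gt0.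
have m0 : 0 < Num.min s1 s2 by rewrite lt_min s10.
have l1 : Num.min s1 s2 <= s1 by rewrite ge_min lexx.
have l2 : Num.min s1 s2 <= s2 by rewrite ge_min lexx orbT.
exfalso; apply: (h2 (Num.min s1 s2 / 2)); first by apply/andP; split; lra.
apply: subset_closure; apply: h1; apply/andP; split; lra.
Qed.

Lemma outward_normalE Omega x0 r e gamma x : open Omega ->
  local_graph Omega x0 r e gamma -> C1_fun gamma -> bdry Omega x -> enorm (x - x0) < r ->
  outward_normal Omega x = (enorm (graph_normal e gamma x))^-1 *: graph_normal e gamma x.
Proof.
move=> oO lg cg bx xr.
have lgx : local_graph Omega x (r - enorm (x - x0)) e gamma.
  by apply: local_graph_shrink lg _ _; lra.
have nv : is_outward_normal Omega x ((enorm (graph_normal e gamma x))^-1 *: graph_normal e gamma x).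
  by exists (r - enorm (x - x0)), e, gamma; split.
apply: (outward_normal_unique oO bx _ nv).
exact: (getI (P := [set nu | is_outward_normal Omega x nu]) nv).
Qed.

Lemma local_graph_normal_derivative0 Omega U (f : V -> R) x0 r e gamma x : open Omega ->
  local_graph Omega x0 r e gamma -> C1_fun gamma -> bdry Omega x -> enorm (x - x0) < r ->
  normal_derivative Omega U f x = 0 -> dot (grad_trace U f x) (graph_normal e gamma x) = 0.
Proof.
move=> oO lg cg bx xr; rewrite /normal_derivative (outward_normalE oO lg cg bx xr).
have [_ e1 _] := lg.
rewrite dotZr => /eqP; rewrite mulf_eq0 invr_eq0 => /orP[|/eqP//].
by rewrite gt_eqF// graph_normal_enorm_gt0.
Qed.

End charts.

(** * Barriers, the strong maximum principle and maxima under a Neumann condition *)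

Section barrier.
Context {R : realType}.
Notation V := 'rV[R]_2.
Implicit Types (x y z e v : V) (A K : set V).

Lemma within_continuous_line A (f : V -> R) x d (s : R) :
  {within A, continuous f} -> (forall t : R, 0 <= t <= s -> A (x + t *: d)) ->
  {within `[0, s], continuous (fun t : R => f (x + t *: d))}.
Proof.
move=> /subspace_continuousP cf hA; apply/subspace_continuousP => t /= tin.
have At : A (x + t *: d) by apply: hA; move: tin; rewrite in_itv/=.
have hl : (fun t : R => x + t *: d) @ t --> x + t *: d.
  by apply: cvgD; [exact: cvg_cst|apply: cvgZr_tmp; exact: cvg_id].
move=> B /(cf _ At) hB.
have h : \forall t' \near t, A (x + t' *: d) -> B (f (x + t' *: d)) := hl _ hB.
rewrite /nbhs /= /within /=; near=> t' => /= t'in.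
have At' : A (x + t' *: d) by apply: hA; move: t'in; rewrite in_itv.
by move: At'; near: t'.
Unshelve. all: by end_near.
Qed.

(** [f] has no derivative at the boundary point [x]. Growth along the ray is read off from the mean
    value theorem on a segment starting at [x]: continuity holds up to the endpoint, and [G] is
    positive on the rest. *)
Lemma increase_from_bdry A (f G : V -> R) x d (s : R) : 0 < s ->
  (forall t, 0 < t < s -> A (x + t *: d)) -> closure A x ->
  {within closure A, continuous f} ->
  (forall z, A z -> is_derive z d f (G z)) ->
  (\forall z \near within A (nbhs x), 0 < G z) ->
  exists2 s' : R, 0 < s' & forall t, 0 < t < s' -> A (x + t *: d) /\ f x < f (x + t *: d).
Proof.
move=> s0 As clx cf df /= Gpos.
have [d1 d10 hd1] := (nbhs_enormP _ _).1 Gpos.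
have ed := enorm_ge0 d.
pose s' := Num.min s (d1 / (enorm d + 1)).
have s'0 : 0 < s' by rewrite lt_min s0 divr_gt0// ltr_wpDl.
have posG t : 0 < t < s' -> A (x + t *: d) /\ 0 < G (x + t *: d).
  rewrite lt_min => /and3P[t0 ts td].
  have At : A (x + t *: d) by apply: As; rewrite t0.
  split => //; apply: hd1 => //.
  rewrite addrAC subrr add0r enormZ gtr0_norm//.
  by move: td; rewrite ltr_pdivlMr; [nra|lra].
exists s' => // t /[dup] tt' /andP[t0 ts]; split; first by have [] := posG _ tt'.
have [xi xii E] : exists2 xi, xi \in `]0, t[%R &
    f (x + t *: d) - f (x + 0 *: d) = G (x + xi *: d) * (t - 0).
  apply: (@MVT _ (fun t => f (x + t *: d)) (fun t => G (x + t *: d))) => //.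
    move=> u; rewrite in_itv/= => /andP[u0 ut]; apply: is_derive_line; apply: df.
    by have [] : A (x + u *: d) /\ 0 < G (x + u *: d) by apply: posG; rewrite u0 (lt_trans ut).
  apply: (within_continuous_line cf) => u /andP[]; rewrite le_eqVlt => /predU1P[<- _|u0 ut].
    by rewrite scale0r addr0.
  by apply: subset_closure; have [] := posG u; rewrite // u0 (le_lt_trans ut).
move: xii; rewrite in_itv/= => /andP[xi0 xit].
have [_ Gp] : A (x + xi *: d) /\ 0 < G (x + xi *: d) by apply: posG; rewrite xi0 (lt_trans xit).
by move: E; rewrite scale0r addr0 subr0 => E; rewrite -subr_gt0 E mulr_gt0.
Qed.

Lemma continuous_invdist2 y x : 0 < dist2 y x ->
  {for x, continuous (fun z => (dist2 y z)^-1)}.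
Proof.
move=> q0; have q1 : dist2 y x != 0 by rewrite gt_eqF.
have h : dist2 y @ x --> dist2 y x by exact: continuous_dist2.
exact: (cvgV q1 h).
Qed.

Lemma within_continuousZ K (g : V -> R) (k : R) :
  {within K, continuous g} -> {within K, continuous (fun x => k * g x)}.
Proof.
move=> cg x; have hc : (fun=> k) @ nbhs (x : subspace K) --> k by exact: cvg_cst.
exact: (cvgM hc (cg x)).
Qed.

(* The comparison function is dist2 y x ^-1 - r ^-2, which is positive and
   strictly subharmonic in the punctured disc of radius r and vanishes on its
   boundary circle. *)
Lemma barrier_lt A (u : V -> R) d1 d2 (M : R) y (rho r : R) :
  open A -> bounded_set A -> {within closure A, continuous u} ->
  twice_partial A u d1 d2 -> (forall x, A x -> 0 <= d2 0 x + d2 1 x) ->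
  0 < rho -> rho < r ->
  (forall x, closure A x -> dist2 y x <= r ^+ 2 -> u x <= M) ->
  (forall x, closure A x -> dist2 y x <= rho ^+ 2 -> u x < M) ->
  (forall eps x, 0 < eps -> closure A x -> ~ A x -> rho ^+ 2 < dist2 y x < r ^+ 2 ->
    exists z, [/\ closure A z, rho ^+ 2 <= dist2 y z <= r ^+ 2 &
      u x + eps * (dist2 y x)^-1 < u z + eps * (dist2 y z)^-1]) ->
  forall x, closure A x -> dist2 y x < r ^+ 2 -> u x < M.
Proof.
move=> oA bA cu tp lap rho0 rr leM ltM hb x Ax xr.
have [xrho|xrho] := leP (dist2 y x) (rho ^+ 2); first exact: ltM.
have r2 : rho ^+ 2 < r ^+ 2 by rewrite ltr_pXn2r// nnegrE; lra.
have rho20 : 0 < rho ^+ 2 by rewrite exprn_gt0.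
have cA := compact_closure bA.
have cclose (a b : R) : closed [set z | a <= dist2 y z <= b].
  rewrite (_ : [set z | _] = (dist2 y) @^-1` [set t | a <= t] `&` (dist2 y) @^-1` [set t | t <= b]).
    by apply: closedI; apply: closed_comp => [? _|]; solve [exact: continuous_dist2|exact: closed_ge|exact: closed_le].
  by apply/seteqP; split => z /= => [/andP[]|[-> ->]].
have cK a b : compact (closure A `&` [set z | a <= dist2 y z <= b]).
  by apply: compact_closedI.
(* Compactness turns the strict inequality on the inner disc into a margin [M - M'], which fixes the
   size of the barrier. *)
have [M' M'M hM'] : exists2 M', M' < M & forall z, closure A z -> dist2 y z <= rho ^+ 2 -> u z <= M'.
  have [[z0 hz0]|h0] := pselect (closure A `&` [set z | 0 <= dist2 y z <= rho ^+ 2] !=set0).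
    have cu0 : {within closure A `&` [set z | 0 <= dist2 y z <= rho ^+ 2], continuous u}.
      by apply: continuous_subspaceW cu => z [].
    have [|z1 /[!inE] -[Az1 /= /andP[_ z1r]] zmax] := compact_EVT_max _ (cK _ _) cu0; first by exists z0.
    exists (u z1); first exact: ltM.
    by move=> z Az zr; apply: zmax; rewrite inE; split => //=; rewrite zr dot_ge0.
  exists (M - 1); first lra.
  by move=> z Az zr; exfalso; apply: h0; exists z; split => //=; rewrite zr dot_ge0.
(* On the inner circle the barrier term [eps * (dist2 y x)^-1] then equals the margin, so that
   [g <= M] there. *)
pose eps := (M - M') * rho ^+ 2.
have eps0 : 0 < eps by rewrite mulr_gt0// subr_gt0.
pose g z := u z + eps * (dist2 y z)^-1.
pose K := closure A `&` [set z | rho ^+ 2 <= dist2 y z <= r ^+ 2].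
have cg : {within K, continuous g}.
  apply: (@within_continuousD _ _ _ _ u (fun z => eps * (dist2 y z)^-1)); first by apply: continuous_subspaceW cu => z [].
  apply: within_continuousZ.
  apply: continuous_in_subspaceT => z /[!inE] -[_ /= /andP[z1 _]].
  by apply: continuous_invdist2; lra.
have Kx : K x by split => //=; rewrite !ltW.
have [|x1 /[!inE] -[Ax1 /= /andP[x1a x1b]] gmax] := compact_EVT_max _ (cK _ _) cg; first by exists x.
have q10 : 0 < dist2 y x1 by lra.
have r20 : 0 < r ^+ 2 by lra.
(* The maximum of [g] over the annular region can only lie on one of the two circles: between them,
   [hb] excludes the points outside [A], and strict subharmonicity excludes those of [A]. *)
have gx1 : g x1 <= M + eps * (r ^+ 2)^-1.
  have ir : 0 < eps * (r ^+ 2)^-1 by rewrite mulr_gt0// invr_gt0.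
  have [e1|n1] := eqVneq (dist2 y x1) (rho ^+ 2).
    have := hM' _ Ax1; rewrite e1 lexx => /(_ isT) h.
    have e3 : eps * (rho ^+ 2)^-1 = M - M' by rewrite /eps mulfK// gt_eqF.
    rewrite /g e1 e3; lra.
  have [e2|n2] := eqVneq (dist2 y x1) (r ^+ 2).
    by rewrite /g e2 lerD2r; apply: leM => //; rewrite e2.
  have x1ab : rho ^+ 2 < dist2 y x1 < r ^+ 2 by rewrite !lt_neqAle eq_sym n1 n2 x1a x1b.
  have [A1|A1] := pselect (A x1); last first.
    have [z [Az zr gz]] := hb _ _ eps0 Ax1 A1 x1ab.
    have := gmax z; rewrite inE => /(_ (conj Az zr)); rewrite /g; lra.
  have A'o : open (A `&` [set z | rho ^+ 2 < dist2 y z < r ^+ 2]).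
    apply: openI => //.
    rewrite (_ : [set z | _] = (dist2 y) @^-1` [set t | rho ^+ 2 < t] `&` (dist2 y) @^-1` [set t | t < r ^+ 2]).
      by apply: openI; apply: open_comp => [? _|]; solve [exact: continuous_dist2|exact: open_gt|exact: open_lt].
    by apply/seteqP; split => z /= => [/andP[]|[-> ->]].
  have lap1 := lap _ A1.
  have lap2 := mulr_gt0 eps0 (laplacian_invdist2 q10).
  have sub : A `&` [set z | rho ^+ 2 < dist2 y z < r ^+ 2] `<=` [set z | 0 < dist2 y z].
    by move=> z [_ /= /andP[h _]]; lra.
  have gm : \forall z \near x1, g z <= g x1.
    have O1 : (A `&` [set z | rho ^+ 2 < dist2 y z < r ^+ 2]) x1 by [].
    apply: (filterS _ (open_nbhs_nbhs (conj A'o O1))) => z [Az /= /andP[z1 z2]].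
    by apply: gmax; rewrite inE; split; [exact: subset_closure|rewrite /= !ltW].
  have /= := laplacian_at_max A'o (conj A1 x1ab) (twice_partialDZ eps
    (twice_partialS (@subIsetl _ _ _) tp) (twice_partialS sub (@twice_partial_invdist2 R y))) gm.
  by move: lap1 lap2; lra.
have : g x <= g x1 by apply: gmax; rewrite inE.
rewrite /g => gx.
have : eps * (r ^+ 2)^-1 < eps * (dist2 y x)^-1 by rewrite ltr_pM2l// ltf_pV2// posrE; lra.
rewrite /g in gx1; lra.
Qed.

(** If [u y < M] for some [y] near [x1], the barrier around [y] yields [u x1 < M]. The disc of
    radius [d / 2] about [y] contains [x1] and stays in [A], so the condition of the barrier lemma
    on points outside [A] is void. *)
Lemma strong_max_near A (u : V -> R) d1 d2 (M : R) x1 : open A -> bounded_set A ->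
  {within closure A, continuous u} ->
  twice_partial A u d1 d2 -> (forall x, A x -> 0 <= d2 0 x + d2 1 x) ->
  (forall x, closure A x -> u x <= M) -> A x1 -> u x1 = M ->
  \forall x \near x1, u x = M.
Proof.
move=> oA bA cu tp lap leM A1 uM.
have [d d0 hd] := (nbhs_enormP _ _).1 (open_nbhs_nbhs (conj oA A1)).
apply/nbhs_enormP; exists (d / 4); first lra.
move=> y yx1; apply/eqP; rewrite eq_le; apply/andP; split.
  by apply/leM/subset_closure/hd; lra.
rewrite leNgt; apply/negP => uy.
have Ay : A y by apply: hd; lra.
have [d' d'0 hd'] : exists2 d' : R, 0 < d' & forall z, enorm (z - y) < d' -> closure A z -> u z < M.
  have cuy : u @ within (closure A) (nbhs y) --> u y.
    by apply: (subspace_continuousP _ _).1 cu _ _; exact: subset_closure.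
  have h : \forall z \near within (closure A) (nbhs y), u z < M by exact: (cvgr_lt _ cuy).
  exact: (nbhs_enormP _ _).1 h.
pose rho := Num.min (d' / 2) (d / 4).
have rho0 : 0 < rho by rewrite lt_min; apply/andP; split; lra.
have rhod' : rho <= d' / 2 by rewrite ge_min lexx.
have rhod : rho <= d / 4 by rewrite ge_min lexx orbT.
suff : u x1 < M by rewrite uM ltxx.
apply: (@barrier_lt A u d1 d2 M y rho (d / 2)) => //.
- lra.
- by move=> x Ax _; exact: leM.
- move=> x Ax; rewrite -enorm_le ?(ltW rho0)// => xr; apply: hd' => //; lra.
- move=> eps x _ _ nAx /andP[_]; rewrite -enorm_lt; last lra.
  move=> xy; exfalso; apply: nAx; apply: hd.
  have := ler_enormD (x - y) (y - x1); rewrite addrA subrK; lra.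
- exact: subset_closure.
- by rewrite -enorm_lt -1?enormN ?opprB; lra.
Qed.

Lemma dist2_enorm y x : dist2 y x = enorm (x - y) ^+ 2.
Proof. by rewrite sqr_enorm. Qed.

Definition of_class_C1 A : Prop := forall x0, bdry A x0 ->
  exists r e gamma, local_graph A x0 r e gamma /\ C1_fun gamma.

(* Hopf's lemma is not available, as C^1 domains need not satisfy the interior
   ball condition.  Instead, a point y of A is chosen on the inner normal at x0;
   near x0 the boundary is transversal to the rays from y, so that
   u + eps |x - y|^-2 has a negative outward normal derivative there and its
   maximum over an annulus around y cannot lie on the boundary of A. *)
Lemma neumann_max_interior A (u : V -> R) (M : R) x0 : open A -> bounded_set A ->
  harmonic_on A u -> C1_closure A u ->
  of_class_C1 A ->
  (forall x, bdry A x -> normal_derivative A A u x = 0) ->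
  (forall x, closure A x -> u x <= M) -> closure A x0 -> u x0 = M ->
  exists2 x1, A x1 & u x1 = M.
Proof.
move=> oA bA hu [cu gu] smooth neu leM clx0 uM.
have tp := harmonic_twice hu.
have lap x : A x -> 0 <= partial 0 (partial 0 u) x + partial 1 (partial 1 u) x.
  have [_ _ h] := hu; move=> /h; rewrite /laplacian big_ord_recl big_ord1.
  by rewrite (_ : lift ord0 ord0 = 1); [move=> ->|exact/val_inj].
have bdA x : closure A x -> ~ A x -> bdry A x.
  by move=> cx nx; split => //; rewrite (interior_id _).1.
have [Ax0|nAx0] := pselect (A x0); first by exists x0.
have [//|nex] := pselect (exists2 x1, A x1 & u x1 = M).
have ltM x : A x -> u x < M.
  move=> Ax; rewrite lt_neqAle leM ?andbT; last exact: subset_closure.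
  by apply/eqP => uxM; apply: nex; exists x.
have bx0 := bdA _ clx0 nAx0.
have [r0 [e [gamma [lg cg]]]] := smooth _ bx0.
have [r00 e1 _] := lg.
pose N := graph_normal e gamma.
pose g0 := derive1 gamma (dot x0 (rot90 e)).
pose L := enorm (N x0).
have L2 : L ^+ 2 = 1 + g0 ^+ 2 by rewrite sqr_enorm graph_normal_sqr.
have L1 : 1 <= L.
  by rewrite -(@ler_pXn2r _ 2)// ?nnegrE ?enorm_ge0// L2 expr1n; have := sqr_ge0 g0; lra.
have Lg : `|g0| <= L.
  by rewrite -(@ler_pXn2r _ 2)// ?nnegrE ?enorm_ge0// L2 real_normK ?num_real//; lra.
(* The tolerance 1/16 enters the formula for [dot (x - y) (N x)] below: its first term is then at
   most 3/8 of [s * L] in absolute value, while its second is at least 15/16 of [s * L]. *)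
have [del del0 hdel] : exists2 del : R, 0 < del & forall t, `|t - dot x0 (rot90 e)| < del ->
    `|derive1 gamma t - g0| < 1 / 16.
  have [_ /(_ (dot x0 (rot90 e))) cd] := cg.
  have e16 : 0 < 1 / 16 :> R by lra.
  have [/= del del0 h] := proj1 (cvgrPdist_lt _ _) cd _ e16.
  by exists del => // t td; rewrite distrC; apply: h; rewrite /= distrC.
have [s1 s10 hs1] : exists2 s : R, 0 < s & forall t, 0 < t < s -> A (x0 + t *: - N x0).
  apply: (graph_normal_in oA bx0 lg cg).
  by rewrite dotNl graph_normal_sqr// oppr_lt0 ltr_pwDl// sqr_ge0.
(* The bound [s1 / 2] puts [y] into [A]. The other one gives [3 * (s * L) < Num.min r0 del], so that
   boundary points within [2 * (s * L)] of [y] remain in the chart and in the range where the slope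
   varies little. *)
pose s := Num.min (s1 / 2) (Num.min r0 del / (4 * L)).
have m0 : 0 < Num.min r0 del by rewrite lt_min r00.
have s0 : 0 < s.
  by rewrite lt_min !divr_gt0//; lra.
have ss1 : s <= s1 / 2 by rewrite ge_min lexx.
have sL0 : 0 < s * L by rewrite mulr_gt0//; lra.
have smin : 3 * (s * L) < Num.min r0 del.
  have : s <= Num.min r0 del / (4 * L) by rewrite ge_min lexx orbT.
  by rewrite ler_pdivlMr; [nra|lra].
have minr : Num.min r0 del <= r0 by rewrite ge_min lexx.
have mind : Num.min r0 del <= del by rewrite ge_min lexx orbT.
pose y := x0 + s *: - N x0.
have Ay : A y by apply: hs1; apply/andP; split; lra.
have x0y : enorm (x0 - y) = s * L.
  by rewrite /y opprD addrA subrr sub0r enormN enormZ enormN gtr0_norm.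
(* Transversality: rays from [y] cross the nearby boundary outwards. The displacement from [x0] to
   [x] along the graph is almost tangent to it, by the mean value theorem, and the contribution of
   [s *: N x0] dominates. *)
have key x : bdry A x -> enorm (x - y) < 2 * (s * L) ->
    enorm (x - x0) < r0 /\ 0 < dot (x - y) (N x).
  move=> bx xy.
  have xx0 : enorm (x - x0) < 3 * (s * L).
    apply: le_lt_trans (_ : enorm (x - y) + enorm (y - x0) < _).
      by apply: le_trans (ler_enormD _ _); rewrite addrA subrK.
    by rewrite -(enormN (y - x0)) opprB x0y; lra.
  have xr : enorm (x - x0) < r0 by lra.
  split => //.
  have xE := local_graph_bdry oA lg cg bx xr.
  have x0E : dot x0 e = gamma (dot x0 (rot90 e)).
    by apply: (local_graph_bdry oA lg cg bx0); rewrite subrr /enorm dotE !mxE mulr0 addr0 sqrtr0.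
  set t := dot x (rot90 e) in xE; set t0 := dot x0 (rot90 e) in x0E.
  have tt0 : `|t - t0| <= enorm (x - x0).
    rewrite -dotBl; apply: le_trans (normr_dot _ _) _.
    suff -> : enorm (rot90 e) = 1 by rewrite mulr1.
    by rewrite /enorm dot_rot90.
  have [c ct E] := C1_fun_MVT t0 t cg.
  have cd : `|c - t0| < del by lra.
  have hc := hdel _ cd.
  have ht : `|derive1 gamma t - g0| < 1 / 16 by apply: hdel; lra.
  have -> : dot (x - y) (N x) = (derive1 gamma c - derive1 gamma t) * (t - t0) +
      s * (1 + g0 * derive1 gamma t).
    rewrite /y opprD addrA scalerN opprK dotDl graph_normal_dot dotZl.
    rewrite !dotBl xE x0E -/t -/t0 E dotZl !graph_normal_dot dot_rot90.
    rewrite (dotC (rot90 e) e) dotx_rot90 (enorm1 e1) -/t -/g0 mulr0 subr0; ring.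
  have h1 : `|(derive1 gamma c - derive1 gamma t) * (t - t0)| <= 1 / 8 * (3 * (s * L)).
    rewrite normrM; apply: ler_pM => //; last lra.
    rewrite (_ : _ - _ = (derive1 gamma c - g0) - (derive1 gamma t - g0)); last ring.
    by apply: le_trans (ler_normB _ _) _; lra.
  have h2 : `|g0 * (derive1 gamma t - g0)| <= L * (1 / 16).
    by rewrite normrM; apply: ler_pM => //; lra.
  have h3 : 1 + g0 * derive1 gamma t >= L ^+ 2 - L * (1 / 16).
    by rewrite L2; move: h2; rewrite ler_norml mulrBr expr2; lra.
  have h4 : s * (1 + g0 * derive1 gamma t) >= s * (L ^+ 2 - L * (1 / 16)) by rewrite ler_pM2l.
  have h5 : s * (L ^+ 2 - L * (1 / 16)) >= s * (L * (15 / 16)).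
    by rewrite ler_pM2l// expr2; nra.
  by move: h1; rewrite ler_norml => /andP[h1 _]; nra.
have [d' d'0 hd'] := (nbhs_enormP _ _).1 (open_nbhs_nbhs (conj oA Ay)).
pose rho := Num.min (d' / 2) (s * L).
have rho0 : 0 < rho by rewrite lt_min; apply/andP; split; lra.
have rhod' : rho <= d' / 2 by rewrite ge_min lexx.
have rhosL : rho <= s * L by rewrite ge_min lexx orbT.
suff : u x0 < M by rewrite uM ltxx.
(* The outer radius is twice the distance from [y] to [x0]; [rho] is small enough for the inner disc
   to lie in [A], where [u < M]. *)
apply: (@barrier_lt A u _ _ M y rho (2 * (s * L)) oA bA cu tp) => //.
- lra.
- by move=> x cx _; exact: leM.
- move=> x cx; rewrite -enorm_le ?(ltW rho0)// => xr; apply: ltM; apply: hd'; lra.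
- move=> eps x eps0 cx nx /andP[x1 x2].
  have bx := bdA _ cx nx.
  have [xr0 dN] : enorm (x - x0) < r0 /\ 0 < dot (x - y) (N x).
    by apply: key => //; rewrite enorm_lt//; lra.
  have lgx : local_graph A x (r0 - enorm (x - x0)) e gamma.
    by apply: local_graph_shrink lg _ _; lra.
  pose d := - N x.
  have [s2 s20 hs2] : exists2 s : R, 0 < s & forall t, 0 < t < s -> A (x + t *: d).
    apply: (graph_normal_in oA bx lgx cg).
    by rewrite dotNl graph_normal_sqr// oppr_lt0 ltr_pwDl// sqr_ge0.
  have q0 : 0 < dist2 y x by apply: lt_trans x1; rewrite exprn_gt0.
  have qx : 0 < dist2 y x by apply: lt_trans x1; rewrite exprn_gt0.
  pose A' := A `&` [set z | rho ^+ 2 < dist2 y z < (2 * (s * L)) ^+ 2].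
  have nx' : \forall z \near x, rho ^+ 2 < dist2 y z < (2 * (s * L)) ^+ 2.
    have cq : dist2 y @ x --> dist2 y x by exact: continuous_dist2.
    have n1 := cvgr_gt _ cq _ x1; have n2 := cvgr_lt _ cq _ x2.
    by near=> z; apply/andP; split; [near: z; exact: n1|near: z; exact: n2].
  have [d3 d30 hd3] := (nbhs_enormP _ _).1 nx'.
  have ed := enorm_ge0 d.
  have clA'x : closure A' x.
    by move=> B nB; have [z [Az [Bz rz]]] := cx _ (filterI nB nx'); exists z.
  have clA' z : closure A' z -> closure A z /\ rho ^+ 2 <= dist2 y z.
    move=> cz; split; first by apply: closureS cz => w [].
    have clo : closed [set w | rho ^+ 2 <= dist2 y w].
      apply: (@closed_comp _ _ (dist2 y) [set t | rho ^+ 2 <= t]); last exact: closed_ge.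
      by move=> w _; exact: continuous_dist2.
    by apply: clo; apply: closureS cz => w [_ /= /andP[/ltW]].
  pose f z := u z + eps * (dist2 y z)^-1.
  have cf : {within closure A', continuous f}.
    apply: (@within_continuousD _ _ _ _ u (fun z => eps * (dist2 y z)^-1)).
      by apply: continuous_subspaceW cu => z /clA'[].
    apply: within_continuousZ; apply: continuous_in_subspaceT => z /[!inE] /clA'[_ hz].
    by apply: continuous_invdist2; apply: lt_le_trans hz; rewrite exprn_gt0.
  pose G z := dot (grad u z) d + eps * (- (dist2 y z) ^- 2 * (2 * dot (z - y) d)).
  have df z : A' z -> is_derive z d f (G z).
    move=> [Az /= /andP[hz _]].
    have qz : dist2 y z != 0 by rewrite gt_eqF// (lt_trans _ hz)// exprn_gt0.
    have duz : differentiable u z by have [/(_ z Az)[]] := hu.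
    exact: (is_deriveD (derive_grad d duz) (is_deriveZ eps (is_derive_inv qz (is_derive_dist2 z y d)))).
  (* Near [x], the derivative of [u] along the inner normal [d] tends to 0 by the Neumann condition,
     and that of the barrier tends to a positive limit, because [dot (x - y) d] is negative. Hence
     [f] increases on entering [A], and [x] is not a maximum. *)
  have G0 : \forall z \near within A' (nbhs x), 0 < G z.
    have TN := local_graph_normal_derivative0 oA lg cg bx xr0 (neu _ bx).
    have pf : ProperFilter (within A (nbhs x)) by exact: within_nbhs_proper.
    have c1 : (fun z => dot (grad u z) d) @ within A (nbhs x) --> 0.
      have -> : 0 = dot (grad_trace A u x) d by rewrite /d dotNr TN oppr0.
      exact: (cvg_comp _ _ (gu x cx) (@continuous_dotl R d (grad_trace A u x))).
    have c2 : (fun z => eps * (- (dist2 y z) ^- 2 * (2 * dot (z - y) d))) @ x -->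
        eps * (- (dist2 y x) ^- 2 * (2 * dot (x - y) d)).
      have ci : (fun z => (dist2 y z)^-1) @ x --> (dist2 y x)^-1 by exact: continuous_invdist2.
      have cd : (fun z => dot (z - y) d) @ x --> dot (x - y) d.
        have -> : (fun z => dot (z - y) d) = (fun z => dot z d - dot y d).
          by apply/funext => z; rewrite dotBl.
        rewrite dotBl; have h : dot^~ d @ x --> dot x d by exact: continuous_dotl.
        exact: (cvgB h (cvg_cst _)).
      have -> : (fun z => eps * (- (dist2 y z) ^- 2 * (2 * dot (z - y) d))) =
          (fun z => eps * (- ((dist2 y z)^-1 * (dist2 y z)^-1) * (2 * dot (z - y) d))).
        by apply/funext => z; rewrite -expr2 exprVn.
      rewrite -exprVn expr2.
      exact: (cvgM (cvg_cst _) (cvgM (cvgN (cvgM ci ci)) (cvgM (cvg_cst _) cd))).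
    have c2' : (fun z => eps * (- (dist2 y z) ^- 2 * (2 * dot (z - y) d))) @ within A (nbhs x) -->
        eps * (- (dist2 y x) ^- 2 * (2 * dot (x - y) d)).
      exact: cvg_within_filter c2.
    have cG : G @ within A (nbhs x) --> 0 + eps * (- (dist2 y x) ^- 2 * (2 * dot (x - y) d)).
      exact: (cvgD c1 c2').
    have pos : 0 < 0 + eps * (- (dist2 y x) ^- 2 * (2 * dot (x - y) d)).
      rewrite add0r pmulr_rgt0// mulNr -mulrN pmulr_rgt0 ?invr_gt0 ?exprn_gt0//.
      by rewrite /d dotNr mulrN opprK mulr_gt0.
    have hG : \forall z \near within A (nbhs x), 0 < G z by exact: (cvgr_gt _ cG _ pos).
    have [d4 d40 hd4] := (nbhs_enormP x (fun z => A z -> 0 < G z)).1 hG.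
    apply/(nbhs_enormP x (fun z => A' z -> 0 < G z)).
    by exists d4 => // z zd [Az _]; exact: hd4.
  pose s3 := Num.min s2 (d3 / (enorm d + 1)).
  have s30 : 0 < s3 by rewrite lt_min s20 divr_gt0//; lra.
  have As3 t : 0 < t < s3 -> A' (x + t *: d).
    rewrite lt_min => /and3P[t0 ts td]; split; first by apply: hs2; rewrite t0.
    apply: hd3; rewrite addrAC subrr add0r enormZ gtr0_norm//.
    by move: td; rewrite ltr_pdivlMr; [nra|lra].
  have [s4 s40 hs4] := increase_from_bdry s30 As3 clA'x cf df G0.
  have [Az fz] : A' (x + (s4 / 2) *: d) /\ f x < f (x + (s4 / 2) *: d).
    by apply: hs4; apply/andP; split; lra.
  exists (x + (s4 / 2) *: d); split => //.
    by have [/subset_closure] := Az.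
  by have [_ /= /andP[/ltW-> /ltW->]] := Az.
- by rewrite dist2_enorm x0y ltr_pXn2r// ?nnegrE; lra.
Unshelve. all: by end_near. Qed.
End barrier.

(** * Symmetry of second derivatives *)

Section mixed_partials.
Context {R : realType}.
Notation V := 'rV[R]_2.
Implicit Types (x y z v : V) (A : set V).

Lemma MVT_line (f g : V -> R) x v (h : R) : 0 < h ->
  (forall t, 0 <= t <= h -> is_derive (x + t *: v) v f (g (x + t *: v))) ->
  exists2 t : R, 0 < t < h & f (x + h *: v) - f x = g (x + t *: v) * h.
Proof.
move=> h0 df.
have [t] : exists2 t, t \in `]0, h[%R & f (x + h *: v) - f (x + 0 *: v) = g (x + t *: v) * (h - 0).
  apply: (@MVT _ (fun t => f (x + t *: v)) (fun t => g (x + t *: v))) => //.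
    by move=> t; rewrite in_itv/= => /andP[t0 th]; apply/is_derive_line/df; rewrite !ltW.
  apply: derivable_within_continuous => t; rewrite in_itv/= => tin.
  by have [] := is_derive_line (df t tin).
by rewrite in_itv/= scale0r addr0 subr0 => th E; exists t.
Qed.

Lemma is_derive_translate (f : V -> R) x w v (d : R) :
  is_derive (x + w) v f d -> is_derive x v (fun y => f (y + w)) d.
Proof.
move=> df; apply: is_derive_line0.
have -> : (fun s : R => f (x + s *: v + w)) = (fun s => f (x + w + s *: v)).
  by apply/funext => s; rewrite addrAC.
by apply: is_derive_line; rewrite scale0r addr0.
Qed.

Lemma second_difference A (u : V -> R) x i j (h : R) : 0 < h -> harmonic_on A u ->
  (forall s t, 0 <= s <= h -> 0 <= t <= h ->
     A (x + s *: delta_mx 0 i + t *: delta_mx 0 j)) ->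
  exists s t, [/\ 0 < s < h, 0 < t < h &
    u (x + h *: delta_mx 0 i + h *: delta_mx 0 j) - u (x + h *: delta_mx 0 i)
    - (u (x + h *: delta_mx 0 j) - u x) =
    partial j (partial i u) (x + s *: delta_mx 0 i + t *: delta_mx 0 j) * (h * h)].
Proof.
move=> h0 hu hA; pose ei : V := delta_mx 0 i; pose ej : V := delta_mx 0 j.
have tp := harmonic_twice hu.
have h00 : (0 : R) <= 0 <= h by rewrite lexx ltW.
have h0h : (0 : R) <= h <= h by rewrite lexx ltW.
pose f y := u (y + h *: ej) - u y.
have [s sh Es] : exists2 s, 0 < s < h & f (x + h *: ei) - f x =
    (partial i u (x + s *: ei + h *: ej) - partial i u (x + s *: ei)) * h.
  apply: (@MVT_line f (fun y => partial i u (y + h *: ej) - partial i u y)) => // t th.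
  apply: is_deriveB; first by apply: is_derive_translate; have [] := tp i _ (hA t h th h0h).
  by have := hA t 0 th h00; rewrite scale0r addr0 => At; have [] := tp i _ At.
have sh' : 0 <= s <= h by move/andP: sh => [s1 s2]; rewrite !ltW.
have [t th Et] : exists2 t, 0 < t < h &
    partial i u (x + s *: ei + h *: ej) - partial i u (x + s *: ei) =
    partial j (partial i u) (x + s *: ei + t *: ej) * h.
  apply: MVT_line => // t th; have [_ c1 _] := hu; apply: DeriveDef => //.
  by apply: diff_derivable; have [] := c1 i _ (hA s t sh' th).
by exists s, t; split => //; rewrite -/ei -/ej mulrA -Et -Es /f.
Qed.

(** The second difference is unchanged when the two directions are exchanged, so the two mixed
    partials take a common value at points arbitrarily near [x]; continuity excludes a gap at [x].
    The equality is a Cauchy-Riemann equation for the derivative of [u + i psi] below. *)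
Lemma mixed_partials A (u : V -> R) x : open A -> harmonic_on A u -> A x ->
  partial 0 (partial 1 u) x = partial 1 (partial 0 u) x.
Proof.
move=> oA hu Ax.
have cp i j : {for x, continuous (partial i (partial j u))}.
  by have [_ c1 _] := hu; have [_] := c1 j _ Ax.
set a := partial 0 (partial 1 u) x; set b := partial 1 (partial 0 u) x.
apply/eqP; rewrite eq_sym -subr_eq0 -normr_eq0 eq_le normr_ge0 andbT.
rewrite leNgt; apply/negP => ab0.
pose eps := `|b - a| / 2; have eps0 : 0 < eps by rewrite divr_gt0.
have na : \forall y \near x, `|a - partial 0 (partial 1 u) y| < eps.
  exact: (proj1 (cvgrPdist_lt _ _) (cp 0 1) _ eps0).
have nb : \forall y \near x, `|b - partial 1 (partial 0 u) y| < eps.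
  exact: (proj1 (cvgrPdist_lt _ _) (cp 1 0) _ eps0).
have [d d0 hd] := (nbhs_enormP _ _).1 (filterI (open_nbhs_nbhs (conj oA Ax)) (filterI na nb)).
pose h := d / 4; have h0 : 0 < h by rewrite divr_gt0.
have ed i : enorm (delta_mx 0 i : V) = 1.
  by rewrite /enorm dotE; case: (ord2E i) => ->; rewrite !mxE/= ?mulr0 ?mulr1 ?addr0 ?add0r sqrtr1.
have hb i j s t : 0 <= s <= h -> 0 <= t <= h ->
    enorm (x + s *: delta_mx 0 i + t *: delta_mx 0 j - x) < d.
  move=> /andP[s1 s2] /andP[t1 t2]; rewrite addrAC [x + _]addrC addrK.
  apply: le_lt_trans (ler_enormD _ _) _.
  by rewrite !enormZ !ed !ger0_norm// /h in s2 t2 *; lra.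
have [s [t [sh th E1]]] := second_difference (i:=0) (j:=1) h0 hu
   (fun s t sh th => (hd _ (hb 0 1 s t sh th)).1).
have [s' [t' [sh' th' E2]]] := second_difference (i:=1) (j:=0) h0 hu
   (fun s t sh th => (hd _ (hb 1 0 s t sh th)).1).
have wk (r : R) : 0 < r < h -> 0 <= r <= h by move=> /andP[r1 r2]; rewrite !ltW.
have [_ [_ /= H1]] := hd _ (hb 0 1 s t (wk _ sh) (wk _ th)).
have [_ [/= H2 _]] := hd _ (hb 1 0 s' t' (wk _ sh') (wk _ th')).
have : partial 1 (partial 0 u) (x + s *: delta_mx 0 0 + t *: delta_mx 0 1) =
       partial 0 (partial 1 u) (x + s' *: delta_mx 0 1 + t' *: delta_mx 0 0).
  apply: (mulIf (_ : h * h != 0)); first by rewrite mulf_neq0// gt_eqF.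
  have alg (p q r w : R) : p - q - (r - w) = p - r - (q - w) by ring.
  rewrite (addrAC x (h *: delta_mx 0 0) (h *: delta_mx 0 1)) in E1.
  exact: etrans (esym E1) (etrans (alg _ _ _ _) E2).
move=> E; move: H1; rewrite E -/b.
set p := partial 0 (partial 1 u) _ => H1; rewrite -/a -/p in H2.
have := ler_normB (b - p) (a - p); rewrite opprB addrA subrK => H3.
by have := le_lt_trans H3 (ltrD H1 H2); rewrite /eps -splitr ltxx.
Qed.

End mixed_partials.

(** * Potentials of closed one-forms on rectangles *)

Section poincare.
Context {R : realType}.
Notation V := 'rV[R]_2.
Notation mu := (@lebesgue_measure R).
Implicit Types (x y z v : V) (A : set V).

Lemma Rintegral_FTC2 (F f : R -> R) (a b : R) : a < b ->
  (forall t, a <= t <= b -> is_derive t 1 F (f t)) -> {within `[a, b], continuous f} ->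
  \int[mu]_(t in `[a, b]) f t = F b - F a.
Proof.
move=> ab dF cf; rewrite /Rintegral (@continuous_FTC2 _ f F)//.
  have cF t : a <= t <= b -> {for t, continuous F}.
    by move=> /dF[dv _]; exact/differentiable_continuous/derivable1_diffP.
  split.
  - by move=> t; rewrite in_itv/= => /andP[t1 t2]; have [] : is_derive t 1 F (f t) by apply: dF; rewrite !ltW.
  - by apply: cvg_at_right_filter; apply: cF; rewrite lexx ltW.
  - by apply: cvg_at_left_filter; apply: cF; rewrite lexx ltW.
move=> t; rewrite in_itv/= => /andP[t1 t2]; rewrite derive1E.
by have [] : is_derive t 1 F (f t) by apply: dF; rewrite !ltW.
Qed.

Definition pt (s t : R) : V := \row_i (if i == 0 then s else t).

Lemma ptE x : x = pt (x 0 0) (x 0 1).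
Proof. by apply: row2P; rewrite !mxE. Qed.

Lemma pt_line0 s t : pt s t = pt 0 t + s *: delta_mx 0 0.
Proof. by apply: row2P; rewrite !mxE /= ?mulr1 ?mulr0 ?add0r ?addr0. Qed.

Lemma pt_line1 s t : pt s t = pt s 0 + t *: delta_mx 0 1.
Proof. by apply: row2P; rewrite !mxE /= ?mulr1 ?mulr0 ?add0r ?addr0. Qed.

Lemma is_derive_pt0 (f : V -> R) (s t d : R) :
  is_derive (pt s t) (delta_mx 0 0) f d -> is_derive s 1 (fun s => f (pt s t)) d.
Proof.
rewrite pt_line0 => /is_derive_line; congr (is_derive _ _ _ _).
by apply/funext => s'; rewrite [in RHS]pt_line0.
Qed.

Lemma is_derive_pt1 (f : V -> R) (s t d : R) :
  is_derive (pt s t) (delta_mx 0 1) f d -> is_derive t 1 (fun t => f (pt s t)) d.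
Proof.
rewrite pt_line1 => /is_derive_line; congr (is_derive _ _ _ _).
by apply/funext => s'; rewrite [in RHS]pt_line1.
Qed.

Lemma is_derive_of_pt0 (f : V -> R) (s t d : R) :
  is_derive s 1 (fun s => f (pt s t)) d -> is_derive (pt s t) (delta_mx 0 0) f d.
Proof.
move=> h; apply: is_derive_line0.
have -> : (fun r : R => f (pt s t + r *: delta_mx 0 0)) = (fun s => f (pt s t)) \o shift s.
  apply/funext => r /=; congr f.
  by apply: row2P; rewrite !mxE /= ?mulr1 ?mulr0 ?addr0 // addrC.
have h' : is_derive (shift s 0) 1 (fun s => f (pt s t)) d by rewrite /= add0r.
by have := is_derive1_comp h' (is_derive_shift 0 1 s); rewrite mulr1.
Qed.

Lemma is_derive_of_pt1 (f : V -> R) (s t d : R) :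
  is_derive t 1 (fun t => f (pt s t)) d -> is_derive (pt s t) (delta_mx 0 1) f d.
Proof.
move=> h; apply: is_derive_line0.
have -> : (fun r : R => f (pt s t + r *: delta_mx 0 1)) = (fun t => f (pt s t)) \o shift t.
  apply/funext => r /=; congr f.
  by apply: row2P; rewrite !mxE /= ?mulr1 ?mulr0 ?addr0 // addrC.
have h' : is_derive (shift t 0) 1 (fun t => f (pt s t)) d by rewrite /= add0r.
by have := is_derive1_comp h' (is_derive_shift 0 1 t); rewrite mulr1.
Qed.

Lemma continuous_pt1 s : continuous (fun t => pt s t : V).
Proof.
move=> t; rewrite (_ : (fun t => pt s t) = (fun t => pt s 0 + t *: delta_mx 0 1)); last first.
  by apply/funext => t'; rewrite pt_line1.
by apply: cvgD; [exact: cvg_cst|apply: cvgZr_tmp; exact: cvg_id].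
Qed.

Lemma continuous_pt0 t : continuous (fun s => pt s t : V).
Proof.
move=> s; rewrite (_ : (fun s => pt s t) = (fun s => pt 0 t + s *: delta_mx 0 0)); last first.
  by apply/funext => t'; rewrite pt_line0.
by apply: cvgD; [exact: cvg_cst|apply: cvgZr_tmp; exact: cvg_id].
Qed.

Lemma compact_box (c0 c0' c1 c1' : R) :
  compact [set x : V | c0 <= x 0 0 <= c0' /\ c1 <= x 0 1 <= c1'].
Proof.
have c i : compact (if i == 0 :> 'I_2 then `[c0, c0']%classic else `[c1, c1']%classic).
  by case: ifP => _; exact: segment_compact.
rewrite (_ : [set x : V | _] = [set x : V | forall i, (if i == 0 :> 'I_2 then `[c0, c0']%classic else `[c1, c1']%classic) (x ord0 i)]).
  exact: (@rV_compact _ 2 (fun i => if i == 0 then `[c0, c0']%classic else `[c1, c1']%classic) c).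
apply/seteqP; split => x /=.
  by move=> [h0 h1] i; case: (ord2E i) => ->; rewrite /= in_itv.
by move=> h; split; [have := h 0|have := h 1]; rewrite /= in_itv.
Qed.

Lemma box_bounded (k : V -> R) (c0 c0' c1 c1' : R) : c0 <= c0' -> c1 <= c1' ->
  (forall s t, c0 <= s <= c0' -> c1 <= t <= c1' -> {for pt s t, continuous k}) ->
  exists2 M : R, 0 <= M & forall s t, c0 <= s <= c0' -> c1 <= t <= c1' -> `|k (pt s t)| <= M.
Proof.
move=> h0 h1 ck.
pose K := [set x : V | c0 <= x 0 0 <= c0' /\ c1 <= x 0 1 <= c1'].
have cK : {within K, continuous (fun x => `|k x|)}.
  apply: continuous_in_subspaceT => x /[!inE] -[x0 x1].
  by have := ck _ _ x0 x1; rewrite -ptE => /cvg_norm.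
have [|x _ xmax] := compact_EVT_max _ (@compact_box c0 c0' c1 c1') cK.
  by exists (pt c0 c1); rewrite /= !mxE /= !lexx h0 h1.
exists `|k x| => // s t hs ht; apply: (xmax (pt s t)).
by rewrite inE /= !mxE.
Qed.

(** The common cross derivative [k] says that a dx + b dy is closed. The potential integrates [a]
    along the bottom side and then [b] upwards. Its horizontal derivative is obtained under the
    integral sign, where the integral of [k] equals [a (pt s t) - a (pt s c1)]. *)
Lemma poincare_lemma A (a b k : V -> R) (c0 c0' c1 c1' : R) :
  c0 < c0' -> c1 < c1' ->
  (forall s t, c0 <= s <= c0' -> c1 <= t <= c1' -> A (pt s t)) ->
  (forall x, A x -> [/\ {for x, continuous a}, {for x, continuous b} & {for x, continuous k}]) ->
  (forall x, A x -> is_derive x (delta_mx 0 1) a (k x) /\ is_derive x (delta_mx 0 0) b (k x)) ->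
  exists psi : V -> R, forall s t, c0 < s < c0' -> c1 < t < c1' ->
    is_derive (pt s t) (delta_mx 0 0) psi (a (pt s t)) /\
    is_derive (pt s t) (delta_mx 0 1) psi (b (pt s t)).
Proof.
move=> c00 c11 box cA dA.
have wk (r u v : R) : u < r < v -> u <= r <= v by move=> /andP[r1 r2]; rewrite !ltW.
pose psi1 s t := \int[mu]_(r in `[c1, t]) b (pt s r).
pose psi2 s := \int[mu]_(r in `[c0, s]) a (pt r c1).
exists (fun x => psi1 (x 0 0) (x 0 1) + psi2 (x 0 0)) => s t hs ht.
have hs' := wk _ _ _ hs; have ht' := wk _ _ _ ht.
have [s1 s2] := andP hs; have [t1 t2] := andP ht.
have c1in : c1 <= c1 <= c1' by rewrite lexx ltW.
have cb1 s' : c0 <= s' <= c0' -> forall r, c1 <= r <= c1' -> {for r, continuous (fun r => b (pt s' r))}.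
  move=> hs'' r hr; apply: continuous_comp; first exact: continuous_pt1.
  by have [] := cA _ (box s' r hs'' hr).
have ck1 r : c1 <= r <= c1' -> {for r, continuous (fun r => k (pt s r))}.
  move=> hr; apply: continuous_comp; first exact: continuous_pt1.
  by have [] := cA _ (box s r hs' hr).
have ca0 r : c0 <= r <= c0' -> {for r, continuous (fun r => a (pt r c1))}.
  move=> hr; apply: continuous_comp; first exact: continuous_pt0.
  by have [] := cA _ (box r c1 hr c1in).
have int (f : R -> R) (u v : R) : (forall r, u <= r <= v -> {for r, continuous f}) ->
    mu.-integrable `[u, v] (EFin \o f).
  move=> cf; apply: continuous_compact_integrable; first exact: segment_compact.
  by apply: continuous_in_subspaceT => r /[!inE] /=; rewrite in_itv/=; exact: cf.
split.
- apply: is_derive_of_pt0.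
  have -> : (fun s => psi1 (pt s t 0 0) (pt s t 0 1) + psi2 (pt s t 0 0)) = psi1^~ t \+ psi2.
    by apply/funext => s' /=; rewrite !mxE.
  have d2 : is_derive s 1 psi2 (a (pt s c1)).
    have [|dv E] := continuous_FTC1_closed s2 (int _ _ _ ca0) s1 (f := fun r => a (pt r c1)).
      exact: ca0.
    by split; [exact: dv|rewrite -derive1E].
  (* A constant majorant of [k], as required for differentiation under the integral. *)
  have [M M0 hM] := box_bounded (ltW c00) (ltW c11) (fun s t hs ht => let: And3 _ _ c := cA _ (box s t hs ht) in c).
  have rt r : r \in `[c1, t] -> c1 <= r <= c1' by rewrite in_itv/= => /andP[-> /le_trans]; apply; rewrite ltW.
  pose f s r := b (pt s r).
  have d1f r' r : r' \in `]c0, c0'[ -> r \in `[c1, t] -> is_derive r' 1 (f^~ r) (k (pt r' r)).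
    rewrite in_itv/= => hr' /rt hr; apply: is_derive_pt0.
    by have [] := dA _ (box r' r (wk _ _ _ hr') hr).
  have Ia : [set` `]c0, c0'[] s by rewrite /= in_itv.
  have i1 (x : R) : [set` `]c0, c0'[] x -> mu.-integrable `[c1, t] (EFin \o f x).
    rewrite /= in_itv/= => hx; apply: int => r hr; apply: cb1; first exact: wk.
    by apply: rt; rewrite in_itv.
  have i2 (x y : R) : [set` `]c0, c0'[] x -> [set` `[c1, t]] y -> derivable (f^~ y) x 1.
    by move=> hx hy; have [] := d1f x y hx hy.
  have i3 : mu.-integrable `[c1, t] (EFin \o cst M).
    by apply: int => r _; exact: cst_continuous.
  have i4 (x y : R) : [set` `]c0, c0'[] x -> [set` `[c1, t]] y -> `|partial1of2 f x y| <= cst M y.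
    move=> hx hy; rewrite partial1of2E; have [_ ->] := d1f x y hx hy.
    by apply: hM; [apply: wk; move: hx; rewrite /= in_itv|exact: rt].
  have dv := @derivable_under_integral R _ (measurableTypeR R) mu f `[c1, t]%classic (measurable_itv _) s c0 c0' Ia i1 i2 (cst M) (fun=> M0) i3 i4.
  have E := @differentiation_under_integral R _ (measurableTypeR R) mu f `[c1, t]%classic (measurable_itv _) s c0 c0' Ia i1 i2 (cst M) (fun=> M0) i3 i4.
  have d1 : is_derive s 1 (psi1^~ t) (a (pt s t) - a (pt s c1)).
    split; first exact: dv.
    rewrite -derive1E [LHS]E.
    have da r : c1 <= r <= t -> is_derive r 1 (fun r => a (pt s r)) (k (pt s r)).
      move=> hr; apply: is_derive_pt1.
      by have [] := dA _ (box s r hs' (rt r _)); rewrite ?in_itv.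
    have ck : {within `[c1, t], continuous (fun r => k (pt s r))}.
      by apply: continuous_in_subspaceT => r /[!inE] hr; apply: ck1; exact: rt.
    apply: (etrans _ (Rintegral_FTC2 t1 da ck)).
    apply: eq_Rintegral => r /[!inE] hr; rewrite partial1of2E.
    by have [_ ->] := d1f s r Ia hr.
  by apply: is_derive_eq (is_deriveD d1 d2) _; rewrite subrK.
- apply: is_derive_of_pt1.
  have -> : (fun t => psi1 (pt s t 0 0) (pt s t 0 1) + psi2 (pt s t 0 0)) = psi1 s \+ cst (psi2 s).
    by apply/funext => t' /=; rewrite !mxE.
  have d2 : is_derive t 1 (psi1 s) (b (pt s t)).
    have [|dv E] := continuous_FTC1_closed t2 (int _ _ _ (cb1 s hs')) t1 (f := fun r => b (pt s r)).
      exact: cb1.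
    by split; [exact: dv|rewrite -derive1E].
  by apply: is_derive_eq (is_deriveD d2 (is_derive_cst _ _ _)) _; rewrite addr0.
Qed.

End poincare.

(** * Harmonic conjugates and unique continuation *)

Section unique_continuation.
Context {R : realType}.
Notation V := 'rV[R]_2.
Implicit Types (x y z v : V) (A : set V).

Lemma continuous_at_enorm (f : V -> R) x :
  (forall eps : R, 0 < eps -> exists2 d : R, 0 < d & forall y, enorm (y - x) < d -> `|f y - f x| < eps) ->
  {for x, continuous f}.
Proof.
move=> h B /nbhs_ballP[e /= e0 hB]; have [d d0 hd] := h e e0.
apply/(nbhs_enormP x (f @^-1` B)); exists d => // y yd; apply: hB.
by rewrite -ball_normE /= distrC; exact: hd.
Qed.

Lemma segment_lipschitz (f df : R -> R) (u v M s t : R) :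
  (forall r, u < r < v -> is_derive r 1 f (df r) /\ `|df r| <= M) ->
  u < s < v -> u < t < v -> `|f t - f s| <= M * `|t - s|.
Proof.
move=> h; wlog st : s t / s <= t.
  move=> W hs ht; have [st|ts] := leP s t; first exact: W.
  by rewrite distrC (distrC t s); apply: W => //; exact: ltW.
move=> /andP[s1 s2] /andP[t1 t2].
have inuv r : r \in `[s, t] -> u < r < v.
  by rewrite in_itv/= => /andP[r1 r2]; rewrite (lt_le_trans s1)// (le_lt_trans r2).
have [||c hc ->] := @MVT_segment _ f df s t st.
  by move=> r hr; have [] := h r (inuv r (subset_itv_oo_cc hr)).
  by apply: derivable_within_continuous => r hr; have [[]] := h r (inuv r hr).
by rewrite normrM ler_wpM2r//; have [] := h c (inuv c hc).
Qed.

(** The conjugate is known only through its partial derivatives. Moving along two sides of a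
    rectangle gives its continuity where they are bounded and its constancy where they vanish. *)
Lemma box_lipschitz (f d0 d1 : V -> R) (c0 c0' c1 c1' M : R) :
  (forall s t, c0 < s < c0' -> c1 < t < c1' ->
    [/\ is_derive (pt s t) (delta_mx 0 0) f (d0 (pt s t)),
        is_derive (pt s t) (delta_mx 0 1) f (d1 (pt s t)),
        `|d0 (pt s t)| <= M & `|d1 (pt s t)| <= M]) ->
  forall s t s' t', c0 < s < c0' -> c1 < t < c1' -> c0 < s' < c0' -> c1 < t' < c1' ->
    `|f (pt s' t') - f (pt s t)| <= M * (`|s' - s| + `|t' - t|).
Proof.
move=> h s t s' t' hs ht hs' ht'.
have h1 : `|f (pt s' t') - f (pt s t')| <= M * `|s' - s|.
  apply: (@segment_lipschitz (fun s => f (pt s t')) (fun s => d0 (pt s t')) c0 c0') => // r hr.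
  by have [dd _ b _] := h r t' hr ht'; split => //; exact: is_derive_pt0.
have h2 : `|f (pt s t') - f (pt s t)| <= M * `|t' - t|.
  apply: (@segment_lipschitz (fun t => f (pt s t)) (fun t => d1 (pt s t)) c1 c1') => // r hr.
  by have [_ dd _ b] := h s r hs hr; split => //; exact: is_derive_pt1.
rewrite mulrDr; apply: le_trans (lerD h1 h2).
by apply: le_trans (ler_normD _ _); rewrite addrA subrK.
Qed.

(* Pairs (a, b) such that a + i b has complex derivative a' + i b' on A. *)
Definition complex_derivative A (a b a' b' : V -> R) : Prop := forall x, A x ->
  [/\ is_derive x (delta_mx 0 0) a (a' x), is_derive x (delta_mx 0 1) a (- b' x),
      is_derive x (delta_mx 0 0) b (b' x) & is_derive x (delta_mx 0 1) b (a' x)].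

Lemma complex_derivativeD A (a b a' b' c d c' d' : V -> R) :
  complex_derivative A a b a' b' -> complex_derivative A c d c' d' ->
  complex_derivative A (fun x => a x + c x) (fun x => b x + d x)
    (fun x => a' x + c' x) (fun x => b' x + d' x).
Proof.
move=> h k x Ax; have [h1 h2 h3 h4] := h x Ax; have [k1 k2 k3 k4] := k x Ax.
split; [exact: (is_deriveD h1 k1)| |exact: (is_deriveD h3 k3)|exact: (is_deriveD h4 k4)].
by apply: is_derive_eq (is_deriveD h2 k2) _; rewrite opprD.
Qed.

(** Multiplication by -i. Iterating it turns upper bounds for real parts into bounds for the
    modulus. *)
Lemma complex_derivative_rot A (a b a' b' : V -> R) :
  complex_derivative A a b a' b' ->
  complex_derivative A b (fun x => - a x) b' (fun x => - a' x).
Proof.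
move=> h x Ax; have [h1 h2 h3 h4] := h x Ax.
split => //; [by rewrite opprK|exact: (is_deriveN h1)|].
by apply: is_derive_eq (is_deriveN h2) _; rewrite opprK.
Qed.

Lemma complex_derivativeM A (a b a' b' c d c' d' : V -> R) :
  complex_derivative A a b a' b' -> complex_derivative A c d c' d' ->
  complex_derivative A
    (fun x => a x * c x - b x * d x) (fun x => a x * d x + b x * c x)
    (fun x => (a' x * c x - b' x * d x) + (a x * c' x - b x * d' x))
    (fun x => (a' x * d x + b' x * c x) + (a x * d' x + b x * c' x)).
Proof.
move=> h k x Ax; have [h1 h2 h3 h4] := h x Ax; have [k1 k2 k3 k4] := k x Ax.
split.
- by apply: is_derive_eq (is_deriveB (is_deriveM h1 k1) (is_deriveM h3 k3)) _; rewrite /GRing.scale /=; ring.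
- by apply: is_derive_eq (is_deriveB (is_deriveM h2 k2) (is_deriveM h4 k4)) _; rewrite /GRing.scale /=; ring.
- by apply: is_derive_eq (is_deriveD (is_deriveM h1 k3) (is_deriveM h3 k1)) _; rewrite /GRing.scale /=; ring.
- by apply: is_derive_eq (is_deriveD (is_deriveM h2 k4) (is_deriveM h4 k2)) _; rewrite /GRing.scale /=; ring.
Qed.

(** Two complex derivatives make the real part harmonic, its pure second partials being [a''] and
    [- a''], and the class is closed under products. *)
Definition twice_holomorphic A (a b : V -> R) : Prop := exists a' b' a'' b'',
  complex_derivative A a b a' b' /\ complex_derivative A a' b' a'' b''.

Lemma twice_holomorphic_rot A (a b : V -> R) :
  twice_holomorphic A a b -> twice_holomorphic A b (fun x => - a x).
Proof.
move=> [a' [b' [a'' [b'' [h1 h2]]]]].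
exists b', (fun x => - a' x), b'', (fun x => - a'' x).
by split; exact: complex_derivative_rot.
Qed.

Lemma twice_holomorphicM A (a b c d : V -> R) :
  twice_holomorphic A a b -> twice_holomorphic A c d ->
  twice_holomorphic A (fun x => a x * c x - b x * d x) (fun x => a x * d x + b x * c x).
Proof.
move=> [a' [b' [a'' [b'' [h1 h2]]]]] [c' [d' [c'' [d'' [k1 k2]]]]].
do 4 eexists; split; first exact: complex_derivativeM h1 k1.
exact: complex_derivativeD (complex_derivativeM h2 k1) (complex_derivativeM h1 k2).
Qed.

Lemma twice_holomorphic_harmonic A (a b : V -> R) : twice_holomorphic A a b ->
  exists d1 d2, twice_partial A a d1 d2 /\ forall x, A x -> d2 0 x + d2 1 x = 0.
Proof.
move=> [a' [b' [a'' [b'' [h1 h2]]]]].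
exists (fun i => if i == 0 then a' else fun x => - b' x),
  (fun i => if i == 0 then a'' else fun x => - a'' x); split.
  move=> i x Ax; have [k1 k2 _ _] := h1 x Ax; have [l1 _ _ l4] := h2 x Ax.
  by case: (ord2E i) => -> /=; split => //; exact: is_deriveN.
by move=> x _ /=; rewrite subrr.
Qed.

(** The pair is 1 / (x - z), the conjugate over the squared modulus. Its derivative is minus its
    square, so the second derivative follows from the product rule, two rotations supplying the
    sign. *)
Lemma twice_holomorphic_inv z : twice_holomorphic [set x | 0 < dist2 z x]
  (fun x => (x 0 0 - z 0 0) * (dist2 z x)^-1) (fun x => - (x 0 1 - z 0 1) * (dist2 z x)^-1).
Proof.
pose a x := (x 0 0 - z 0 0) * (dist2 z x)^-1.
pose b x := - (x 0 1 - z 0 1) * (dist2 z x)^-1.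
have h : complex_derivative [set x | 0 < dist2 z x] a b
    (fun x => - (a x * a x - b x * b x)) (fun x => - (a x * b x + b x * a x)).
  move=> x /= q0; have q1 : dist2 z x != 0 by rewrite gt_eqF.
  have dc i v := is_deriveB (is_derive_coord x v i) (is_derive_cst (z 0 i) x v).
  have dq i := is_derive_inv q1 (is_derive_dist2 x z (delta_mx 0 i)).
  have qE : dist2 z x = (x 0 0 - z 0 0) ^+ 2 + (x 0 1 - z 0 1) ^+ 2.
    by rewrite /dist2 dotE !mxE !expr2.
  have qn : (x 0 0 - z 0 0) ^+ 2 + (x 0 1 - z 0 1) ^+ 2 != 0 by rewrite -qE.
  split; [apply: is_derive_eq (is_deriveM (dc 0 _) (dq 0)) _
         |apply: is_derive_eq (is_deriveM (dc 0 _) (dq 1)) _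
         |apply: is_derive_eq (is_deriveM (is_deriveN (dc 1 _)) (dq 0)) _
         |apply: is_derive_eq (is_deriveM (is_deriveN (dc 1 _)) (dq 1)) _];
  rewrite /GRing.scale /= !fctE dist2_delta /a /b !mxE /= qE; by field.
exists (fun x => - (a x * a x - b x * b x)), (fun x => - (a x * b x + b x * a x)).
do 2 eexists; split; first exact: h.
exact: complex_derivative_rot (complex_derivative_rot (complex_derivativeM h h)).
Qed.

Lemma twice_holomorphic_le A B (a b : V -> R) : B `<=` A ->
  twice_holomorphic A a b -> twice_holomorphic B a b.
Proof.
move=> BA [a' [b' [a'' [b'' [h1 h2]]]]]; exists a', b', a'', b''.
by split => x /BA; [exact: h1|exact: h2].
Qed.

Lemma annulus_max (a b : V -> R) z (r1 r2 K : R) : 0 < r1 -> r1 < r2 ->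
  twice_holomorphic [set x | r1 ^+ 2 < dist2 z x < r2 ^+ 2] a b ->
  (forall x, r1 ^+ 2 <= dist2 z x <= r2 ^+ 2 -> {for x, continuous a}) ->
  (forall x, dist2 z x = r1 ^+ 2 \/ dist2 z x = r2 ^+ 2 -> a x <= K) ->
  forall x, r1 ^+ 2 < dist2 z x < r2 ^+ 2 -> a x <= K.
Proof.
move=> r10 r12 hol ca bd x xin.
set An := [set x | r1 ^+ 2 < dist2 z x < r2 ^+ 2] in hol.
have oA : open An.
  rewrite (_ : An = (dist2 z) @^-1` [set t | r1 ^+ 2 < t] `&` (dist2 z) @^-1` [set t | t < r2 ^+ 2]).
    by apply: openI; apply: open_comp => [? _|]; solve [exact: continuous_dist2|exact: open_gt|exact: open_lt].
  by apply/seteqP; split => y /= => [/andP[]|[]]; rewrite /An /= => -> ->.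
have clA y : closure An y -> r1 ^+ 2 <= dist2 z y <= r2 ^+ 2.
  have clo : closed [set y | r1 ^+ 2 <= dist2 z y <= r2 ^+ 2].
    rewrite (_ : [set y | _] = (dist2 z) @^-1` [set t | r1 ^+ 2 <= t] `&` (dist2 z) @^-1` [set t | t <= r2 ^+ 2]).
      by apply: closedI; apply: closed_comp => [? _|]; solve [exact: continuous_dist2|exact: closed_ge|exact: closed_le].
    by apply/seteqP; split => w /= => [/andP[]|[-> ->]].
  by move=> cy; apply: clo; apply: closureS cy => w /= /andP[/ltW-> /ltW].
have bA : bounded_set An.
  exists (`|z| + r2); split; first exact: num_real.
  move=> N hN y /= /andP[_ y2].
  have yz : `|y - z| < r2.
    by apply: le_lt_trans (normr_le_enorm _) _; rewrite enorm_lt//; lra.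
  by have := ler_normD (y - z) z; rewrite subrK; lra.
have [d1 [d2 [tp lap]]] := twice_holomorphic_harmonic hol.
apply: (weak_max oA bA _ tp).
- by apply: continuous_in_subspaceT => y /[!inE] /clA; exact: ca.
- by move=> y Ay; rewrite lap.
- move=> y /clA /andP[y1 y2] nAy; apply: bd.
  have [e1|n1] := eqVneq (dist2 z y) (r1 ^+ 2); first by left.
  right; apply/eqP; apply/negPn/negP => n2; apply: nAy.
  by rewrite /An /= !lt_neqAle eq_sym n1 n2 y1 y2.
- exact: subset_closure.
Qed.

(** The pair is (f + i g) / (x - z)^n; only its squared modulus is recorded, which is what the
    estimates on circles use. *)
Lemma holomorphic_divX A (f g : V -> R) z (n : nat) : A `<=` [set x | 0 < dist2 z x] ->
  twice_holomorphic A f g ->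
  (forall x, A x -> {for x, continuous f} /\ {for x, continuous g}) ->
  exists a b, [/\ twice_holomorphic A a b,
    forall x, A x -> {for x, continuous a} /\ {for x, continuous b} &
    forall x, 0 < dist2 z x ->
      a x ^+ 2 + b x ^+ 2 = (f x ^+ 2 + g x ^+ 2) * (dist2 z x)^-1 ^+ n].
Proof.
move=> Az hol cfg; elim: n => [|n [a [b [hab cab eab]]]].
  by exists f, g; split => // x _; rewrite expr0 mulr1.
pose c x := (x 0 0 - z 0 0) * (dist2 z x)^-1.
pose d x := - (x 0 1 - z 0 1) * (dist2 z x)^-1.
have hcd : twice_holomorphic A c d by apply: twice_holomorphic_le Az (twice_holomorphic_inv z).
exists (fun x => a x * c x - b x * d x), (fun x => a x * d x + b x * c x); split.
- exact: twice_holomorphicM hab hcd.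
- move=> x Ax; have [ca cb] := cab x Ax.
  have ci : (fun x => (dist2 z x)^-1) @ x --> (dist2 z x)^-1.
    by apply: continuous_invdist2; exact: Az.
  have h i : (fun x : V => x 0 i - z 0 i) @ x --> x 0 i - z 0 i.
    have h0 : (fun x : V => x 0 i) @ x --> x 0 i by exact: continuous_coord.
    exact: (cvgB h0 (cvg_cst _)).
  have cc : c @ x --> c x by exact: (cvgM (h 0) ci).
  have cd : d @ x --> d x by exact: (cvgM (cvgN (h 1)) ci).
  split; first exact: (cvgB (cvgM ca cc) (cvgM cb cd)).
  exact: (cvgD (cvgM ca cd) (cvgM cb cc)).
- move=> x q0; rewrite [_^-1 ^+ n.+1]exprSr [RHS]mulrA -eab//.
  have E : c x ^+ 2 + d x ^+ 2 = (dist2 z x)^-1.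
    have qE : dist2 z x = (x 0 0 - z 0 0) ^+ 2 + (x 0 1 - z 0 1) ^+ 2.
      by rewrite /dist2 dotE !mxE !expr2.
    rewrite /c /d; move: q0; rewrite qE => q0; field; lra.
  rewrite -E; ring.
Qed.

Lemma geometric_le0 (c C r : R) : 0 <= r < 1 -> (forall n, c <= C * r ^+ n) -> c <= 0.
Proof.
move=> /andP[r0 r1] h.
have cv : (fun n => C * r ^+ n) @ \oo --> C * 0.
  apply: cvgM; first exact: cvg_cst.
  by apply: cvg_expr; rewrite ger0_norm.
rewrite mulr0 in cv.
rewrite -(cvg_lim _ cv)//; apply: limr_ge; first by apply/cvg_ex; exists 0.
exact: nearW.
Qed.

Lemma ball_box z (l : R) x : enorm (x - z) < l ->
  z 0 0 - l < x 0 0 < z 0 0 + l /\ z 0 1 - l < x 0 1 < z 0 1 + l.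
Proof.
move=> /(le_lt_trans (normr_le_enorm _)) xz.
have := le_lt_trans (coord_le_norm _ 0) xz; have := le_lt_trans (coord_le_norm _ 1) xz.
by rewrite !mxE !ltr_norml => /andP[? ?] /andP[? ?]; split; apply/andP; split; lra.
Qed.

(** [psi] is a potential of the form with components [- partial 1 u] and [partial 0 u], closed
    because [u] is harmonic. For the last clause, the gradient of [u], hence that of [psi], vanishes
    where [u] is locally constant. *)
Lemma harmonic_conjugate A (u : V -> R) z (l : R) : open A -> 0 < l -> harmonic_on A u ->
  (forall x, z 0 0 - l <= x 0 0 <= z 0 0 + l -> z 0 1 - l <= x 0 1 <= z 0 1 + l -> A x) ->
  exists psi, [/\
    twice_holomorphic [set x | enorm (x - z) < l] u psi,
    forall x, enorm (x - z) < l -> {for x, continuous psi} &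
    (\forall x \near z, u x = u z) -> \forall x \near z, psi x = psi z].
Proof.
move=> oA l0 hu box; have [c0 c1 lap] := hu.
have tp := harmonic_twice hu.
have lapE x : A x -> partial 0 (partial 0 u) x + partial 1 (partial 1 u) x = 0.
  move=> /lap; rewrite /laplacian big_ord_recl big_ord1.
  by rewrite (_ : lift ord0 ord0 = 1)//; exact/val_inj.
have lapN x : A x -> - partial 1 (partial 1 u) x = partial 0 (partial 0 u) x.
  by move=> /lapE/eqP; rewrite addr_eq0 => /eqP ->.
have box' s t : z 0 0 - l <= s <= z 0 0 + l -> z 0 1 - l <= t <= z 0 1 + l -> A (pt s t).
  by move=> hs ht; apply: box; rewrite mxE.
have cA x : A x -> [/\ {for x, continuous (fun x => - partial 1 u x)},
    {for x, continuous (partial 0 u)} & {for x, continuous (partial 0 (partial 0 u))}].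
  move=> Ax; have [_ k] := c0 x Ax; have [_ k'] := c1 0 x Ax; split => //.
  exact: cvgN (k 1).
have dA x : A x -> is_derive x (delta_mx 0 1) (fun x => - partial 1 u x) (partial 0 (partial 0 u) x) /\
    is_derive x (delta_mx 0 0) (partial 0 u) (partial 0 (partial 0 u) x).
  move=> Ax; have [_ k0] := tp 0 x Ax; have [_ k1] := tp 1 x Ax; split; last exact: k0.
  exact: is_derive_eq (is_deriveN k1) (lapN x Ax).
have [psi hpsi] := @poincare_lemma _ A _ _ _ (z 0 0 - l) (z 0 0 + l) (z 0 1 - l) (z 0 1 + l)
  ltac:(lra) ltac:(lra) box' cA dA.
have wk (r s t : R) : s < r < t -> s <= r <= t by move=> /andP[r1 r2]; rewrite !ltW.
have dpsi x : enorm (x - z) < l -> [/\ A x, is_derive x (delta_mx 0 0) psi (- partial 1 u x) &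
    is_derive x (delta_mx 0 1) psi (partial 0 u x)].
  move=> /ball_box[b0 b1]; have [d0 d1] := hpsi _ _ b0 b1; rewrite -ptE in d0 d1.
  by split; [apply: box; exact: wk|exact: d0|exact: d1].
have lip (r M : R) x : 0 < r -> (forall s t, x 0 0 - r < s < x 0 0 + r -> x 0 1 - r < t < x 0 1 + r ->
      enorm (pt s t - z) < l /\ `|partial 1 u (pt s t)| <= M /\ `|partial 0 u (pt s t)| <= M) ->
    forall y, enorm (y - x) < r -> `|psi y - psi x| <= M * (`|y 0 0 - x 0 0| + `|y 0 1 - x 0 1|).
  move=> r0 h y /ball_box[b0 b1].
  rewrite {1}(ptE y) {1}(ptE x); apply: (@box_lipschitz psi (fun x => - partial 1 u x) (partial 0 u)
    (x 0 0 - r) (x 0 0 + r) (x 0 1 - r) (x 0 1 + r)) => //; try (apply/andP; split; lra).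
  move=> s t hs ht; have [/dpsi[_ k0 k1] [k2 k3]] := h s t hs ht.
  by split; [exact: k0|exact: k1|rewrite normrN|].
have small x (B : set V) : (\forall y \near x, B y) -> exists2 r : R, 0 < r &
    forall s t, x 0 0 - r < s < x 0 0 + r -> x 0 1 - r < t < x 0 1 + r -> B (pt s t).
  move=> /nbhs_enormP[d d0 hd]; exists (d / 2); first by rewrite divr_gt0.
  move=> s t /andP[s1 s2] /andP[t1 t2]; apply: hd.
  apply: le_lt_trans (enorm_le_normr _) _.
  suff : `|pt s t - x| < d / 2 by lra.
  by apply: norm_lt_coord; rewrite !mxE /= ltr_norml; apply/andP; split; lra.
have inball x : enorm (x - z) < l -> \forall y \near x, enorm (y - z) < l.
  move=> xz; apply/nbhs_enormP; exists (l - enorm (x - z)); first by rewrite subr_gt0.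
  by move=> y yx; have := ler_enormD (y - x) (x - z); rewrite addrA subrK; lra.
exists psi; split.
(* The derivative of [u + i psi] is [partial 0 u - i partial 1 u]; its own Cauchy-Riemann equations
   are harmonicity and the equality of mixed partials. *)
- exists (partial 0 u), (fun x => - partial 1 u x), (partial 0 (partial 0 u)), (fun x => - partial 0 (partial 1 u) x).
  split => x /= xz; have [Ax k0 k1] := dpsi x xz.
    split; [by have [] := tp 0 x Ax|by rewrite opprK; have [] := tp 1 x Ax|exact: k0|exact: k1].
  have [_ t1] := tp 1 x Ax; have [_ t0] := tp 0 x Ax.
  split; first exact: t0.
  + rewrite opprK (mixed_partials oA hu Ax).
    by split; [apply: diff_derivable; have [] := c1 0 x Ax|reflexivity].
  + have d01 : is_derive x (delta_mx 0 0) (partial 1 u) (partial 0 (partial 1 u) x).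
      by split; [apply: diff_derivable; have [] := c1 1 x Ax|reflexivity].
    exact: (is_deriveN d01).
  + by have [] := dA x Ax.
- move=> x xz; have [Ax _ _] := dpsi x xz.
  have [_ k] := c0 x Ax.
  pose M := `|partial 0 u x| + `|partial 1 u x| + 1.
  have M0 : 0 < M by rewrite ltr_wpDl// addr_ge0.
  have nM i : \forall y \near x, `|partial i u y| < M.
    have ci : (fun y => `|partial i u y|) @ x --> `|partial i u x| by exact: cvg_norm (k i).
    have ltM (p q : R) : `|p| < `|p| + `|q| + 1 by rewrite -addrA ltrDl ltr_wpDl.
    apply: (cvgr_lt _ ci); rewrite /M.
    by case: (ord2E i) => ->; [exact: ltM|rewrite [X in X + 1]addrC; exact: ltM].
  have [r r0 hr] := small x _ (filterI (inball x xz) (filterI (nM 1) (nM 0))).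
  have L := lip r M x r0 (fun s t hs ht => let: conj a (conj b c) := hr s t hs ht in
    conj a (conj (ltW b) (ltW c))).
  apply: continuous_at_enorm => eps eps0.
  exists (Num.min r (eps / (2 * M))).
    by rewrite lt_min r0 divr_gt0// mulr_gt0.
  move=> y; rewrite lt_min => /andP[yr ye].
  apply: le_lt_trans (L y yr) _.
  have := coord_le_norm (y - x) 0; have := coord_le_norm (y - x) 1; rewrite !mxE => h1 h0.
  have h2 := normr_le_enorm (y - x).
  have h3 : enorm (y - x) * (2 * M) < eps by rewrite -ltr_pdivlMr// mulr_gt0.
  apply: le_lt_trans h3; rewrite mulrC mulrA ler_pM2r//; lra.
- move=> uz.
  have z0 : enorm (z - z) < l by rewrite subrr /enorm dotE !mxE mulr0 addr0 sqrtr0.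
  have uz2 : \forall x \near z, \forall y \near x, u y = u z by exact: (near_join uz).
  have part0 i x : (\forall y \near x, u y = u z) -> partial i u x = 0.
    move=> h; rewrite /partial.
    have dc : is_derive x (delta_mx 0 i) u 0.
      by apply: near_eq_is_derive (is_derive_cst (u z) x (delta_mx 0 i)); apply: filterS h => y ->.
    by have [] := dc.
  have [r r0 hr] := small z _ (filterI (inball z z0) uz2).
  have L := lip r 0 z r0.
  apply/nbhs_enormP; exists r => // y yr; apply/eqP; rewrite -subr_eq0 -normr_le0.
  rewrite -[leRHS](mul0r (`|y 0 0 - z 0 0| + `|y 0 1 - z 0 1|)); apply: L => // s t hs ht.
  by have [k1 k2] := hr s t hs ht; rewrite !part0// normr0.
Qed.

(* With psi a harmonic conjugate of u, F = (u - M) + i (psi - psi z) vanishes near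
   z; the maximum principle for the real parts of i^k F(x) / (x - z)^n on an
   annulus of outer radius r2 bounds |F(x)| by a multiple of (|x - z| / r2)^n. *)
Lemma unique_continuation_disc A (u : V -> R) z (l M : R) : open A -> 0 < l -> harmonic_on A u ->
  (forall x, z 0 0 - l <= x 0 0 <= z 0 0 + l -> z 0 1 - l <= x 0 1 <= z 0 1 + l -> A x) ->
  (\forall x \near z, u x = M) -> forall x, enorm (x - z) < l -> u x = M.
Proof.
move=> oA l0 hu box uz x xl.
have [psi [hol cpsi nearpsi]] := harmonic_conjugate oA l0 hu box.
have zM : u z = M by exact: nbhs_singleton uz.
have {}nearpsi : \forall x \near z, psi x = psi z by apply: nearpsi; rewrite zM.
pose f y := u y - M; pose g y := psi y - psi z.
have hfg : twice_holomorphic [set y | enorm (y - z) < l] f g.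
  have [a' [b' [a'' [b'' [h1 h2]]]]] := hol; exists a', b', a'', b''; split => //.
  move=> y yl; have [k1 k2 k3 k4] := h1 y yl.
  have cst0 (c d : R) v (h : V -> R) : is_derive y v h d -> is_derive y v (fun y => h y - c) d.
    by move=> hh; apply: is_derive_eq (is_deriveB hh (is_derive_cst c y v)) _; rewrite subr0.
  split; [exact: cst0 k1|exact: cst0 k2|exact: cst0 k3|exact: cst0 k4].
have cfg y : enorm (y - z) < l -> {for y, continuous f} /\ {for y, continuous g}.
  move=> yl; split.
    have [c0 _ _] := hu; have [b0 b1] := ball_box yl.
    have Ay : A y by apply: box; apply/andP; split; lra.
    have [/differentiable_continuous cu _] := c0 y Ay.
    exact: (cvgB cu (cvg_cst _)).
  exact: (cvgB (cpsi y yl) (cvg_cst _)).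
have [r r0 hr] := (nbhs_enormP _ _).1 (filterI uz nearpsi).
have f0 y : enorm (y - z) < r -> f y = 0 /\ g y = 0.
  by move=> /hr[uy py]; rewrite /f /g uy py !subrr.
have [xr|xr] := ltP (enorm (x - z)) r.
  by apply/eqP; rewrite -subr_eq0; have [/eqP] := f0 x xr.
(* The inner circle lies where F vanishes; the outer one passes between [x] and the edge of the disc
   of radius [l]. *)
pose r1 := r / 2; pose r2 := (enorm (x - z) + l) / 2.
have r10 : 0 < r1 by rewrite divr_gt0.
have r12 : r1 < r2 by rewrite /r1 /r2; lra.
have r2l : r2 < l by rewrite /r2; lra.
have r20 : 0 < r2 by lra.
have xr2 : enorm (x - z) < r2 by rewrite /r2; lra.
have xin : r1 ^+ 2 < dist2 z x < r2 ^+ 2.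
  by rewrite dist2_enorm !ltr_pXn2r// ?nnegrE ?enorm_ge0//; rewrite ?ltW// xr2 andbT /r1; lra.
have lt_dist y t : 0 <= t -> (dist2 z y < t ^+ 2) = (enorm (y - z) < t).
  by move=> t0; rewrite enorm_lt.
have le_dist y t : 0 <= t -> (dist2 z y <= t ^+ 2) = (enorm (y - z) <= t).
  by move=> t0; rewrite enorm_le.
have ann y : r1 ^+ 2 <= dist2 z y <= r2 ^+ 2 -> 0 < dist2 z y /\ enorm (y - z) < l.
  move=> /andP[h1 h2]; split; first by apply: lt_le_trans h1; rewrite exprn_gt0.
  by move: h2; rewrite le_dist; lra.
have [B B0 hB] : exists2 B : R, 0 < B & forall y, dist2 z y = r2 ^+ 2 -> f y ^+ 2 + g y ^+ 2 <= B.
  pose K := [set y | dist2 z y <= r2 ^+ 2].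
  have cK : compact K.
    apply: bounded_closed_compact.
      exists (`|z| + r2); split; first exact: num_real.
      move=> N hN y; rewrite /K /= (le_dist _ _ (ltW r20)) => yz.
      have := normr_le_enorm (y - z); have := ler_normD (y - z) z; rewrite subrK; lra.
    apply: (@closed_comp _ _ (dist2 z) [set t | t <= r2 ^+ 2]); last exact: closed_le.
    by move=> y _; exact: continuous_dist2.
  have ch : {within K, continuous (fun y => f y ^+ 2 + g y ^+ 2)}.
    apply: continuous_in_subspaceT => y /[!inE]; rewrite /K /= (le_dist _ _ (ltW r20)) => yz.
    have [cf cg] := cfg y (le_lt_trans yz r2l).
    exact: (cvgD (cvgM cf cf) (cvgM cg cg)).
  have [|y _ ymax] := compact_EVT_max _ cK ch.
    by exists x; rewrite /K /=; case/andP: xin => _ /ltW.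
  exists (f y ^+ 2 + g y ^+ 2 + 1); first by rewrite ltr_wpDl// addr_ge0// sqr_ge0.
  move=> y' hy'; have := ymax y'; rewrite inE /K /= hy' lexx => /(_ isT); lra.
have hfg' : twice_holomorphic [set y | 0 < dist2 z y /\ enorm (y - z) < l] f g.
  by apply: twice_holomorphic_le hfg => y [].
have key n : f x ^+ 2 <= 2 * B * (dist2 z x / r2 ^+ 2) ^+ n.
  have [a [b [hab cab eab]]] := @holomorphic_divX _ f g z n (fun y => @proj1 _ _) hfg'
    (fun y h => cfg y h.2).
  have in0 : 0 <= (r2 ^+ 2)^-1 ^+ n by rewrite exprn_ge0// invr_ge0 sqr_ge0.
  have Bn0 : 0 <= B * (r2 ^+ 2)^-1 ^+ n by rewrite mulr_ge0// ltW.
  pose K := Num.sqrt (B * (r2 ^+ 2)^-1 ^+ n).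
  have K2 : K ^+ 2 = B * (r2 ^+ 2)^-1 ^+ n.
    by rewrite sqr_sqrtr.
  (* On the inner circle the quotient vanishes, on the outer one its squared modulus is at most
     [K ^+ 2]. The maximum principle bounds the real part from above, so it is applied to the four
     rotations of [(a, b)]; adding the squares of both parts produces the factor 2 in [key]. *)
  have bound c d : twice_holomorphic [set y | 0 < dist2 z y /\ enorm (y - z) < l] c d ->
      (forall y, 0 < dist2 z y /\ enorm (y - z) < l -> {for y, continuous c}) ->
      (forall y, 0 < dist2 z y -> c y ^+ 2 <= a y ^+ 2 + b y ^+ 2) -> c x <= K.
    move=> hcd cc cd; apply: (annulus_max r10 r12 (a := c) (b := d)) xin.
    - apply: twice_holomorphic_le hcd => y /= /andP[h1 h2].
      by apply: ann; rewrite !ltW.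
    - by move=> y /ann; exact: cc.
    - move=> y yb.
      have y0 : 0 < dist2 z y by case: yb => ->; rewrite exprn_gt0.
      apply: le_trans (ler_norm _) _.
      rewrite -(@ler_pXn2r _ 2)// ?nnegrE ?sqrtr_ge0// real_normK ?num_real// K2.
      apply: le_trans (cd y y0) _; rewrite eab//.
      case: yb => yE.
        have [-> ->] : f y = 0 /\ g y = 0.
          by apply: f0; rewrite -(lt_dist _ _ (ltW r0)) yE ltr_pXn2r// ?nnegrE; rewrite ?ltW// /r1; lra.
        by rewrite !expr0n /= addr0 mul0r.
      by rewrite yE ler_wpM2r// hB.
  have ax : a x <= K.
    by apply: (bound a b) => // [y /cab[]//|y _]; rewrite lerDl sqr_ge0.
  have bx : b x <= K.
    apply: (bound b _ (twice_holomorphic_rot hab)) => [y /cab[]//|y _].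
    by rewrite lerDr sqr_ge0.
  have cN (h : V -> R) y : {for y, continuous h} -> {for y, continuous (fun y => - h y)}.
    by move=> ch; exact: (cvgN ch).
  have nax : - a x <= K.
    apply: (bound (fun y => - a y) _ (twice_holomorphic_rot (twice_holomorphic_rot hab))).
      by move=> y /cab[/cN].
    by move=> y _; rewrite sqrrN lerDl sqr_ge0.
  have nbx : - b x <= K.
    apply: (bound (fun y => - b y) _ (twice_holomorphic_rot (twice_holomorphic_rot (twice_holomorphic_rot hab)))).
      by move=> y /cab[_ /cN].
    by move=> y _; rewrite sqrrN lerDr sqr_ge0.
  have sq (p : R) : p <= K -> - p <= K -> p ^+ 2 <= K ^+ 2.
    move=> p1 p2; have : `|p| <= K by rewrite ler_norml; apply/andP; split; lra.
    by move=> h; rewrite -[p ^+ 2]real_normK ?num_real// ler_pXn2r// nnegrE// (le_trans _ h).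
  have x0 : 0 < dist2 z x by case/andP: xin => h _; apply: lt_trans h; rewrite exprn_gt0.
  have : a x ^+ 2 + b x ^+ 2 <= 2 * K ^+ 2.
    have := sq _ ax nax; have := sq _ bx nbx; lra.
  rewrite eab// K2 => le1.
  have le2 : f x ^+ 2 * (dist2 z x)^-1 ^+ n <= 2 * (B * (r2 ^+ 2)^-1 ^+ n).
    apply: le_trans le1; rewrite ler_wpM2r ?lerDl ?sqr_ge0// exprn_ge0// invr_ge0; exact: ltW.
  have dn : 0 < dist2 z x ^+ n by rewrite exprn_gt0.
  rewrite -(ler_pM2r dn) in le2.
  have E : (dist2 z x)^-1 ^+ n * dist2 z x ^+ n = 1 by rewrite -exprMn mulVf ?gt_eqF// expr1n.
  rewrite -[leLHS]mulrA E mulr1 in le2; apply: le_trans le2 _.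
  rewrite (_ : (dist2 z x / r2 ^+ 2) ^+ n = dist2 z x ^+ n * (r2 ^+ 2)^-1 ^+ n); last exact: exprMn.
  by rewrite [X in _ <= _ * X]mulrC !mulrA.
have : f x ^+ 2 <= 0.
  apply: geometric_le0 key; case/andP: xin => h1 h2.
  by rewrite divr_ge0 ?sqr_ge0 ?dot_ge0//= ltr_pdivrMr ?exprn_gt0// mul1r.
by move=> h; apply/eqP; rewrite -subr_eq0 -sqrf_eq0 eq_le h sqr_ge0.
Qed.

(** The set of points near which [u = M] is open, and it is closed relative to [A]: such a point [z]
    close enough to a limit point [x] has a disc that covers a neighbourhood of [x], and the disc
    version applies around [z]. *)
Lemma unique_continuation A (u : V -> R) (M : R) x1 : open A -> connected A -> harmonic_on A u ->
  A x1 -> (\forall x \near x1, u x = M) -> forall x, A x -> u x = M.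
Proof.
move=> oA conA hu Ax1 ux1.
pose S := A `&` [set x | \forall y \near x, u y = M].
suff -> : A = S by move=> x [_ /= /nbhs_singleton].
apply/esym; apply: conA.
- by exists x1.
- exists [set x | \forall y \near x, u y = M] => //.
  by rewrite openE => x /= /near_join.
- exists (closure [set x | \forall y \near x, u y = M]); first exact: closed_closure.
  apply/seteqP; split => x [Ax hx]; split => //; first exact: subset_closure.
  have [d d0 hd] := (nbhs_enormP _ _).1 (open_nbhs_nbhs (conj oA Ax)).
  (* The square of half side [2 * l] about [z] stays within [4 * l] of [z], hence within [5 * l < d]
     of [x]. *)
  pose l := d / 8; have l0 : 0 < l by rewrite divr_gt0.
  have nx : \forall y \near x, enorm (y - x) < l by apply/nbhs_enormP; exists l.
  have [z [/= uz zx]] := hx _ nx.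
  have ul : forall y, enorm (y - z) < 2 * l -> u y = M.
    apply: (unique_continuation_disc oA _ hu _ uz); first by rewrite mulr_gt0.
    move=> y /andP[y1 y2] /andP[y3 y4]; apply: hd.
    have yz : enorm (y - z) <= 2 * (2 * l).
      apply: le_trans (enorm_le_normr _) _; rewrite ler_pM2l//.
      by apply: norm_le_coord; rewrite !mxE ler_norml; apply/andP; split; lra.
    have := ler_enormD (y - z) (z - x); rewrite addrA subrK; move: zx yz; rewrite /l; lra.
  apply/nbhs_enormP; exists l => // y yx; apply: ul.
  have := ler_enormD (y - x) (x - z); rewrite addrA subrK -(enormN (x - z)) opprB; lra.
Qed.

End unique_continuation.

(** * Arc length: measurability, finiteness and positivity on boundaries *)

Section hausdorff.
Context {R : realType}.
Notation V := 'rV[R]_2.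
Implicit Types (x y z : V) (A B O X : set V).
Local Open Scope ereal_scope.

Lemma ediam_ub A x y : A x -> A y -> (enorm (x - y))%:E <= ediam A.
Proof. by move=> Ax Ay; apply: ereal_sup_ubound; right; exists x => //; exists y. Qed.

Lemma ediam_le A (d : R) : (0 <= d)%R ->
  (forall x y, A x -> A y -> (enorm (x - y) <= d)%R) -> ediam A <= d%:E.
Proof.
move=> d0 h; apply: ge_ereal_sup => _ [->|[x Ax [y Ay <-]]]; first by rewrite lee_fin.
by rewrite lee_fin; exact: h.
Qed.

Lemma hausdorff1_fine_anti (d d' : R) A : (d' <= d)%R -> hausdorff1_fine d A <= hausdorff1_fine d' A.
Proof.
move=> dd; apply/ereal_inf_le_tmp => _ [W [hW cW] <-]; exists W => //; split => // k.
by apply: le_trans (hW k) _; rewrite lee_fin.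
Qed.

Lemma hausdorff1_fine_le (d : R) A : (0 < d)%R -> hausdorff1_fine d A <= hausdorff1 A.
Proof. by move=> d0; apply: ereal_sup_ubound; exists d. Qed.

(** A set of diameter at most [d < e] meets at most one of [A] and [B], so a cover of the union
    splits into covers of the two sets that share no piece. *)
Lemma hausdorff1_fine_separated (d e : R) A B : (d < e)%R ->
  (forall x y, A x -> B y -> (e <= enorm (x - y))%R) ->
  hausdorff1_fine d A + hausdorff1_fine d B <= hausdorff1_fine d (A `|` B).
Proof.
move=> de sep; apply: le_ereal_inf_tmp => _ [W [hW cW] <-].
pose meets (C : set V) k := `[< W k `&` C !=set0 >].
pose restr C k := if meets C k then W k else set0.
have hr C : (C `<=` A `|` B) -> fine_cover d C (restr C).
  move=> CAB; split => [k|x Cx].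
    rewrite /restr; case: ifP => _; first exact: hW.
    by rewrite ediam0; apply: le_trans (hW 0%N); exact: ediam_ge0.
  have [k _ Wk] := cW x (CAB x Cx); exists k => //; rewrite /restr.
  by rewrite (_ : meets C k)//; apply/asboolP; exists x.
have le_inf C : (C `<=` A `|` B) -> hausdorff1_fine d C <= \sum_(k <oo) ediam (restr C k).
  by move=> CAB; apply: ereal_inf_lbound; exists (restr C) => //; exact: hr.
apply: le_trans (leeD (le_inf _ (@subsetUl _ A B)) (le_inf _ (@subsetUr _ A B))) _.
rewrite -nneseriesD; try by move=> *; exact: ediam_ge0.
apply: lee_nneseries => [k _ _|k _]; first by apply: adde_ge0; exact: ediam_ge0.
rewrite /restr; case: ifP => mA; case: ifP => mB; rewrite ?ediam0 ?adde0 ?add0e ?ediam_ge0//.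
move/asboolP : mA => [x [Wx Ax]]; move/asboolP : mB => [y [Wy By]].
have := le_trans (ediam_ub Wx Wy) (hW k); rewrite lee_fin.
by move=> h; exfalso; have := sep x y Ax By; lra.
Qed.

Lemma hausdorff1_separated (e : R) A B : (0 < e)%R ->
  (forall x y, A x -> B y -> (e <= enorm (x - y))%R) ->
  hausdorff1 A + hausdorff1 B <= hausdorff1 (A `|` B).
Proof.
move=> e0 sep; set c := hausdorff1 (A `|` B).
(* Two independent meshes allow the suprema defining [hausdorff1 A] and [hausdorff1 B] to be taken
   one after the other. *)
have key (d1 d2 : R) : (0 < d1)%R -> (0 < d2)%R -> hausdorff1_fine d1 A + hausdorff1_fine d2 B <= c.
  move=> d10 d20; pose d := Num.min (Num.min d1 d2) (e / 2)%R.
  have d0 : (0 < d)%R by rewrite !lt_min d10 d20 divr_gt0.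
  have dd1 : (d <= d1)%R by rewrite !ge_min lexx.
  have dd2 : (d <= d2)%R by rewrite !ge_min lexx orbT.
  have de : (d < e)%R.
    by apply: le_lt_trans (_ : (e / 2 < e)%R); [rewrite !ge_min lexx orbT|lra].
  apply: le_trans (hausdorff1_fine_le _ d0).
  apply: le_trans (hausdorff1_fine_separated de sep).
  by apply: leeD; exact: hausdorff1_fine_anti.
have [->|coo] := eqVneq c +oo; first exact: leey.
have cfin : c \is a fin_num by rewrite ge0_fin_numE ?hausdorff1_ge0// ltey.
have fB (d2 : R) : (0 < d2)%R -> hausdorff1_fine d2 B \is a fin_num.
  move=> d20; rewrite ge0_fin_numE ?hausdorff1_fine_ge0//.
  apply: (@le_lt_trans _ _ c); last by rewrite ltey.
  apply: le_trans (key 1%R d2 ltr01 d20).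
  by rewrite leeDr// hausdorff1_fine_ge0.
have AB (d2 : R) : (0 < d2)%R -> hausdorff1 A <= c - hausdorff1_fine d2 B.
  move=> d20; apply: ge_ereal_sup => _ [d1 d10 <-].
  by rewrite leeBrDr ?fB//; exact: key.
have fA : hausdorff1 A \is a fin_num.
  rewrite ge0_fin_numE ?hausdorff1_ge0//; apply: le_lt_trans (AB 1%R ltr01) _.
  by rewrite ltey_eq fin_numB cfin fB.
rewrite -leeBrDl//; apply: ge_ereal_sup => _ [d2 d20 <-].
by rewrite leeBrDl// -leeBrDr ?fB//; exact: AB.
Qed.

(** An exhaustion of the part of [X] in the open set [O]. The gap between the radii 1/(n+1) and
    1/(n+2) separates each member from the points of [X] that the next one misses. *)
Let inner X O (n : nat) : set V := [set x | X x /\ forall y, (enorm (y - x) < n.+1%:R^-1)%R -> O y].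

Let inner_sub X O m n : (m <= n)%N -> inner X O m `<=` inner X O n.
Proof.
move=> mn x [Xx h]; split => // y yx; apply: h; apply: lt_le_trans yx _.
by rewrite lef_pV2 ?posrE// ler_nat.
Qed.

Let inner_separated X O n A B : A `<=` inner X O n -> B `&` inner X O n.+1 = set0 -> B `<=` X ->
  hausdorff1 A + hausdorff1 B <= hausdorff1 (A `|` B).
Proof.
move=> An Bn BX.
have lt1 : (n.+2%:R^-1 < n.+1%:R^-1 :> R)%R by rewrite ltf_pV2 ?posrE// ltr_nat.
apply: (@hausdorff1_separated (n.+1%:R^-1 - n.+2%:R^-1)%R); first by rewrite subr_gt0.
move=> x y /An[Xx hx] By; rewrite leNgt; apply/negP => xy.
have : inner X O n.+1 y.
  split; first exact: BX.
  move=> w wy; apply: hx; have := ler_enormD (w - y) (y - x).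
  rewrite addrA subrK -(enormN (y - x)) opprB.
  by move: xy wy; set p := (n.+1%:R^-1)%R; set q := (n.+2%:R^-1)%R; lra.
by move=> h; have : (B `&` inner X O n.+1) y by []; rewrite Bn.
Qed.

Lemma sum_even_odd (f : nat -> \bar R) n :
  \sum_(0 <= k < 2 * n) f k =
  \sum_(0 <= k < n) f (2 * k + 0)%N + \sum_(0 <= k < n) f (2 * k + 1)%N.
Proof.
elim: n => [|n ih]; first by rewrite muln0 !big_nil adde0.
rewrite mulnS !big_nat_recr//= ih addn0 addn1.
by rewrite -addeA addeACA.
Qed.

(** The criterion of Caratheodory for metric outer measures. Rings [S n] of equal parity are
    separated, so their lengths add up to at most [hausdorff1 X] and the series of all rings
    converges. Replacing the part of [X] in [O] by [An N], which is separated from the part outside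
    [O], costs only a tail of that series. *)
Lemma open_caratheodory O : open O -> (@hausdorff1_outer R).-caratheodory%mu O.
Proof.
move=> oO; apply: le_caratheodory_measurable => X.
rewrite -[_ (X `&` O)]/(hausdorff1 _) -[_ (X `&` ~` O)]/(hausdorff1 _) -[leRHS]/(hausdorff1 X).
have [->|Xoo] := eqVneq (hausdorff1 X) +oo; first exact: leey.
have Xfin : hausdorff1 X \is a fin_num by rewrite ge0_fin_numE ?hausdorff1_ge0// ltey.
pose An := inner X O; pose S n := An n.+1 `\` An n.
have AnX n : An n `<=` X by move=> x [].
have SX n : S n `<=` X by move=> x [/AnX].
have XOA : X `&` O `<=` \bigcup_n An n.
  move=> x [Xx Ox]; have [d d0 hd] := (nbhs_enormP _ _).1 (open_nbhs_nbhs (conj oO Ox)).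
  have [n nd] : exists n : nat, (n.+1%:R^-1 < d)%R.
    have := near_infty_natSinv_lt (PosNum d0); move=> [n _ /(_ n (leqnn n))] /= h.
    by exists n.
  by exists n => //; split => // y yx; apply: hd; exact: lt_trans nd.
have sumS p N : \sum_(0 <= k < N) hausdorff1 (S (2 * k + p)%N) <= hausdorff1 X.
  pose T N := \bigcup_(k in `I_N) S (2 * k + p)%N.
  suff h : \sum_(0 <= k < N) hausdorff1 (S (2 * k + p)%N) <= hausdorff1 (T N).
    by apply: le_trans h _; apply: le_hausdorff1 => x [k _ /SX].
  elim: N => [|N ih]; first by rewrite big_geq//= hausdorff1_ge0.
  rewrite big_nat_recr//=.
  apply: le_trans (leeD ih (lexx _)) _.
  apply: le_trans (_ : hausdorff1 (T N `|` S (2 * N + p)%N) <= _).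
    case: N {ih} => [|N].
      have -> : T 0%N = set0 by rewrite /T bigcup0// => k.
      by rewrite hausdorff1_0 add0e set0U.
    (* The rings collected so far lie in [An (2 * N + p).+1], and the next ring of the same parity
       misses [An (2 * N + p).+2]. *)
    apply: (@inner_separated X O (2 * N + p).+1%N) => //.
      move=> x [k /= kN [Ak _]]; apply: inner_sub Ak.
      by rewrite ltnS leq_add2r leq_mul2l -ltnS.
    rewrite -subset0 => x [[_ nA] iA]; apply: nA; apply: inner_sub iA.
    by rewrite mulnS.
  by apply: le_hausdorff1 => x [[k /= kN]|] hx; [exists k => //=; exact: ltnW|exists N => /=].
have sumfin : \sum_(0 <= k <oo) hausdorff1 (S k) < +oo.
  apply: le_lt_trans (_ : hausdorff1 X + hausdorff1 X < _); last by rewrite ltey_eq fin_numD Xfin.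
  apply: lime_le; first by apply: is_cvg_nneseries => *; exact: hausdorff1_ge0.
  apply: nearW => n.
  apply: le_trans (_ : \sum_(0 <= k < 2 * n) hausdorff1 (S k) <= _).
    by apply: lee_sum_nneg_natr => [*|]; [exact: hausdorff1_ge0|rewrite leq_pmull].
  rewrite sum_even_odd; exact: leeD (sumS 0%N n) (sumS 1%N n).
have tail := nneseries_tail_cvg sumfin (fun k _ => hausdorff1_ge0 (S k)).
have key N : hausdorff1 (X `&` O) + hausdorff1 (X `&` ~` O) <=
    hausdorff1 X + \sum_(N <= k <oo) hausdorff1 (S k).
  have sub : hausdorff1 (X `&` O) <= hausdorff1 (An N) + \sum_(N <= k <oo) hausdorff1 (S k).
    have cov : X `&` O `<=` An N `|` \bigcup_k S (k + N)%N.
      move=> x /XOA[n _]; elim: n => [|n ih] hn.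
        by left; apply: inner_sub hn.
      have [nN|Nn] := leqP n.+1 N; first by left; exact: inner_sub hn.
      have [/ih//|nAn] := pselect (An n x).
      by right; exists (n - N)%N => //; rewrite subnK.
    apply: le_trans (le_hausdorff1 cov) _.
    apply: le_trans (outer_measureU2 (@hausdorff1_outer R) _ _) _.
    apply: leeD => //.
    apply: le_trans (hausdorff1_sigma_subadditive _) _.
    by rewrite (nneseries_addn N (f := fun k => hausdorff1 (S k)))// => i; exact: hausdorff1_ge0.
  apply: le_trans (leeD sub (lexx _)) _.
  rewrite addeAC leeD2r//.
  apply: le_trans (_ : hausdorff1 (An N `|` (X `&` ~` O)) <= _).
    apply: (@inner_separated X O N) => //.
    rewrite -subset0 => x [[_ nO] [_ h]]; apply: nO; apply: h.
    by rewrite subrr /enorm dotE !mxE mulr0 addr0 sqrtr0 invr_gt0.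
  by apply: le_hausdorff1 => x [/AnX|[]].
apply/lee_addgt0Pr => eps eps0.
have [N _ hN] : \forall N \near \oo, \sum_(N <= k <oo) hausdorff1 (S k) < eps%:E.
  apply: (tail [set x | x < eps%:E]); apply: open_nbhs_nbhs; split; last by rewrite /= lte_fin.
  exact: open_ereal_lt_ereal.
apply: le_trans (key N) _; apply: leeD => //; apply: ltW; exact: (hN N (leqnn N)).
Qed.

Lemma open_measurable_arc O : open O -> measurable (O : set (caratheodory_type (@hausdorff1_outer R))).
Proof. exact: open_caratheodory. Qed.

Lemma closed_measurable_arc (C : set V) : closed C ->
  measurable (C : set (caratheodory_type (@hausdorff1_outer R))).
Proof.
move=> cC; rewrite -[C]setCK; apply: measurableC; apply: open_measurable_arc.
exact: closed_openC.
Qed.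

Lemma within_continuous_measurable_arc (C : set V) (f : V -> R) : closed C ->
  {within C, continuous f} ->
  measurable_fun (C : set (caratheodory_type (@hausdorff1_outer R))) (f : caratheodory_type _ -> R).
Proof.
move=> cC cf; apply: (measurability _ (measurable_realfun.RGenOInfty.measurableE R)).
move=> /= _ [_ [a ->] <-].
have -> : C `&` f @^-1` `]a, +oo[%classic = C `&` (~` (C `&` f @^-1` `]-oo, a]%classic)).
  apply/seteqP; split => x [Cx] /=; rewrite !in_itv/= ?andbT => h; split => //.
    by move=> [_]; rewrite leNgt h.
  by rewrite ltNge; apply/negP => xa; exact: h.
apply: measurableI; first exact: closed_measurable_arc.
apply: measurableC; apply: closed_measurable_arc.
rewrite closed_setSI//; apply: closed_comp; last exact: interval_closed.
by move=> x _; exact: cf.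
Qed.

(** Cutting [[a, b]] into [N.+1] equal pieces covers the curve by sets of diameter at most [K * h],
    which add up to [K * (b - a)] however fine the cut. *)
Lemma lipschitz_curve_hausdorff1 (c : R -> V) (a b K : R) : (a <= b)%R -> (0 <= K)%R ->
  (forall s t, (a <= s <= b)%R -> (a <= t <= b)%R -> (enorm (c s - c t) <= K * `|s - t|)%R) ->
  hausdorff1 [set c t | t in `[a, b]%classic] <= (K * (b - a))%:E.
Proof.
move=> ab K0 lip; apply: ge_ereal_sup => _ [d /= d0 <-].
have [N hN] : exists N : nat, (K * (b - a) / N.+1%:R <= d)%R.
  have M0 : (0 < K * (b - a) + 1)%R by rewrite ltr_wpDl// mulr_ge0// subr_ge0.
  have e0 : (0 < d / (K * (b - a) + 1))%R by rewrite divr_gt0.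
  have [N _ /(_ N (leqnn N)) /= h] := near_infty_natSinv_lt (PosNum e0); exists N.
  move: h; rewrite ltr_pdivlMr// mulrC => h; apply: ltW; apply: le_lt_trans h.
  by rewrite ler_wpM2r// ?invr_ge0// lerDl.
pose h := ((b - a) / N.+1%:R)%R.
have h0 : (0 <= h)%R by rewrite divr_ge0// subr_ge0.
pose W k := if (k < N.+1)%N then [set c t | t in [set t | (a + k%:R * h <= t <= a + k.+1%:R * h)%R]] else set0.
have Nh : (N.+1%:R * h = b - a)%R by rewrite /h mulrC divfK// pnatr_eq0.
have dW k : ediam (W k) <= (if (k < N.+1)%N then K * h else 0)%:E.
  rewrite /W; case: ifP => kN; last by rewrite ediam0.
  apply: ediam_le; first by rewrite mulr_ge0.
  have kb : (a + k.+1%:R * h <= b)%R.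
    by rewrite -lerBrDl -Nh ler_wpM2r// ler_nat.
  have ka : (a <= a + k%:R * h)%R by rewrite lerDl mulr_ge0.
  move=> _ _ [s /andP[s1 s2] <-] [t /andP[t1 t2] <-].
  apply: le_trans (lip s t _ _) _; try by apply/andP; split; lra.
  rewrite ler_wpM2l// ler_norml; move: s2 t2; rewrite -natr1 mulrDl mul1r => s2 t2.
  by apply/andP; split; lra.
apply: le_trans (_ : \sum_(k <oo) ediam (W k) <= _).
  apply: ereal_inf_lbound; exists W => //; split => [k|_ [t /= tin <-]].
    apply: le_trans (dW k) _; rewrite lee_fin; case: ifP => _; last exact: ltW.
    by apply: le_trans hN; rewrite /h mulrA.
  move: tin; rewrite in_itv/= => /andP[t1 t2].
  have exk : exists k : nat, (t <= a + k.+1%:R * h)%R by exists N; rewrite Nh; lra.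
  (* The first piece whose right end reaches [t]; minimality puts its left end below [t]. *)
  case: (ex_minnP exk) => k tk kmin; exists k => //.
  have kN : (k < N.+1)%N by apply: kmin; rewrite Nh; lra.
  rewrite /W kN; exists t => //=; rewrite tk andbT.
  case: k {kN tk} kmin => [|k] kmin; first by rewrite mul0r addr0.
  by rewrite leNgt; apply/negP => /ltW/kmin; rewrite ltnn.
apply: le_trans (_ : \sum_(k <oo) (if (k < N.+1)%N then K * h else 0)%:E <= _).
  by apply: lee_nneseries => [k _ _|k _]; [exact: ediam_ge0|exact: dW].
rewrite (nneseries_split 0 N.+1); last by move=> k _; rewrite lee_fin; case: ifP => // _; rewrite mulr_ge0.
rewrite add0n eseries0 ?adde0; last by move=> k kN _; rewrite ltnNge kN.
rewrite big_mkord; under eq_bigr do rewrite ltn_ord.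
by rewrite sumEFin lee_fin sumr_const card_ord -mulr_natl mulrCA Nh.
Qed.

Lemma closed_bdry (Omega : set V) : closed (bdry Omega).
Proof.
rewrite /bdry setDE; apply: closedI; first exact: closed_closure.
by apply: open_closedC; exact: open_interior.
Qed.

Lemma compact_bdry (Omega : set V) : bounded_set Omega -> compact (bdry Omega).
Proof.
move=> bO; apply: (subclosed_compact (@closed_bdry Omega) (compact_closure bO)).
by move=> x [].
Qed.

Lemma open_eball x (r : R) : open [set y | (enorm (y - x) < r)%R].
Proof.
rewrite openE => y /= yr; apply/nbhs_enormP; exists (r - enorm (y - x))%R.
  by rewrite subr_gt0.
by move=> z zy /=; have := ler_enormD (z - y) (y - x); rewrite addrA subrK; lra.
Qed.

Definition graph_point (e : V) (gamma : R -> R) (t : R) : V :=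
  (t *: rot90 e + gamma t *: e)%R.

Lemma graph_point_e e gamma t : enorm e = 1%R -> dot (graph_point e gamma t) e = gamma t.
Proof.
by move=> e1; rewrite dotDl !dotZl (dotC (rot90 e)) dotx_rot90 enorm1// mulr0 add0r mulr1.
Qed.

Lemma graph_point_rot e gamma t : enorm e = 1%R -> dot (graph_point e gamma t) (rot90 e) = t.
Proof.
by move=> e1; rewrite dotDl !dotZl dot_rot90 dotx_rot90 enorm1// mulr0 addr0 mulr1.
Qed.

Lemma graph_point_lipschitz e gamma (a b : R) : (a <= b)%R -> enorm e = 1%R -> C1_fun gamma ->
  exists2 K : R, (0 <= K)%R & forall s t, (a <= s <= b)%R -> (a <= t <= b)%R ->
    (enorm (graph_point e gamma s - graph_point e gamma t) <= K * `|s - t|)%R.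
Proof.
move=> ab e1 cg; pose l := (b - a)%R.
(* The interval is widened by its length because the mean value point is located only within
   [|s - t|] of [t]. *)
have cd : {within `[(a - l)%R, (b + l)%R], continuous (fun t => `|derive1 gamma t|%R)}.
  by apply: continuous_subspaceT => t; apply: cvg_norm; have [_] := cg; apply.
have l0 : (0 <= l)%R by rewrite subr_ge0.
have [|M _ hM] := EVT_max _ cd; first by rewrite /l; lra.
pose K := (1 + `|derive1 gamma M|)%R; exists K; first by rewrite addr_ge0.
move=> s t /andP[s1 s2] /andP[t1 t2].
have -> : (graph_point e gamma s - graph_point e gamma t = (s - t) *: rot90 e + (gamma s - gamma t) *: e)%R.
  by rewrite /graph_point opprD addrACA -!scalerBl.
apply: le_trans (ler_enormD _ _) _; rewrite !enormZ e1.
have -> : enorm (rot90 e) = 1%R by rewrite /enorm dot_rot90.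
have [c ct ->] := C1_fun_MVT t s cg.
rewrite !mulr1 normrM /K mulrDl mul1r lerD2l ler_wpM2r//.
apply: hM; rewrite in_itv/=.
have : (`|s - t| <= l)%R by rewrite ler_norml /l; apply/andP; split; lra.
by move: ct; rewrite ler_norml => /andP[c1 c2] h; rewrite /l in h *; apply/andP; split; lra.
Qed.

(** Each boundary point is the centre of a disc in which the boundary is part of a Lipschitz graph
    over a segment, hence of finite length; by compactness finitely many such discs cover it. The
    pairs in [good] are centre and radius. *)
Lemma hausdorff1_bdry_lty (Omega : set V) : open Omega -> bounded_set Omega ->
  of_class_C1 Omega -> hausdorff1 (bdry Omega) < +oo.
Proof.
move=> oO bO sm.
pose good (p : V * R) := (0 < p.2)%R /\
  hausdorff1 (bdry Omega `&` [set y | (enorm (y - p.1) < p.2)%R]) < +oo.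
have loc x0 : bdry Omega x0 -> exists2 r : R, (0 < r)%R & good (x0, r).
  move=> bx0; have [r [e [gamma [lg cg]]]] := sm _ bx0; have [r0 e1 _] := lg.
  exists r => //; split => //=.
  pose t0 := dot x0 (rot90 e).
  have [|K K0 lip] := @graph_point_lipschitz e gamma (t0 - r)%R (t0 + r)%R _ e1 cg; first lra.
  apply: (@le_lt_trans _ _ (K * ((t0 + r) - (t0 - r)))%:E); last exact: ltry.
  apply: le_trans (lipschitz_curve_hausdorff1 _ K0 lip); last lra.
  apply: le_hausdorff1 => x [bx /= xr]; exists (dot x (rot90 e)).
    have := le_trans (normr_dot (x - x0) (rot90 e)).
    rewrite (_ : enorm (rot90 e) = 1%R) ?mulr1; last by rewrite /enorm dot_rot90.
    move=> /(_ _ (ltW xr)); rewrite dotBl -/t0 ler_norml => /andP[h1 h2].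
    by rewrite /= in_itv/=; apply/andP; split; lra.
  by rewrite {2}(frameE x e1) (local_graph_bdry oO lg cg bx xr) addrC.
have := compact_bdry bO; rewrite compact_cover.
move=> /(_ _ good (fun p => [set y | (enorm (y - p.1) < p.2)%R]) _ _)[|x bx|D Dg cov].
- by move=> p _; exact: open_eball.
- by have [r r0 g] := loc x bx; exists (x, r) => //=; rewrite subrr /enorm dotE !mxE mulr0 addr0 sqrtr0.
have -> : bdry Omega = \bigcup_(p in [set p | p \in D]) (bdry Omega `&` [set y | (enorm (y - p.1) < p.2)%R]).
  by rewrite -setI_bigcupr; apply/esym/setIidPl.
rewrite bigcup_fset big_seq.
elim/big_ind : _ => [|A B hA hB|p pD].
- by rewrite hausdorff1_0.
- apply: le_lt_trans (outer_measureU2 (@hausdorff1_outer R) A B) _.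
  exact: lte_add_pinfty.
- by have /set_mem[] := Dg p pD.
Qed.

(** Projection to the axis [rot90 e] does not increase distances, and the piece of boundary near
    [x0] projects onto a set containing an interval of length [eta]. The Lebesgue measure of that
    interval bounds the total diameter of every cover from below. *)
Lemma hausdorff1_bdry_gt0 (Omega : set V) x0 (d : R) : open Omega -> of_class_C1 Omega ->
  bdry Omega x0 -> (0 < d)%R ->
  0 < hausdorff1 (bdry Omega `&` [set y | (enorm (y - x0) < d)%R]).
Proof.
move=> oO sm bx0 d0.
have [r [e [gamma [lg cg]]]] := sm _ bx0; have [r0 e1 lgE] := lg.
pose t0 := dot x0 (rot90 e); pose c := graph_point e gamma.
have x0E : x0 = c t0.
  have g0 : dot x0 e = gamma t0.
    by apply: (local_graph_bdry oO lg cg bx0); rewrite subrr /enorm dotE !mxE mulr0 addr0 sqrtr0.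
  by rewrite /c /graph_point -g0 addrC; exact: frameE.
have [|K K0 lip] := @graph_point_lipschitz e gamma (t0 - 1)%R (t0 + 1)%R _ e1 cg; first lra.
have m0 : (0 < Num.min r d)%R by rewrite lt_min r0.
pose eta := Num.min 1%R (Num.min r d / (2 * (K + 1)))%R.
have eta0 : (0 < eta)%R by rewrite lt_min ltr01 divr_gt0// mulr_gt0// ltr_wpDl.
have eta1 : (eta <= 1)%R by rewrite ge_min lexx.
have etaK : (eta * (2 * (K + 1)) <= Num.min r d)%R.
  by rewrite -ler_pdivlMr ?ge_min ?lexx ?orbT// mulr_gt0// ltr_wpDl.
have near_c t : (t0 <= t <= t0 + eta)%R -> (enorm (c t - x0) < Num.min r d)%R.
  move=> /andP[t1 t2]; rewrite x0E.
  apply: le_lt_trans (lip _ _ _ _) _; try by apply/andP; split; lra.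
  rewrite ger0_norm ?subr_ge0//.
  have : (K * (t - t0) <= K * eta)%R by rewrite ler_wpM2l//; lra.
  nra.
have bc t : (t0 <= t <= t0 + eta)%R -> bdry Omega (c t).
  move=> ht; have := near_c t ht; rewrite lt_min => /andP[cr _].
  have nO : ~ Omega (c t) by move=> /(lgE _ cr); rewrite graph_point_e// graph_point_rot// ltxx.
  split; last by move=> /interior_subset.
  by apply/(local_graph_closure oO lg cg cr); rewrite graph_point_e// graph_point_rot.
(* A set of the cover projects into an interval centred at the projection of one of its points and
   of length twice its diameter, whence the half. *)
apply: (@lt_le_trans _ _ (eta / 2)%:E); first by rewrite lte_fin divr_gt0.
apply: le_trans (hausdorff1_fine_le _ ltr01).
apply: le_ereal_inf_tmp => _ [W [hW cW] <-].
have Wfin k : ediam (W k) \is a fin_num.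
  by rewrite ge0_fin_numE ?ediam_ge0//; apply: le_lt_trans (hW k) (ltry _).
pose dk k := fine (ediam (W k)).
have [p hp] : {p : nat -> V & forall k, W k !=set0 -> W k (p k)}.
  apply: (@choice _ _ (fun k x => W k !=set0 -> W k x)) => k.
  by have [[x Wx]|n] := pselect (W k !=set0); [exists x|exists 0%R].
pose I k := `[(dot (p k) (rot90 e) - dk k)%R, (dot (p k) (rot90 e) + dk k)%R]%classic.
have dk0 k : (0 <= dk k)%R by rewrite fine_ge0// ediam_ge0.
have cov : `[t0, (t0 + eta)%R]%classic `<=` \bigcup_k I k.
  move=> t /=; rewrite in_itv/= => ht.
  have [k _ Wk] : (\bigcup_k W k) (c t).
    by apply: cW; split; [exact: bc|have := near_c t ht; rewrite lt_min => /andP[]].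
  exists k => //; have Wp := hp k (ex_intro _ _ Wk).
  have := ediam_ub Wk Wp; rewrite -(fineK (Wfin k)) lee_fin => h.
  have := normr_dot (c t - p k) (rot90 e).
  rewrite (_ : enorm (rot90 e) = 1%R) ?mulr1; last by rewrite /enorm dot_rot90.
  move=> /le_trans /(_ h); rewrite dotBl graph_point_rot// ler_norml => /andP[h1 h2].
  by rewrite /I /= in_itv/=; rewrite /dk; apply/andP; split; lra.
have := measure_sigma_subadditive (@lebesgue_measure R) (fun k => measurable_itv _)
  (measurable_itv _) cov.
move=> h.
have E : lebesgue_measure (`[t0, (t0 + eta)%R]%classic : set R) = eta%:E.
  by rewrite lebesgue_measure_itv/= lte_fin ltrDl eta0 -EFinB addrAC subrr add0r.
have Ek k : lebesgue_measure (I k : set R) <= ediam (W k) + ediam (W k).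
  rewrite /I lebesgue_measure_itv/=; case: ifP => _; last by apply: adde_ge0; exact: ediam_ge0.
  by rewrite -(fineK (Wfin k)) -!EFinD lee_fin -/(dk k); lra.
have h2 : eta%:E <= \sum_(k <oo) (ediam (W k) + ediam (W k)).
  rewrite -E; apply: le_trans h _; apply: lee_nneseries => [k _ _|k _]; last exact: Ek.
  exact: measure_ge0.
move: h2; rewrite nneseriesD; try by move=> *; exact: ediam_ge0.
have : 0 <= \sum_(k <oo) ediam (W k) by apply: nneseries_ge0 => *; exact: ediam_ge0.
by case: (\sum_(k <oo) ediam (W k)) => [s| |] //=; rewrite ?leey// -EFinD !lee_fin; lra.
Qed.

End hausdorff.

(** * Minimization of squared norms along a line *)

Section quadratic.
Context {R : realType}.

(** The minimizer is the vertex [m] clamped to the interval. Uniqueness is strict convexity: the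
    midpoint of two minimizers would be lower by [C * ((z - z') / 2) ^+ 2]. *)
Lemma quadratic_unique_min (A B C a b : R) : 0 < C -> a <= b ->
  exists! z, a <= z <= b /\
    forall w, a <= w <= b -> A - B * z + C * z ^+ 2 <= A - B * w + C * w ^+ 2.
Proof.
move=> C0 ab; pose m := B / (2 * C).
have BE : B = 2 * C * m by rewrite /m; field; lra.
pose q w := A - B * w + C * w ^+ 2.
have qE w : q w = C * (w - m) ^+ 2 + (A - C * m ^+ 2) by rewrite /q BE; ring.
pose z := if m < a then a else if b < m then b else m.
have zab : a <= z <= b.
  rewrite /z; case: ltP => [_|am]; first by rewrite lexx.
  by case: ltP => [_|mb]; rewrite ?lexx ?andbT// am.
have zmin w : a <= w <= b -> q z <= q w.
  move=> /andP[aw wb]; rewrite !qE lerD2r ler_pM2l// /z.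
  case: ltP => [ma|am]; first by rewrite !expr2; nra.
  case: ltP => [bm|mb]; first by rewrite !expr2; nra.
  by rewrite subrr expr0n /= sqr_ge0.
exists z; split; first by split.
move=> z' [/andP[az' z'b] h].
have [az zb] := andP zab.
have h1 : q z' <= q z by exact: h.
have mid : a <= (z + z') / 2 <= b by apply/andP; split; lra.
have h2 := zmin _ mid.
have E : q ((z + z') / 2) = (q z + q z') / 2 - C * ((z - z') / 2) ^+ 2.
  by rewrite /q; field.
have : C * ((z - z') / 2) ^+ 2 <= 0 by lra.
rewrite pmulr_rle0// => h3.
have : ((z - z') / 2) ^+ 2 == 0 by rewrite eq_le h3 sqr_ge0.
by rewrite sqrf_eq0 mulf_eq0 invr_eq0 pnatr_eq0 orbF subr_eq0 => /eqP.
Qed.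

Lemma sqr_Lnorm2 d (T : measurableType d) (mu : {measure set T -> \bar R})
    (G : set T) (f : T -> R) : measurable G ->
  mu.-integrable G (EFin \o (fun x => f x ^+ 2)) ->
  ('N[mu]_2%:E[EFin \o (f \_ G)] ^+ 2)%E = (\int[mu]_(x in G) (f x ^+ 2))%:E.
Proof.
move=> mG int; have n2 : 2 != 0 :> R by rewrite pnatr_eq0.
have E := poweR_Lnorm mu (EFin \o (f \_ G)) n2.
have {}E : ('N[mu]_2%:E[EFin \o (f \_ G)] `^ 2)%E = (\int[mu]_(x in G) (f x ^+ 2))%:E.
  rewrite E Rintegral_mkcond /Rintegral fineK; last first.
    apply: integrable_fin_num => //.
    rewrite -[X in mu.-integrable _ X]/(EFin \o ((fun x => f x ^+ 2) \_ G)) -restrict_EFin.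
    by apply/integrable_restrict => //=; rewrite ?setIT ?setTI.
  apply: eq_integral => x _ /=; rewrite !patchE.
  (* Off [G] the restriction takes the default value [point], which is 0 in [R]. *)
  by case: ifP => _; rewrite powR_mulrn// real_normK ?num_real// -[point]/(0 : R) expr0n.
have := Lnorm_ge0 mu 2%:E (EFin \o (f \_ G)).
move: E; case: ('N[mu]_2%:E[EFin \o (f \_ G)])%E => [r| |] //=.
  rewrite lee_fin => -[<-] r0; by rewrite powR_mulrn.
by rewrite pnatr_eq0.
Qed.

(** The square is expanded under the integral. Boundedness of [g] and [h] on a set of finite measure
    makes the integrals of all three products finite. *)
Lemma L2_quadratic d (T : measurableType d) (mu : {measure set T -> \bar R})
    (G : set T) (g h : T -> R) (k : R) : measurable G -> (mu G < +oo)%E ->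
  measurable_fun G g -> measurable_fun G h ->
  [bounded g x | x in G] -> [bounded h x | x in G] ->
  (0 < k) -> (0 < \int[mu]_(x in G) (h x ^+ 2)) ->
  exists A B C : R, 0 < C /\
    forall z, ('N[mu]_2%:E[EFin \o ((fun x => g x - k * z * h x)%R \_ G)] ^+ 2)%E = (A - B * z + C * z ^+ 2)%:E.
Proof.
move=> mG fG mg mh bg bh k0 h0.
have bM (u v : T -> R) : [bounded u x | x in G] -> [bounded v x | x in G] -> [bounded (u x * v x) | x in G].
  move=> [M1 [_ h1]] [M2 [_ h2]].
  exists ((`|M1| + 1) * (`|M2| + 1)); split; first exact: num_real.
  move=> N hN x Gx /=; rewrite normrM; apply: le_trans (ltW hN).
  apply: ler_pM => //.
    by apply: (h1 (`|M1| + 1) _ x Gx); have := ler_norm M1; lra.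
  by apply: (h2 (`|M2| + 1) _ x Gx); have := ler_norm M2; lra.
have int (u v : T -> R) : measurable_fun G u -> measurable_fun G v ->
    [bounded u x | x in G] -> [bounded v x | x in G] ->
    mu.-integrable G (EFin \o (fun x => u x * v x)).
  move=> mu1 mv bu bv; apply: measurable_bounded_integrable => //; last exact: bM.
  exact: measurable_realfun.measurable_funM.
have igg := int _ _ mg mg bg bg; have igh := int _ _ mg mh bg bh; have ihh := int _ _ mh mh bh bh.
pose I2 (u v : T -> R) := \int[mu]_(x in G) (u x * v x).
exists (I2 g g), (2 * k * I2 g h), (k ^+ 2 * I2 h h); split.
  by rewrite mulr_gt0 ?exprn_gt0//.
move=> z.
have iZ (c : R) (u : T -> R) : mu.-integrable G (EFin \o u) -> mu.-integrable G (EFin \o (fun x => c * u x)).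
  by move=> iu; apply: (integrableZl mG c iu).
have i1 : mu.-integrable G (EFin \o (fun x => g x * g x - 2 * k * z * (g x * h x))).
  exact: (integrableB mG igg (iZ _ _ igh)).
have i2 := iZ (k ^+ 2 * z ^+ 2) _ ihh.
have sqE : (fun x => (g x - k * z * h x) ^+ 2) =
   (fun x => (g x * g x - 2 * k * z * (g x * h x)) + k ^+ 2 * z ^+ 2 * (h x * h x)).
  by apply/funext => x; ring.
have i3 : mu.-integrable G (EFin \o (fun x => (g x - k * z * h x) ^+ 2)).
  by rewrite sqE; exact: (integrableD mG i1 i2).
rewrite sqr_Lnorm2// sqE RintegralD// RintegralB//; last exact: iZ.
rewrite RintegralZl// RintegralZl//; congr (_%:E).
by rewrite -/(I2 g g) -/(I2 g h) -/(I2 h h); ring.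
Qed.

Lemma minimizes_quadratic (F : R -> \bar R) (A B C a b : R) : 0 < C -> a <= b ->
  (forall z, F z = (A - B * z + C * z ^+ 2)%:E) -> exists! z, minimizes F [set` `[a, b]] z.
Proof.
move=> C0 ab FE; have [z [[zab zmin] zu]] := quadratic_unique_min A B C0 ab.
exists z; split.
  split => [|w]; first by rewrite /= in_itv.
  by rewrite /= in_itv/= => /zmin; rewrite !FE lee_fin.
move=> w [wab wmin]; apply: zu; split; first by move: wab; rewrite /= in_itv.
by move=> v vab; rewrite -lee_fin -!FE; apply: wmin; rewrite /= in_itv.
Qed.

End quadratic.

(** * Connected components of open sets in the plane *)

Section components.
Context {R : realType}.
Notation V := 'rV[R]_2.
Implicit Types (x y z : V) (A U W : set V).

Lemma segment_connected_component U x y :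
  (forall t : R, 0 <= t <= 1 -> U (x + t *: (y - x))) -> connected_component U x y.
Proof.
move=> h; pose S := (fun t : R => x + t *: (y - x)) @` `[0, 1]%classic.
have cS : connected S.
  apply: connected_continuous_connected; first exact: segment_connected.
  apply: continuous_subspaceT => t.
  by apply: cvgD; [exact: cvg_cst|apply: cvgZr_tmp; exact: cvg_id].
exists S; last by exists 1; [rewrite /= in_itv/= lexx ler01|rewrite scale1r addrC subrK].
split => //; first by exists 0; [rewrite /= in_itv/= lexx ler01|rewrite scale0r addr0].
by move=> _ [t /= + <-]; rewrite in_itv/=; exact: h.
Qed.

Lemma ball_connected_component U x y (d : R) :
  (forall z, enorm (z - x) < d -> U z) -> enorm (y - x) < d -> connected_component U x y.
Proof.
move=> h yx; apply: segment_connected_component => t /andP[t0 t1]; apply: h.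
rewrite addrAC subrr add0r enormZ ger0_norm//; apply: le_lt_trans yx.
by rewrite ler_piMl ?enorm_ge0.
Qed.

Lemma open_connected_component U x : open U -> open (connected_component U x).
Proof.
move=> oU; rewrite openE => y xy.
have Uy : U y by exact: connected_component_sub xy.
have [d d0 hd] := (nbhs_enormP _ _).1 (open_nbhs_nbhs (conj oU Uy)).
apply/nbhs_enormP; exists d => // z zy.
apply: connected_component_trans xy _; exact: ball_connected_component hd zy.
Qed.

Lemma closure_connected_component U x y : open U -> U y ->
  closure (connected_component U x) y -> connected_component U x y.
Proof.
move=> oU Uy cy.
have [d d0 hd] := (nbhs_enormP _ _).1 (open_nbhs_nbhs (conj oU Uy)).
have nd : nbhs y [set z | enorm (z - y) < d] by apply/nbhs_enormP; exists d.
have [z [xz zy]] := cy _ nd.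
apply: connected_component_trans xz _; apply: connected_component_sym.
exact: ball_connected_component hd zy.
Qed.

Lemma connected_plane : connected [set: V].
Proof.
rewrite (_ : [set: V] = connected_component setT (0 : V)); first exact: component_connected.
apply/esym/seteqP; split => // x _; exact: segment_connected_component.
Qed.

(** The exterior of a sup norm ball is the union of four half-planes, in each of which points are
    joined by segments; the corners [p] link neighbouring half-planes. *)
Lemma exterior_connected U (K : R) : 0 < K ->
  (forall x, K < `|x| -> U x) -> forall x, K < `|x| ->
  connected_component U (pt (K + 1) (K + 1)) x.
Proof.
move=> K0 hU x Kx.
have gtc y i : K < `|y 0 i| -> U y.
  by move=> h; apply: hU; exact: lt_le_trans h (coord_le_norm _ _).
have half (i : 'I_2) (s : R) y z : `|s| <= 1 -> K < s * y 0 i -> K < s * z 0 i ->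
    connected_component U y z.
  move=> s1 hy hz; apply: segment_connected_component => t /andP[t0 t1].
  apply: (gtc _ i); rewrite !mxE.
  have h : K < s * (y 0 i + t * (z 0 i - y 0 i)).
    rewrite (_ : s * _ = (1 - t) * (s * y 0 i) + t * (s * z 0 i)); last ring.
    have [->|t'] := eqVneq t 1; first by rewrite subrr mul0r add0r mul1r.
    have t'' : 0 < 1 - t by rewrite subr_gt0 lt_neqAle t'.
    have : (1 - t) * K < (1 - t) * (s * y 0 i) by rewrite ltr_pM2l.
    have : t * K <= t * (s * z 0 i) by rewrite ler_wpM2l// ltW.
    lra.
  apply: lt_le_trans h _; apply: le_trans (ler_norm _) _.
  by rewrite normrM ler_piMl.
have n1 : `|1 : R| <= 1 by rewrite normr1.
have nN1 : `|-1 : R| <= 1 by rewrite normrN normr1.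
pose p (s t : R) : V := pt (s * (K + 1)) (t * (K + 1)).
have -> : pt (K + 1) (K + 1) = p 1 1 by rewrite /p !mul1r.
have c01 : connected_component U (p 1 1) (p 1 (-1)).
  by apply: (half 0 1) => //; rewrite mxE /=; lra.
have c10 : connected_component U (p 1 1) (p (-1) 1).
  by apply: (half 1 1) => //; rewrite mxE /=; lra.
have [h0|h0] := ltP K `|x 0 0|; last have [h1|h1] := ltP K `|x 0 1|.
- have [x0|x0] := leP 0 (x 0 0).
    by rewrite ger0_norm// in h0; apply: (half 0 1) => //; rewrite ?mxE /=; lra.
  rewrite ltr0_norm// in h0; apply: connected_component_trans c10 _.
  by apply: (half 0 (-1)) => //; rewrite ?mxE /=; lra.
- have [x0|x0] := leP 0 (x 0 1).
    by rewrite ger0_norm// in h1; apply: (half 1 1) => //; rewrite ?mxE /=; lra.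
  rewrite ltr0_norm// in h1; apply: connected_component_trans c01 _.
  by apply: (half 1 (-1)) => //; rewrite ?mxE /=; lra.
- by have := lt_le_trans Kx (norm_le_coord h0 h1); rewrite ltxx.
Qed.

Lemma enorm_frame e x (p q : R) : enorm e = 1 -> 0 <= p -> 0 <= q ->
  `|dot x e| <= p -> `|dot x (rot90 e)| <= q -> enorm x <= p + q.
Proof.
move=> e1 p0 q0 hp hq; rewrite {1}(frameE x e1); apply: le_trans (ler_enormD _ _) _.
rewrite !enormZ e1 (_ : enorm (rot90 e) = 1) ?mulr1; first exact: lerD.
by rewrite /enorm dot_rot90.
Qed.

(** From a point below the graph, a descent along [- e] to depth [b] under [x0] followed by a
    horizontal move ends at [x0 - b *: e] without leaving [U]. The choice [b = r / 3] keeps both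
    moves inside the chart, and [del] keeps the graph above that depth. Near such a point [U] thus
    lies in one component. *)
Lemma local_graph_component U x0 r e gamma : local_graph U x0 r e gamma -> C1_fun gamma ->
  dot x0 e = gamma (dot x0 (rot90 e)) ->
  exists2 r' : R, 0 < r' & exists c, forall x, U x -> enorm (x - x0) < r' -> connected_component U x c.
Proof.
move=> [r0 e1 h] cg x0E; set t0 := dot x0 (rot90 e) in x0E.
pose b := r / 3; have b0 : 0 < b by rewrite divr_gt0.
have cc : gamma @ t0 --> gamma t0 by exact: C1_fun_continuous.
have [del del0 hdel] : exists2 del : R, 0 < del & forall t, `|t - t0| < del -> `|gamma t - gamma t0| < b.
  have hb : \forall t \near t0, `|gamma t0 - gamma t| < b by exact: (proj1 (cvgrPdist_lt _ _) cc _ b0).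
  have [d /= d0 hd] := hb; exists d => // t td; rewrite distrC; apply: hd.
  by rewrite /= distrC.
have rot1 : enorm (rot90 e) = 1 by rewrite /enorm dot_rot90.
have ee : dot e e = 1 by exact: enorm1.
have re : dot (rot90 e) e = 0 by rewrite dotC dotx_rot90.
have rr : dot (rot90 e) (rot90 e) = 1 by rewrite dot_rot90.
pose r' := Num.min del b; have r'0 : 0 < r' by rewrite lt_min del0.
have r'd : r' <= del by rewrite ge_min lexx.
have r'b : r' <= b by rewrite ge_min lexx orbT.
exists r' => //; exists (x0 - b *: e) => x Ux xr.
have abs_e : `|dot (x - x0) e| < r'.
  by apply: le_lt_trans (normr_dot _ _) _; rewrite e1 mulr1.
have abs_r : `|dot (x - x0) (rot90 e)| < r'.
  by apply: le_lt_trans (normr_dot _ _) _; rewrite rot1 mulr1.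
pose tau := dot (x - x0) e; pose s := dot (x - x0) (rot90 e).
have tauE : dot x e = dot x0 e + tau by rewrite /tau dotBl addrC subrK.
have sE : dot x (rot90 e) = t0 + s by rewrite /s dotBl -/t0 addrC subrK.
have taub : `|tau| < b by exact: lt_le_trans abs_e r'b.
have sb : `|s| < b by exact: lt_le_trans abs_r r'b.
have xr0 : enorm (x - x0) < r.
  by apply: lt_le_trans xr _; apply: le_trans r'b _; rewrite /b; lra.
have xg : dot x e < gamma (dot x (rot90 e)) by apply/h.
have inU y (p q : R) : dot (y - x0) e = p -> dot (y - x0) (rot90 e) = q ->
    `|p| <= b -> `|q| <= b -> dot x0 e + p < gamma (t0 + q) -> U y.
  move=> pE qE pb qb lt; apply/h.
    apply: le_lt_trans (@enorm_frame e (y - x0) b b e1 (ltW b0) (ltW b0) _ _) _; rewrite ?pE ?qE//.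
    by rewrite /b; lra.
  have -> : dot y e = dot x0 e + p by rewrite -pE dotBl addrC subrK.
  by have -> : dot y (rot90 e) = t0 + q by rewrite -qE dotBl -/t0 addrC subrK.
move: taub; rewrite ltr_norml => /andP[tau1 tau2].
move: (sb); rewrite ltr_norml => /andP[s1 s2].
pose y := x - (b + tau) *: e.
apply: (@connected_component_trans _ _ y).
  apply: segment_connected_component => t /andP[t_0 t_1].
  have m1 : 0 <= t * (b + tau) by rewrite mulr_ge0//; lra.
  have m2 : t * (b + tau) <= b + tau by rewrite ler_piMl//; lra.
  apply: (@inU _ (tau - t * (b + tau)) s); last 1 first.
  - by rewrite sE tauE in xg; lra.
  - rewrite /y [x - _ - x]addrAC subrr add0r !dotBl !dotDl dotZl dotNl dotZl ee tauE; ring.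
  - rewrite /y [x - _ - x]addrAC subrr add0r !dotBl !dotDl dotZl dotNl dotZl dotx_rot90 sE -/t0; ring.
  - by rewrite ler_norml; apply/andP; split; lra.
  - exact: ltW.
apply: segment_connected_component => t /andP[t_0 t_1].
have yE : y - x0 = (- b) *: e + s *: rot90 e.
  rewrite /y addrAC {1}(frameE (x - x0) e1) -/tau -/s addrAC -scalerBl; congr (_ *: _ + _); ring.
have cE : x0 - b *: e - y = (- s) *: rot90 e.
  rewrite -[x0 - _ - y]opprK opprB (_ : y - (x0 - b *: e) = (y - x0) + b *: e).
    by rewrite yE addrAC -scalerDl addNr scale0r add0r scaleNr.
  by rewrite opprB addrA addrAC.
have ts : `|s - t * s| <= `|s|.
  rewrite -{1}[s]mul1r -mulrBl normrM ger0_norm ?subr_ge0// ler_piMl//; lra.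
apply: (@inU _ (- b) (s - t * s)).
- by rewrite cE addrAC yE !dotDl !dotZl ee re; ring.
- by rewrite cE addrAC yE !dotDl !dotZl dotx_rot90 rr; ring.
- by rewrite normrN gtr0_norm.
- by apply: le_trans ts _; exact: ltW.
- have /hdel : `|t0 + (s - t * s) - t0| < del.
    by rewrite addrAC subrr add0r; apply: le_lt_trans ts _; exact: lt_le_trans abs_r r'd.
  by rewrite x0E ltr_norml => /andP[? _]; lra.
Qed.

End components.

(** * A potential without flux forces a constant background field *)

Section rigidity.
Context {R : realType}.
Notation V := 'rV[R]_2.
Implicit Types (x y z : V) (A U W Omega D : set V).

Lemma harmonic_onS A B (u : V -> R) : B `<=` A -> harmonic_on A u -> harmonic_on B u.
Proof.
move=> BA [h0 h1 h2]; split; first by move=> x /BA; exact: h0.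
- by move=> i x /BA; exact: h1.
- by move=> x /BA; exact: h2.
Qed.

Lemma within_nbhs_sub A B x : B `<=` A -> within B (nbhs x) `=>` within A (nbhs x).
Proof.
move=> BA P /nbhs_enormP[d d0 hd].
by apply/(nbhs_enormP x (fun y => B y -> P y)); exists d => // y yd /BA; exact: hd.
Qed.

Lemma cvg_grad_sub A B (u : V -> R) x : B `<=` A -> cvg (grad u @ within A (nbhs x)) ->
  grad u @ within B (nbhs x) --> grad_trace A u x.
Proof. by move=> BA gu P /gu; exact: (within_nbhs_sub BA). Qed.

Lemma grad_trace_sub A B (u : V -> R) x : B `<=` A -> closure B x ->
  cvg (grad u @ within A (nbhs x)) -> grad_trace B u x = grad_trace A u x.
Proof.
move=> BA cx gu; have pf : ProperFilter (within B (nbhs x)) by exact: within_nbhs_proper.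
exact: (cvg_lim _ (cvg_grad_sub BA gu)).
Qed.

Lemma C1_closureS A B (u : V -> R) : B `<=` A -> C1_closure A u -> C1_closure B u.
Proof.
move=> BA [cu gu]; have cBA := closureS BA; split; first exact: continuous_subspaceW cu.
move=> x Bx; apply/cvg_ex; exists (grad_trace A u x); apply: (cvg_grad_sub BA).
exact/gu/cBA.
Qed.

Lemma liouville_decay (H : V -> R) (M C r0 : R) : harmonic_on setT H ->
  (forall x, r0 < enorm x -> `|H x - M| <= C * (enorm x)^-1) -> forall x, H x = M.
Proof.
move=> hH dec x.
have tp := harmonic_twice hH.
have cH : continuous H.
  by move=> y; have [c0 _ _] := hH; have [/differentiable_continuous] := c0 y I.
have lap y : partial 0 (partial 0 H) y + partial 1 (partial 1 H) y = 0.
  have [_ _ /(_ y I)] := hH; rewrite /laplacian big_ord_recl big_ord1.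
  by rewrite (_ : lift ord0 ord0 = 1)//; exact/val_inj.
(* The values 1 and -1 of [k] give the upper and the lower bound for [H x - M]. *)
have bound (k : R) : `|k| = 1 -> forall N : R, 0 < N -> enorm x < N -> r0 < N -> k * H x <= k * M + C * N^-1.
  move=> k1 N N0 xN rN.
  pose A : set V := [set y | enorm (y - 0) < N].
  have Ax : A x by rewrite /A /= subr0.
  have bA : bounded_set A.
    exists N; split; first exact: num_real.
    move=> N' NN' y; rewrite /A /= subr0 => yN; apply/ltW.
    exact: le_lt_trans (normr_le_enorm y) (lt_trans yN NN').
  have tpk : twice_partial A (fun y => 0 + k * H y) (fun i y => 0 + k * partial i H y)
      (fun i y => 0 + k * partial i (partial i H) y).
    apply: (@twice_partialDZ _ _ (cst 0) (fun _ => cst 0) (fun _ => cst 0)).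
      by move=> i y _; split; exact: is_derive_cst.
    exact: twice_partialS (@subsetT _ A) tp.
  have := weak_max (M := k * M + C * N^-1) (@open_eball R 0 N) bA _ tpk _ _ (subset_closure Ax).
  rewrite /= add0r; apply.
  - apply: continuous_subspaceT => y.
    have h : (fun z => k * H z) @ y --> k * H y by exact: (cvgM (cvg_cst k) (cH y)).
    exact: (cvgD (cvg_cst 0) h).
  - have gen (a b : R) : a + b = 0 -> 0 <= 0 + k * a + (0 + k * b).
      by move=> ab; rewrite !add0r -mulrDr ab mulr0.
    by move=> y _; exact: gen (lap y).
  - move=> y cy nAy; rewrite add0r.
    have yN : enorm y = N.
      apply/eqP; rewrite eq_le; apply/andP; split; last first.
        by rewrite leNgt; apply/negP => h; apply: nAy; rewrite /A /= subr0.
      have clo : closed [set y | dist2 0 y <= N ^+ 2].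
        apply: (@closed_comp _ _ (dist2 0) [set t | t <= N ^+ 2]); last exact: closed_le.
        by move=> z _; exact: continuous_dist2.
      have : dist2 0 y <= N ^+ 2.
        apply: clo; apply: closureS cy => z; rewrite /A /= subr0 dist2_enorm subr0 => /ltW h.
        by rewrite ler_pXn2r// ?nnegrE ?enorm_ge0// ltW.
      by rewrite dist2_enorm subr0 ler_pXn2r// ?nnegrE ?enorm_ge0// ltW.
    have := dec y; rewrite yN => /(_ rN) h.
    have : k * (H y - M) <= C * N^-1.
      by apply: le_trans (ler_norm _) _; rewrite normrM k1 mul1r.
    by rewrite mulrBr lerBlDl.
have lim (c : R) : (forall N : R, 0 < N -> enorm x < N -> r0 < N -> c <= C * N^-1) -> c <= 0.
  move=> h; rewrite leNgt; apply/negP => c0.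
  (* Large enough for [C < c * N], and beyond both [enorm x] and [r0]. *)
  pose N := `|C| / c + enorm x + `|r0| + 1.
  have q0 : 0 <= `|C| / c by rewrite divr_ge0// ltW.
  have ex := enorm_ge0 x; have rr := ler_norm r0; have r0' := normr_ge0 r0.
  have N0 : 0 < N by rewrite /N; lra.
  have := h N N0 ltac:(rewrite /N; lra) ltac:(rewrite /N; lra).
  rewrite ler_pdivlMr//.
  have : `|C| < c * N.
    by rewrite mulrC -ltr_pdivrMr// /N; lra.
  have := ler_norm C; lra.
apply/eqP; rewrite eq_le; apply/andP; split.
  rewrite -subr_le0; apply: lim => N N0 xN rN.
  by have := bound 1 (normr1 _) N N0 xN rN; rewrite !mul1r; lra.
rewrite -subr_le0; apply: lim => N N0 xN rN.
have := bound (-1) _ N N0 xN rN; rewrite normrN normr1 => /(_ erefl).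
by rewrite !mulN1r; lra.
Qed.

Section flux.
Variables (Omega D : set V) (H phi : V -> R).
Hypotheses (oO : open Omega) (bO : bounded_set Omega) (smO : of_class_C1 Omega).
Hypotheses (oD : open D) (smD : of_class_C1 D) (sub : closure D `<=` Omega).
Hypotheses (potphi : is_potential D H phi).
Hypotheses (flux0 : forall x, bdry Omega x -> normal_derivative Omega (~` closure D) phi x = 0).

Let U := ~` closure D.

Let oU : open U. Proof. exact/closed_openC/closed_closure. Qed.

Variable p : V.
Let W := connected_component U p.
Let A := W `&` Omega.

Let WU : W `<=` U. Proof. exact: connected_component_sub. Qed.

Let oW : open W. Proof. exact: open_connected_component. Qed.

Let oA : open A. Proof. exact: openI. Qed.

Let AU : A `<=` U. Proof. by move=> x [/WU]. Qed.

Let bdA x : bdry A x -> closure A x /\ ~ A x.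
Proof. by move=> [cx nx]; split => // Ax; apply: nx; rewrite /= -/(interior A) (interior_id _).1. Qed.

Let bdryI B x : open B -> closure B x -> ~ B x -> bdry B x.
Proof. by move=> oB cx nx; split => // /interior_subset. Qed.

Let grad_traceA x : closure A x -> grad_trace A phi x = grad_trace U phi x.
Proof.
move=> cx; apply: grad_trace_sub => //; have [_ [_ gu] _ _] := potphi.
by apply: gu; exact: closureS cx.
Qed.

(** A component of the open set [U] is closed relative to [U], so [x] lies in the open set [W], and
    near [x] the set [A] coincides with [Omega]. *)
Let bdryA_outer x : bdry A x -> U x -> bdry Omega x /\
  exists2 d : R, 0 < d & forall y, enorm (y - x) < d -> (Omega y <-> A y).
Proof.
move=> /bdA[cx nAx] Ux.
have Wx : W x.
  by apply: closure_connected_component => //; apply: closureS cx => y [].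
split.
  apply: bdryI => //; first by apply: closureS cx => y [].
  by move=> Ox; exact: nAx.
have [d d0 hd] := (nbhs_enormP _ _).1 (open_nbhs_nbhs (conj oW Wx)).
by exists d => // y /hd Wy; split => [Oy|[]].
Qed.

(** The point lies on the boundary of [D], near which the exterior is a subgraph and falls into a
    single component. Since [W] accumulates at [x], that component is [W], and near [x] the set [A]
    coincides with [U]. *)
Let bdryA_inner x : bdry A x -> ~ U x -> bdry D x /\
  exists2 d : R, 0 < d & forall y, enorm (y - x) < d -> (U y <-> A y).
Proof.
move=> /bdA[cx nAx] nUx.
have cDx : closure D x by apply: contrapT.
have cUx : closure U x by exact: closureS cx.
have nDx : ~ D x.
  move=> Dx; have [y [Uy Dy]] := cUx _ (open_nbhs_nbhs (conj oD Dx)).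
  by apply: Uy; exact: subset_closure.
have bDx : bdry D x by exact: bdryI.
split => //.
have [r [e [gamma [lg cg]]]] := smD bDx.
have xx : enorm (x - x) < r by rewrite subrr /enorm dotE !mxE mulr0 addr0 sqrtr0; have [] := lg.
have xE := local_graph_bdry oD lg cg bDx xx.
have lgU := local_graph_flip oD lg cg.
have [cg' _] := C1_fun_flip cg.
have [|r' r'0 [c hc]] := local_graph_component lgU cg'.
  by rewrite rot90N !dotNr opprK xE.
have Ox : Omega x by exact: sub.
have [d d0 hd] := (nbhs_enormP _ _).1 (open_nbhs_nbhs (conj oO Ox)).
have Wc : W c.
  have nx : nbhs x [set y | enorm (y - x) < r'] by apply/nbhs_enormP; exists r'.
  have [w [[Ww _] wr]] := cx _ nx.
  exact: connected_component_trans Ww (hc w (WU Ww) wr).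
exists (Num.min r' d); first by rewrite lt_min r'0.
move=> y; rewrite lt_min => /andP[yr yd]; split => [Uy|/AU//].
split; last exact: hd.
by apply: connected_component_trans Wc _; apply: connected_component_sym; exact: hc.
Qed.

Let smA : of_class_C1 A.
Proof.
move=> x bx; have [Ux|nUx] := pselect (U x).
  have [bOx [d d0 hd]] := bdryA_outer bx Ux.
  have [r [e [gamma [lg cg]]]] := smO bOx; have [r0 _ _] := lg.
  exists (Num.min r d), e, gamma; split => //.
  apply: (@local_graph_eq _ Omega); last by move=> y; rewrite lt_min => /andP[_]; exact: hd.
  apply: local_graph_shrink lg _ _; first by rewrite lt_min r0.
  by rewrite subrr /enorm dotE !mxE mulr0 addr0 sqrtr0 add0r ge_min lexx.
have [bDx [d d0 hd]] := bdryA_inner bx nUx.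
have [r [e [gamma [lg cg]]]] := smD bDx; have [r0 _ _] := lg.
exists (Num.min r d), (- e), (fun s => - gamma (- s)); split; last by have [] := C1_fun_flip cg.
apply: (@local_graph_eq _ U); last by move=> y; rewrite lt_min => /andP[_]; exact: hd.
apply: local_graph_shrink (local_graph_flip oD lg cg) _ _; first by rewrite lt_min r0.
by rewrite subrr /enorm dotE !mxE mulr0 addr0 sqrtr0 add0r ge_min lexx.
Qed.

Let enorm_xx x (r : R) : 0 < r -> enorm (x - x) < r.
Proof. by rewrite subrr /enorm dotE !mxE mulr0 addr0 sqrtr0. Qed.

(** At a boundary point in [U], [A] has the normal of [Omega] and the zero flux assumption applies;
    at the others it has the normal opposite to that of [D], and the Neumann condition of the
    potential changes sign. *)
Let neumannA x : bdry A x -> normal_derivative A A phi x = 0.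
Proof.
move=> bx; have [cx _] := bdA bx; have [Ux|nUx] := pselect (U x).
  have [bOx [d d0 hd]] := bdryA_outer bx Ux.
  have [r [e [gamma [lg cg]]]] := smO bOx; have [r0 _ _] := lg.
  have m0 : 0 < Num.min r d by rewrite lt_min r0.
  have lgA : local_graph A x (Num.min r d) e gamma.
    apply: (@local_graph_eq _ Omega); last by move=> y; rewrite lt_min => /andP[_]; exact: hd.
    apply: local_graph_shrink lg m0 _.
    by rewrite subrr /enorm dotE !mxE mulr0 addr0 sqrtr0 add0r ge_min lexx.
  rewrite -(flux0 bOx) /normal_derivative (grad_traceA cx).
  rewrite (outward_normalE oA lgA cg bx (enorm_xx _ m0)).
  by rewrite (outward_normalE oO lg cg bOx (enorm_xx _ r0)).
have [bDx [d d0 hd]] := bdryA_inner bx nUx.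
have [r [e [gamma [lg cg]]]] := smD bDx; have [r0 _ _] := lg.
have m0 : 0 < Num.min r d by rewrite lt_min r0.
have lgA : local_graph A x (Num.min r d) (- e) (fun s => - gamma (- s)).
  apply: (@local_graph_eq _ U); last by move=> y; rewrite lt_min => /andP[_]; exact: hd.
  apply: local_graph_shrink (local_graph_flip oD lg cg) m0 _.
  by rewrite subrr /enorm dotE !mxE mulr0 addr0 sqrtr0 add0r ge_min lexx.
have [cg' _] := C1_fun_flip cg.
have [_ _ /(_ x bDx) + _] := potphi.
rewrite /normal_derivative (grad_traceA cx) (outward_normalE oD lg cg bDx (enorm_xx _ r0)).
rewrite (outward_normalE oA lgA cg' bx (enorm_xx _ m0)) graph_normal_flip// enormN.
by rewrite scalerN dotNr => ->; rewrite oppr0.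
Qed.

Lemma potential_constant_on_component : A !=set0 ->
  exists M : R, forall x, W x -> phi x = M.
Proof.
move=> A0; have [hphi cphi _ _] := potphi.
have hA := harmonic_onS AU hphi; have cA := C1_closureS AU cphi.
have bA : bounded_set A.
  by have [K [Kr hK]] := bO; exists K; split => // N KN x [_ Ox]; exact: hK N KN x Ox.
have [y Ay] := A0.
have cA0 : closure A !=set0 by exists y; exact: subset_closure.
have [x0 /set_mem Ax0 xmax] := compact_EVT_max cA0 (compact_closure bA) cA.1.
pose M := phi x0; have leM x : closure A x -> phi x <= M by move=> cx; apply: xmax; exact/mem_set.
have [x1 Ax1 x1M] := neumann_max_interior oA bA hA cA smA neumannA leM Ax0 erefl.
have cW : connected W by exact: component_connected.
suff near1 : \forall x \near x1, phi x = M.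
  by exists M; exact: unique_continuation oW cW (harmonic_onS WU hphi) Ax1.1 near1.
have [_ _ lapA] := hA.
have lap x : A x -> partial 0 (partial 0 phi) x + partial 1 (partial 1 phi) x = 0.
  move=> /lapA; rewrite /laplacian big_ord_recl big_ord1.
  by rewrite (_ : lift ord0 ord0 = 1); [|exact/val_inj].
apply: (strong_max_near oA bA cA.1 (harmonic_twice hA) _ leM Ax1 x1M).
by move=> x /lap ->.
Qed.

End flux.

Lemma zero_flux_constant Omega D (H phi : V -> R) :
  open Omega -> bounded_set Omega -> of_class_C1 Omega ->
  open D -> D !=set0 -> of_class_C1 D -> closure D `<=` Omega ->
  harmonic_on setT H -> is_potential D H phi ->
  (forall x, bdry Omega x -> normal_derivative Omega (~` closure D) phi x = 0) ->
  exists k : R, forall x, H x = k.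
Proof.
move=> oO bO smO oD D0 smD sub hH pot flux0.
set U := ~` closure D; have oU : open U by exact/closed_openC/closed_closure.
have [K K0 hK] : exists2 K : R, 0 < K & forall x, Omega x -> `|x| <= K.
  have [K [_ hK]] := bO; exists (`|K| + 1); first by rewrite ltr_wpDl.
  by move=> x Ox; apply: (hK (`|K| + 1)) => //; have := ler_norm K; lra.
have farU x : K < `|x| -> U x.
  by move=> Kx cDx; have := hK x (sub _ cDx); rewrite leNgt Kx.
pose p : V := pt (K + 1) (K + 1).
have pK : K < `|p|.
  apply: lt_le_trans (coord_le_norm p 0); rewrite mxE /= ger0_norm; lra.
pose W := connected_component U p.
have WU : W `<=` U by exact: connected_component_sub.
have oW : open W by exact: open_connected_component.
(* A limit point of [W] outside [U] lies in [closure D], hence in the open set [Omega]. If [W]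
   missed [Omega] it would therefore be closed as well as open, hence the whole plane, although [D]
   is not empty. *)
have WO : (W `&` Omega) !=set0.
  apply: contrapT => nWO.
  have cW : closed W.
    move=> x cx; have [Ux|nUx] := pselect (U x); first exact: closure_connected_component.
    have Ox : Omega x by apply: sub; apply: contrapT.
    have [y [Wy Oy]] := cx _ (open_nbhs_nbhs (conj oO Ox)).
    by exfalso; apply: nWO; exists y.
  have WT : W = setT.
    apply: connected_plane.
    - by exists p; apply: connected_component_refl; exact: farU.
    - by exists W => //; rewrite setTI.
    - by exists W => //; rewrite setTI.
  have [x Dx] := D0; have : W x by rewrite WT.
  by move=> /WU; apply; exact: subset_closure.
have [M hM] := potential_constant_on_component oO bO smO oD smD sub pot flux0 WO.
have [_ _ _ [C [r0 dec]]] := pot.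
(* Beyond the Euclidean radius [2 * K] the sup norm exceeds [K], so the point lies in [W], where
   [phi] equals [M] and its decay to [H] becomes a decay of [H] to [M]. *)
exists M; apply: (@liouville_decay H M C (Num.max r0 (2 * K)) hH) => x.
rewrite gt_max => /andP[xr xK]; rewrite distrC.
have Kx : K < `|x| by have := enorm_le_normr x; lra.
have Wx : W x by exact: exterior_connected K0 farU _ Kx.
by rewrite -(hM x Wx); exact: dec.
Qed.

End rigidity.

(** * Continuity of normal derivatives on the boundary, and the resulting quadratic functional *)

Section boundary_data.
Context {R : realType}.
Notation V := 'rV[R]_2.
Implicit Types (x y z : V) (A B Omega D : set V).

Lemma within_cvg_enormP B (f : V -> R) x (l : R) :
  f @ within B (nbhs x) --> l <->
  forall eps : R, 0 < eps -> exists2 d : R, 0 < d &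
    forall y, B y -> enorm (y - x) < d -> `|f y - l| < eps.
Proof.
split=> [h eps eps0|h S /nbhs_ballP[eps /= eps0 hS]].
  have [d d0 hd] := (nbhs_enormP x (fun y => B y -> ball l eps (f y))).1 (h _ (nbhsx_ballx l eps eps0)).
  exists d => // y By yd; have := hd y yd By.
  by rewrite -ball_normE /= distrC.
have [d d0 hd] := h eps eps0.
apply/(nbhs_enormP x (fun y => B y -> S (f y))); exists d => // y yd By; apply: hS.
by rewrite -ball_normE /= distrC; exact: hd.
Qed.

Lemma within_continuousP B (f : V -> R) :
  {within B, continuous f} <-> forall x, B x -> f @ within B (nbhs x) --> f x.
Proof. exact: subspace_continuousP. Qed.

Lemma within_cvg_near_eq B (f g : V -> R) x (r : R) : B x -> 0 < r ->
  (forall y, B y -> enorm (y - x) < r -> f y = g y) -> {for x, continuous g} ->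
  f @ within B (nbhs x) --> f x.
Proof.
move=> Bx r0 fg cg S; rewrite fg//; last first.
  by rewrite subrr /enorm dotE !mxE mulr0 addr0 sqrtr0.
move=> /cg /(nbhs_enormP x (g @^-1` S))[d d0 hd].
apply/(nbhs_enormP x (fun y => B y -> S (f y))); exists (Num.min r d).
  by rewrite lt_min r0.
by move=> y; rewrite lt_min => /andP[yr yd] By; rewrite fg//; exact: hd.
Qed.

Lemma cvg_coord B (v : V -> V) x (l : V) (i : 'I_2) :
  v @ within B (nbhs x) --> l -> (fun y => v y 0 i) @ within B (nbhs x) --> l 0 i.
Proof. by move=> h S hS; exact: (h _ (continuous_coord hS)). Qed.

Lemma within_continuous_dot B (v w : V -> V) :
  (forall i, {within B, continuous (fun x => v x 0 i)}) ->
  (forall i, {within B, continuous (fun x => w x 0 i)}) ->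
  {within B, continuous (fun x => dot (v x) (w x))}.
Proof.
move=> cv cw; apply/within_continuousP => x Bx.
have hv i := (within_continuousP _ _).1 (cv i) x Bx.
have hw i := (within_continuousP _ _).1 (cw i) x Bx.
rewrite (_ : (fun y => dot (v y) (w y)) = fun y => v y 0 0 * w y 0 0 + v y 0 1 * w y 0 1).
  by rewrite dotE; exact: (cvgD (cvgM (hv 0) (hw 0)) (cvgM (hv 1) (hw 1))).
by apply/funext => y; rewrite dotE.
Qed.

(** The trace at [z] is within [eps / 2] of the gradient at some [y] of [A] close to [z]; such a [y]
    is also close to [x], so its gradient is within [eps / 2] of the trace at [x]. *)
Lemma within_continuous_grad_trace A (f : V -> R) (i : 'I_2) : C1_closure A f ->
  {within closure A, continuous (fun x => grad_trace A f x 0 i)}.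
Proof.
move=> [_ gf]; apply/within_continuousP => x Ax.
apply/within_cvg_enormP => eps eps0.
have gx z : closure A z -> (fun y => grad f y 0 i) @ within A (nbhs z) --> grad_trace A f z 0 i.
  by move=> /gf; exact: cvg_coord.
have e2 : 0 < eps / 2 by rewrite divr_gt0.
have [d d0 hd] := (within_cvg_enormP _ _ _ _).1 (gx x Ax) _ e2.
exists d => // z Az zd.
have [d' d'0 hd'] := (within_cvg_enormP _ _ _ _).1 (gx z Az) _ e2.
have nz : nbhs z [set y | enorm (y - z) < Num.min d' (d - enorm (z - x))].
  by apply/nbhs_enormP; exists (Num.min d' (d - enorm (z - x))) => //; rewrite lt_min d'0 subr_gt0.
have [y [Ay /=]] := Az _ nz; rewrite lt_min => /andP[yd' yd].
have h1 := hd' y Ay yd'.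
have h2 : `|grad f y 0 i - grad_trace A f x 0 i| < eps / 2.
  apply: hd => //; have := ler_enormD (y - z) (z - x); rewrite addrA subrK; lra.
apply: le_lt_trans (ler_distD (grad f y 0 i) _ _) _.
by rewrite distrC (splitr eps); exact: ltrD.
Qed.

Lemma C1_closure_setT (f : V -> R) : C1_on setT f -> C1_closure setT f.
Proof.
move=> cf; split.
  apply: continuous_subspaceT => x.
  by have [/differentiable_continuous] := cf x I.
move=> x _; apply/cvg_ex; exists (grad f x) => S /nbhs_normP[eps /= eps0 hS].
have c i : (fun y => grad f y 0 i) @ within setT (nbhs x) --> grad f x 0 i.
  have [_ /(_ i) ci] := cf x I; move=> T hT.
  have {}hT : nbhs (partial i f x) T by move: hT; rewrite mxE.
  have := ci _ hT; apply: (@filterS _ (nbhs x)) => y hy _.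
  by rewrite /= mxE.
have [d0 d00 h0] := (within_cvg_enormP _ _ _ _).1 (c 0) _ eps0.
have [d1 d10 h1] := (within_cvg_enormP _ _ _ _).1 (c 1) _ eps0.
apply/(nbhs_enormP x (fun y => setT y -> S (grad f y))); exists (Num.min d0 d1).
  by rewrite lt_min d00.
move=> y; rewrite lt_min => /andP[y0 y1] _; apply: hS; rewrite /= distrC.
apply: norm_lt_coord.
  have -> : (grad f y - grad f x) 0 0 = grad f y 0 0 - grad f x 0 0.
    by rewrite [LHS]mxE [X in _ + X]mxE.
  exact: h0.
have -> : (grad f y - grad f x) 0 1 = grad f y 0 1 - grad f x 0 1.
    by rewrite [LHS]mxE [X in _ + X]mxE.
exact: h1.
Qed.

(** One chart around [x] computes the normal at all nearby boundary points, through the continuous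
    slope [derive1 gamma]. *)
Lemma within_continuous_outward_normal Omega (i : 'I_2) : open Omega -> of_class_C1 Omega ->
  {within bdry Omega, continuous (fun x => outward_normal Omega x 0 i)}.
Proof.
move=> oO sm; apply/within_continuousP => x bx.
have [r [e [gamma [lg cg]]]] := sm x bx; have [r0 e1 _] := lg.
pose s y := derive1 gamma (dot y (rot90 e)).
have cs : {for x, continuous s}.
  by apply: continuous_comp; [exact: continuous_dotl|have [_] := cg; exact].
pose F y := (Num.sqrt (1 + s y * s y))^-1 * (e 0 i - s y * rot90 e 0 i).
have cF : {for x, continuous F}.
  have h1 : (fun y => 1 + s y * s y) @ x --> 1 + s x * s x.
    exact: (cvgD (cvg_cst _) (cvgM cs cs)).
  have h2 : (fun y => Num.sqrt (1 + s y * s y)) @ x --> Num.sqrt (1 + s x * s x).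
    by apply: cvg_comp h1 _; exact: sqrt_continuous.
  have n0 : Num.sqrt (1 + s x * s x) != 0.
    by rewrite gt_eqF// sqrtr_gt0 ltr_pwDl// -expr2 sqr_ge0.
  exact: (cvgM (cvgV n0 h2) (cvgB (cvg_cst _) (cvgM cs (cvg_cst _)))).
have NE y : bdry Omega y -> enorm (y - x) < r -> outward_normal Omega y 0 i = F y.
  move=> By yr; rewrite (outward_normalE oO lg cg By yr) mxE /F /s.
  by rewrite {1}/enorm graph_normal_sqr// expr2 !mxE.
exact: within_cvg_near_eq bx r0 NE cF.
Qed.

Lemma within_continuous_normal_derivative Omega A (f : V -> R) :
  open Omega -> of_class_C1 Omega -> bdry Omega `<=` closure A -> C1_closure A f ->
  {within bdry Omega, continuous (normal_derivative Omega A f)}.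
Proof.
move=> oO sm sub cf; apply: within_continuous_dot => i.
  apply: continuous_subspaceW sub _; exact: within_continuous_grad_trace.
exact: within_continuous_outward_normal.
Qed.

(** In the reversed chart the exterior is a subgraph with [x] on its graph. Traces taken from
    outside, as for the shielding pressure, are thereby defined on the whole boundary. *)
Lemma bdry_closure_exterior Omega : open Omega -> of_class_C1 Omega ->
  bdry Omega `<=` closure (~` closure Omega).
Proof.
move=> oO sm x bx; have [r [e [gamma [lg cg]]]] := sm x bx; have [r0 _ _] := lg.
have xr : enorm (x - x) < r by rewrite subrr /enorm dotE !mxE mulr0 addr0 sqrtr0.
have oE : open (~` closure Omega) by exact/closed_openC/closed_closure.
have [cg' _] := C1_fun_flip cg.
apply/(local_graph_closure oE (local_graph_flip oO lg cg) cg' xr).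
by rewrite rot90N !dotNr opprK (local_graph_bdry oO lg cg bx xr).
Qed.

Lemma bounded_within_continuous B (f : V -> R) : compact B ->
  {within B, continuous f} -> [bounded f x | x in B].
Proof.
move=> cB cf; have [M [Mr hM]] := compact_bounded (continuous_compact cf cB).
by exists M; split => // N MN x Bx; apply: (hM N MN); exists x.
Qed.

(** By continuity [|h|] is at least half of [|h x1|] on the part of the boundary in a small disc
    about [x1], and that part has positive length. *)
Lemma integral_sqr_bdry_gt0 Omega (h : V -> R) x1 :
  open Omega -> bounded_set Omega -> of_class_C1 Omega ->
  {within bdry Omega, continuous h} -> bdry Omega x1 -> h x1 != 0 ->
  0 < \int[arc_length]_(x in bdry Omega) (h x ^+ 2).
Proof.
move=> oO bO sm ch bx1 h1.
have mB : measurable (bdry Omega : set (caratheodory_type (@hausdorff1_outer R))).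
  exact: closed_measurable_arc (@closed_bdry _ Omega).
have e0 : 0 < `|h x1| / 2 by rewrite divr_gt0// normr_gt0.
have [d d0 hd] := (within_cvg_enormP _ _ _ _).1 ((within_continuousP _ _).1 ch x1 bx1) _ e0.
pose S := bdry Omega `&` [set y | enorm (y - x1) < d].
have mS : measurable (S : set (caratheodory_type (@hausdorff1_outer R))).
  apply: measurableI mB _.
  have oE := @open_eball R x1 d.
  exact: (open_measurable_arc oE).
have ch2 : {within bdry Omega, continuous (fun x => h x ^+ 2)}.
  apply/within_continuousP => x Bx; have hx := (within_continuousP _ _).1 ch x Bx.
  exact: (cvgM hx hx).
have mh2 := within_continuous_measurable_arc (@closed_bdry _ Omega) ch2.
have bh2 := bounded_within_continuous (compact_bdry bO) ch2.
have fB : (arc_length (bdry Omega) < +oo)%E by exact: hausdorff1_bdry_lty.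
have ih2 := measurable_bounded_integrable mB fB mh2 bh2.
have fin := integrable_fin_num mB ih2.
apply: fine_gt0; rewrite ltey_eq fin andbT.
pose c := (`|h x1| / 2) ^+ 2.
have c0 : 0 < c by rewrite exprn_gt0.
have S0 : (0 < c%:E * arc_length S)%E.
  by apply: mule_gt0; [rewrite lte_fin|exact: hausdorff1_bdry_gt0].
apply: lt_le_trans S0 _; rewrite -integral_cst//.
have [mh _] := integrableP _ _ _ ih2.
have SB : S `<=` bdry Omega by move=> x [].
have mhS := measurable_funS mB SB mh.
apply: (@le_trans _ _ (\int[arc_length]_(x in S) (h x ^+ 2)%:E)%E).
  apply: ge0_le_integral => //.
  - by move=> x _; rewrite lee_fin ltW.
  move=> x [Bx xd]; rewrite lee_fin /c -[leRHS]real_normK ?num_real//.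
    rewrite ler_pXn2r ?nnegrE//.
    have := hd x Bx xd; have := ler_distD (h x) (h x1) 0; rewrite !subr0 distrC; lra.
apply: ge0_subset_integral => //.
by move=> x _; rewrite lee_fin sqr_ge0.
Qed.

Lemma L2norm_quadratic Omega (g h : V -> R) x1 :
  open Omega -> bounded_set Omega -> of_class_C1 Omega ->
  {within bdry Omega, continuous g} -> {within bdry Omega, continuous h} ->
  bdry Omega x1 -> h x1 != 0 -> exists A B C : R, 0 < C /\ forall z : R,
  (L2norm (bdry Omega) (fun x => (g x - 12 * z * h x)%R) ^+ 2)%E = (A - B * z + C * z ^+ 2)%:E.
Proof.
move=> oO bO sm cg ch bx1 h1; apply: L2_quadratic.
- exact: closed_measurable_arc (@closed_bdry _ Omega).
- exact: hausdorff1_bdry_lty.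
- exact: within_continuous_measurable_arc (@closed_bdry _ Omega) cg.
- exact: within_continuous_measurable_arc (@closed_bdry _ Omega) ch.
- exact: bounded_within_continuous (compact_bdry bO) cg.
- exact: bounded_within_continuous (compact_bdry bO) ch.
- by rewrite ltr0n.
- exact: integral_sqr_bdry_gt0 bx1 h1.
Qed.

End boundary_data.

Theorem theorem4p1 (R : realType) (alpha a b c d : R)
    (Omega D : set 'rV[R]_2) (H P phi : 'rV[R]_2 -> R)
    (alpha_gt0 : 0 < alpha) (alpha_lt1 : alpha < 1)
    (le_ab : a <= b) (le_cd : c <= d)
    (domOmega : is_domain Omega) (bndOmega : bounded_set Omega)
    (domD : is_domain D) (subD : closure D `<=` Omega)
    (regOmega : of_class_C1alpha alpha Omega) (regD : of_class_C1alpha alpha D)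
    (harmH : harmonic_on setT H) (harmP : harmonic_on setT P)
    (nonconstH : ~ exists k : R, forall x, H x = k)
    (potphi : is_potential D H phi) :
  (forall p, is_cloaking_pressure Omega D P p ->
    exists! zeta0, minimizes (cloaking_functional Omega D P phi p)
                             [set` `[a, b]] zeta0) /\
  (forall p, is_shielding_pressure Omega P p ->
    exists! zeta0, minimizes (shielding_functional Omega D phi p)
                             [set` `[c, d]] zeta0).
Proof.
have [oO _ _] := domOmega; have [oD _ D0] := domD.
have smO : of_class_C1 Omega.
  by move=> x /regOmega[r [e [gamma [lg cg _]]]]; exists r, e, gamma.
have smD : of_class_C1 D.
  by move=> x /regD[r [e [gamma [lg cg _]]]]; exists r, e, gamma.
have bdryU : bdry Omega `<=` ~` closure D.
  by move=> x [_ nx] /subD Ox; apply: nx; rewrite /= -/(interior Omega) (interior_id _).1.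
have [_ cphi _ _] := potphi.
have ch : {within bdry Omega, continuous (normal_derivative Omega (~` closure D) phi)}.
  by apply: within_continuous_normal_derivative => // x /bdryU; exact: subset_closure.
have [x1 bx1 h1] : exists2 x1, bdry Omega x1 & normal_derivative Omega (~` closure D) phi x1 != 0.
  (* A flux vanishing at every boundary point would force [H] to be constant. *)
  apply: contrapT => nh; apply: nonconstH.
  apply: (zero_flux_constant oO bndOmega smO oD D0 smD subD harmH potphi) => x bx.
  by apply: contrapT => /eqP hx; apply: nh; exists x.
split=> p.
  move=> [_ cp _ _].
  have cg : {within bdry Omega, continuous (fun x => normal_derivative Omega setT P x -
      normal_derivative Omega (Omega `\` closure D) p x)}.
    have cP : {within bdry Omega, continuous (normal_derivative Omega setT P)}.
      apply: within_continuous_normal_derivative => //.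
        by rewrite closureT.
      by have [hP _ _] := harmP; exact: C1_closure_setT.
    have cQ : {within bdry Omega, continuous (normal_derivative Omega (Omega `\` closure D) p)}.
      (* The boundary of [Omega] keeps away from [closure D], so points of [Omega] close enough to
         it belong to the domain of the pressure. *)
      apply: within_continuous_normal_derivative => // x bx S Sx.
      have nU : nbhs x (~` closure D).
        by apply: open_nbhs_nbhs; split; [exact/closed_openC/closed_closure|exact: bdryU].
      have [y [Oy [Sy Uy]]] := bx.1 _ (filterI Sx nU).
      by exists y.
    apply/within_continuousP => x bx.
    exact: (cvgB ((within_continuousP _ _).1 cP x bx) ((within_continuousP _ _).1 cQ x bx)).
  have [A [B [C [C0 E]]]] := L2norm_quadratic oO bndOmega smO cg ch bx1 h1.
  exact: (minimizes_quadratic C0 le_ab E).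
move=> [_ cp _ _].
have cg : {within bdry Omega, continuous (normal_derivative Omega (~` closure Omega) p)}.
  by apply: within_continuous_normal_derivative => //; exact: bdry_closure_exterior.
have [A [B [C [C0 E]]]] := L2norm_quadratic oO bndOmega smO cg ch bx1 h1.
exact: (minimizes_quadratic C0 le_cd E).
Qed.
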